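(* Let $p$ be an odd prime, $S$ a finite $p$-group and $\mathcal{F}$ a saturated fusion system on $S$. Let $E_1$ and $E_2$ be distinct $\mathcal{F}$-essential subgroups of $S$, both $\mathcal{F}$-characteristic in $S$ and both of sectional rank at most $3$. Then, after possibly interchanging $E_1$ and $E_2$, one of the following holds: (1) $O^{p'}(\mathrm{Out}_{\mathcal{F}}(E_1))\cong O^{p'}(\mathrm{Out}_{\mathcal{F}}(E_2))\cong\mathrm{SL}_2(p)$; or (2) $O^{p'}(\mathrm{Out}_{\mathcal{F}}(E_1))\cong\mathrm{PSL}_2(p)$, $O^{p'}(\mathrm{Out}_{\mathcal{F}}(E_2))\cong\mathrm{SL}_2(p)$ and $S$ has rank $2$.
   Context: Rank: minimal size of a generating set; a group has sectional rank at most $k$ if all its subgroups have rank at most $k$. For $P\le S$, $\mathrm{Aut}_{\mathcal{F}}(P)=\mathrm{Hom}_{\mathcal{F}}(P,P)$, $\mathrm{Out}_{\mathcal{F}}(P)=\mathrm{Aut}_{\mathcal{F}}(P)/\mathrm{Inn}(P)$, $P^{\mathcal{F}}=\{P\alpha:\alpha\in\mathrm{Hom}_{\mathcal{F}}(P,S)\}$. $E\le S$ is $\mathcal{F}$-essential if $C_S(P)\le P$ and $|N_S(E)|\ge|N_S(P)|$ for all $P\in E^{\mathcal{F}}$, and $\mathrm{Out}_{\mathcal{F}}(E)$ has a strongly $p$-embedded subgroup. $E$ is $\mathcal{F}$-characteristic in $S$ if $E$ is normalized by $\mathrm{Aut}_{\mathcal{F}}(S)$. $O^{p'}(G)$ is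 the subgroup of $G$ generated by its $p$-elements. *)

(* Defs.v *)
From mathcomp Require Import all_boot all_order all_algebra all_fingroup all_solvable.
Set Implicit Arguments. Unset Strict Implicit. Unset Printing Implicit Defensive.
Import GroupScope.

(* Fusion systems on a finite group S (subgroups of gT).  A morphism of
   F defined on P is encoded as a finite function gT -> gT which is an
   injective homomorphism on P with image in S and value 1 outside P
   (normalised).  [F P] is the set Hom_F(P, S); Hom_F(P,Q) is the subset of
   those f with f @: P \subset Q. *)

Section FusionDefs.
Variable gT : finGroupType.
Implicit Types (P Q : {set gT}) (f : {ffun gT -> gT}).

Definition nrm (P : {set gT}) (f : gT -> gT) : {ffun gT -> gT} :=
  [ffun x => if x \in P then f x else 1].

Definition homF (F : {set gT} -> {set {ffun gT -> gT}}) P Q :=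
  [set f in F P | f @: P \subset Q].

(* Axioms of a fusion system on S (Aschbacher-Kessar-Oliver, Def. I.2.1) *)
Definition is_fusion_system (S : {group gT})
    (F : {set gT} -> {set {ffun gT -> gT}}) : Prop :=
  (forall P : {set gT}, ~~ (group_set P && (P \subset S)) -> F P = set0) /\
  (forall (P : {group gT}) f, P \subset S -> f \in F P ->
        [/\ {in P &, {morph f : x y / x * y}}, {in P &, injective f},
            f @: P \subset S & {in ~: P, forall x, f x = 1}]) /\
  (forall (P : {group gT}) g, P \subset S -> g \in S ->
        nrm P (conjg^~ g) \in F P) /\
  (forall (P Q : {group gT}) f, P \subset S -> Q \subset P -> f \in F P ->
        nrm Q f \in F Q) /\
  (forall (P : {group gT}) f h, P \subset S -> f \in F P ->
        h \in F (f @: P) -> nrm P (fun x => h (f x)) \in F P) /\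
  (forall (P : {group gT}) f, P \subset S -> f \in F P ->
        exists2 h, h \in F (f @: P) & {in P, forall x, h (f x) = x}).

Definition conjF (F : {set gT} -> {set {ffun gT -> gT}}) P : {set {set gT}} :=
  [set f @: P | f : {ffun gT -> gT} in F P].

Definition AutF (F : {set gT} -> {set {ffun gT -> gT}}) P : {set {perm gT}} :=
  [set a in Aut P | nrm P a \in F P].

Definition AutS (S P : {group gT}) := conj_aut P @* 'N_S(P).
Definition Inn (P : {group gT}) := conj_aut P @* P.

Definition OutF (F : {set gT} -> {set {ffun gT -> gT}}) (P : {group gT}) :=
  AutF F P / Inn P.

Definition fully_normalized (S : {group gT}) (F : {set gT} -> {set {ffun gT -> gT}}) P :=
  forall Q, Q \in conjF F P -> #|'N_S(Q)| <= #|'N_S(P)|.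
Definition fully_centralized (S : {group gT}) (F : {set gT} -> {set {ffun gT -> gT}}) P :=
  forall Q, Q \in conjF F P -> #|'C_S(Q)| <= #|'C_S(P)|.
Definition fully_automized (p : nat) (S : {group gT}) (F : {set gT} -> {set {ffun gT -> gT}}) (P : {group gT}) :=
  p.-Sylow(AutF F P) (AutS S P).

Definition Nphi (S : {group gT}) (Q P : {set gT}) f : {set gT} :=
  [set y in 'N_S(Q) |
     [exists z in 'N_S(P), [forall x in Q, f (x ^ y) == f x ^ z]]].

Definition receptive (S : {group gT}) (F : {set gT} -> {set {ffun gT -> gT}}) P :=
  forall (Q : {group gT}) f, f \in F Q -> f @: Q = P ->
    exists2 g, g \in F (Nphi S Q P f) & {in Q, forall x, g x = f x}.

(* saturation (AKO Def. I.2.2: Sylow axiom and extension axiom) *)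
Definition saturated (p : nat) (S : {group gT}) (F : {set gT} -> {set {ffun gT -> gT}}) : Prop :=
  forall P : {group gT}, P \subset S ->
    (fully_normalized S F P ->
       fully_centralized S F P /\ fully_automized p S F P) /\
    (fully_centralized S F P -> receptive S F P).

Definition F_characteristic (S : {group gT}) (F : {set gT} -> {set {ffun gT -> gT}}) (E : {set gT}) :=
  forall a, a \in AutF F S -> a @: E = E.

End FusionDefs.

Definition strongly_p_embedded (p : nat) (rT : finGroupType)
    (G : {set rT}) (H : {group rT}) :=
  [/\ H \proper G, p %| #|H| &
      forall x, x \in G :\: H -> ~~ (p %| #|H :&: H :^ x|)].

Definition has_strongly_p_embedded (p : nat) (rT : finGroupType) (G : {set rT}) :=
  exists H : {group rT}, strongly_p_embedded p G H.

Definition essential (p : nat) (gT : finGroupType) (S : {group gT})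
    (F : {set gT} -> {set {ffun gT -> gT}}) (E : {group gT}) :=
  [/\ E \subset S,
      forall Q, Q \in conjF F E -> 'C_S(Q) \subset Q,
      fully_normalized S F E
    & has_strongly_p_embedded p (OutF F E)].

Definition grank (gT : finGroupType) (G : {set gT}) : nat :=
  \big[minn/#|G|]_(A : {set gT} | <<A>> == G) #|A|.

Definition sect_rank_le (gT : finGroupType) (G : {set gT}) (k : nat) :=
  forall H : {group gT}, H \subset G -> grank H <= k.

Definition Opprime (p : nat) (rT : finGroupType) (G : {set rT}) : {set rT} :=
  <<[set x in G | p.-elt x]>>.

Definition SL2 (p : nat) : {set {'GL_2['F_p]}} :=
  [set A | (\det (GLval A) == 1)%R].
Definition PSL2 (p : nat) := SL2 p / 'Z(SL2 p).

(* Main.v *)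
(** Let E be one of the two subgroups and G = Out_F(E), acting faithfully on
    E/Phi(E), an F_p-space of dimension at most 3. Since G has a strongly p-embedded
    subgroup, commuting nontrivial p-elements lie in the same conjugates of it; this
    gives two possibilities.

    - Some p-element of G acts as a transvection (always so in dimension 2). Then two
      transvections in different conjugates of the strongly p-embedded subgroup span a
      copy of SL_2(p), which contains all p-elements.
    - G contains no transvection (E is "regular"). Then every nontrivial p-element is a
      single Jordan block of size 3, Sylow subgroups have order p, and G is irreducible.

    In both cases |S : E| = p, so S = E1 E2 and E1, E2 act on each other.

    Both regular: if M <= E is Aut_F(E)-invariant with M/Phi(M) irreducible of order p^3
    and Phi(M) <> 1, then sectional rank 3 and p odd force the p-power map
    M/Phi(M) -> Phi(M)/Phi(Phi(M)) to be an isomorphism. Hence elements of E outside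
    Phi(E) have larger order than elements of Phi(E). But for e in E2 outside E1 some
    [x,e,e] lies in E1 outside Phi(E1) and in Phi(E2), and symmetrically, which is absurd.

    E1 regular and O^p'(Out_F(E2)) = SL_2(p): the central involution of SL_2(p) extends to
    an involution of S trivial on S/E2 and inverting S/E1. On E1/Phi(E1) it normalises
    Out_F(E1) and inverts a regular unipotent element; comparing p-elements with their
    images under this reflection identifies O^p'(Out_F(E1)) with the image of SL_2(p) on
    its symmetric square, that is, with PSL_2(p). Regularity also shows that S is
    generated by two elements. *)
Require Import Defs.
From mathcomp Require Import all_boot all_order all_algebra all_fingroup all_solvable all_character.
From mathcomp Require Import ring zify.
Set Implicit Arguments. Unset Strict Implicit. Unset Printing Implicit Defensive.
Import GroupScope GRing.Theory.

(** * Explicit small matrices *)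

(** The field enters as one of characteristic p in which every element is a natural multiple of 1. A
    one-parameter unipotent group is then cyclic, so one nontrivial element yields all of it, and
    additive maps are linear. The action on E/Phi(E) is faithful because an automorphism trivial
    there is a p-element, while a strongly p-embedded subgroup excludes nontrivial normal
    p-subgroups.

    Unwanted elements are excluded in two ways. With transvections, they would tie all of SL_2(p) to
    one conjugate of the strongly p-embedded subgroup: two transvections with a vanishing pairing
    are linked by their commutator, which commutes with both. Without transvections, a word in them
    would be a nontrivial g with (g - 1)^2 = 0.

    The power map is not a homomorphism on M. With R = Phi(M) it becomes one modulo Phi(R)[R, M],
    where M has class at most 2. Its kernel is invariant, so irreducibility leaves two cases:
    exponent p, or injectivity modulo R. Exponent p is refuted through abelian subgroups of index p
    or a section of rank 4. *)

Section Matrices3.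
Local Open Scope ring_scope.
Variable F : fieldType.

Definition mx3 (a b c d e f g h i : F) : 'M[F]_3 :=
  \matrix_(x, y) nth 0 (nth [::] [:: [:: a; b; c]; [:: d; e; f]; [:: g; h; i]] x) y.

Definition mx2 (a b c d : F) : 'M[F]_2 :=
  \matrix_(x, y) nth 0 (nth [::] [:: [:: a; b]; [:: c; d]] x) y.

Definition rv3 (x y z : F) : 'rV[F]_3 := \row_i nth 0 [:: x; y; z] i.

Let o0 : 'I_3 := ord0.
Let o1 : 'I_3 := lift ord0 ord0.
Let o2 : 'I_3 := ord_max.

Lemma mx3E (A : 'M[F]_3) :
  A = mx3 (A o0 o0) (A o0 o1) (A o0 o2) (A o1 o0) (A o1 o1) (A o1 o2)
          (A o2 o0) (A o2 o1) (A o2 o2).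
Proof.
apply/matrixP=> x y; rewrite mxE.
by case: x => [[|[|[|x]]] lx] //; case: y => [[|[|[|y]]] ly] //=;
  congr (A _ _); apply: val_inj.
Qed.

Lemma mx3P (A : 'M[F]_3) : exists a b c d e f g h i, A = mx3 a b c d e f g h i.
Proof. by do 9!eexists; apply: mx3E. Qed.

Lemma mx2P (A : 'M[F]_2) : exists a b c d, A = mx2 a b c d.
Proof.
exists (A ord0 ord0), (A ord0 ord_max), (A ord_max ord0), (A ord_max ord_max).
apply/matrixP=> x y; rewrite mxE.
by case: x => [[|[|x]] lx] //; case: y => [[|[|y]] ly] //=;
  congr (A _ _); apply: val_inj.
Qed.

Lemma rv3P (v : 'rV[F]_3) : exists x y z, v = rv3 x y z.
Proof.
exists (v 0 o0), (v 0 o1), (v 0 o2); apply/rowP=> j; rewrite mxE.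
by case: j => [[|[|[|j]]] lj] //=; congr (v _ _); apply: val_inj.
Qed.

Lemma mx3_inj a b c d e f g h i a' b' c' d' e' f' g' h' i' :
  mx3 a b c d e f g h i = mx3 a' b' c' d' e' f' g' h' i' ->
  ((a = a') * (b = b') * (c = c') * (d = d') * (e = e') * (f = f')
   * (g = g') * (h = h') * (i = i'))%type.
Proof.
move=> /matrixP E.
have := (E o0 o0, E o0 o1, E o0 o2, E o1 o0, E o1 o1, E o1 o2, E o2 o0, E o2 o1, E o2 o2).
by rewrite !mxE.
Qed.

Lemma mx2_inj a b c d a' b' c' d' :
  mx2 a b c d = mx2 a' b' c' d' -> ((a = a') * (b = b') * (c = c') * (d = d'))%type.
Proof.
move=> /matrixP E.
have := (E ord0 ord0, E ord0 ord_max, E ord_max ord0, E ord_max ord_max).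
by rewrite !mxE.
Qed.

Lemma rv3_inj x y z x' y' z' :
  rv3 x y z = rv3 x' y' z' -> ((x = x') * (y = y') * (z = z'))%type.
Proof. by move=> /rowP E; have := (E o0, E o1, E o2); rewrite !mxE. Qed.

Lemma mx3M a b c d e f g h i a' b' c' d' e' f' g' h' i' :
  mx3 a b c d e f g h i *m mx3 a' b' c' d' e' f' g' h' i' =
  mx3 (a*a'+b*d'+c*g') (a*b'+b*e'+c*h') (a*c'+b*f'+c*i')
      (d*a'+e*d'+f*g') (d*b'+e*e'+f*h') (d*c'+e*f'+f*i')
      (g*a'+h*d'+i*g') (g*b'+h*e'+i*h') (g*c'+h*f'+i*i').
Proof.
apply/matrixP=> x y; rewrite !mxE !big_ord_recl big_ord0 !mxE /= addr0 addrA.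
by case: x => [[|[|[|x]]] lx] //; case: y => [[|[|[|y]]] ly].
Qed.

Lemma mx2M a b c d a' b' c' d' :
  mx2 a b c d *m mx2 a' b' c' d' =
  mx2 (a*a'+b*c') (a*b'+b*d') (c*a'+d*c') (c*b'+d*d').
Proof.
apply/matrixP=> x y; rewrite !mxE !big_ord_recl big_ord0 !mxE /= addr0.
by case: x => [[|[|x]] lx] //; case: y => [[|[|y]] ly].
Qed.

Lemma rv3M x y z a b c d e f g h i :
  rv3 x y z *m mx3 a b c d e f g h i =
  rv3 (x*a+y*d+z*g) (x*b+y*e+z*h) (x*c+y*f+z*i).
Proof.
apply/rowP=> j; rewrite !mxE !big_ord_recl big_ord0 !mxE /= addr0 addrA.
by case: j => [[|[|[|j]]] lj].
Qed.

Lemma mx3D a b c d e f g h i a' b' c' d' e' f' g' h' i' :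
  mx3 a b c d e f g h i + mx3 a' b' c' d' e' f' g' h' i' =
  mx3 (a+a') (b+b') (c+c') (d+d') (e+e') (f+f') (g+g') (h+h') (i+i').
Proof.
apply/matrixP=> x y; rewrite !mxE.
by case: x => [[|[|[|x]]] lx] //; case: y => [[|[|[|y]]] ly].
Qed.

Lemma mx3N a b c d e f g h i :
  - mx3 a b c d e f g h i = mx3 (-a) (-b) (-c) (-d) (-e) (-f) (-g) (-h) (-i).
Proof.
apply/matrixP=> x y; rewrite !mxE.
by case: x => [[|[|[|x]]] lx] //; case: y => [[|[|[|y]]] ly].
Qed.

Lemma mx3_1 : 1%:M = mx3 1 0 0 0 1 0 0 0 1.
Proof.
apply/matrixP=> x y; rewrite !mxE.
by case: x => [[|[|[|x]]] lx] //; case: y => [[|[|[|y]]] ly].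
Qed.

Lemma mx3_oner : 1 = mx3 1 0 0 0 1 0 0 0 1.
Proof. exact: mx3_1. Qed.

Lemma mx3_0 : 0 = mx3 0 0 0 0 0 0 0 0 0.
Proof.
apply/matrixP=> x y; rewrite !mxE.
by case: x => [[|[|[|x]]] lx] //; case: y => [[|[|[|y]]] ly].
Qed.

Lemma mx2_1 : 1%:M = mx2 1 0 0 1.
Proof.
apply/matrixP=> x y; rewrite !mxE.
by case: x => [[|[|x]] lx] //; case: y => [[|[|y]] ly].
Qed.

Lemma rv3D x y z x' y' z' : rv3 x y z + rv3 x' y' z' = rv3 (x+x') (y+y') (z+z').
Proof. by apply/rowP=> j; rewrite !mxE; case: j => [[|[|[|j]]] lj]. Qed.

Lemma rv3Z k x y z : k *: rv3 x y z = rv3 (k*x) (k*y) (k*z).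
Proof. by apply/rowP=> j; rewrite !mxE; case: j => [[|[|[|j]]] lj]. Qed.

Lemma rv3_0 : 0 = rv3 0 0 0.
Proof. by apply/rowP=> j; rewrite !mxE; case: j => [[|[|[|j]]] lj]. Qed.

Lemma det_mx2 a b c d : \det (mx2 a b c d) = a * d - b * c.
Proof. 
rewrite (expand_det_row _ ord0) !big_ord_recl big_ord0 /cofactor !det_mx11 !mxE /=.
by rewrite addr0 mul1r mulN1r mulrN. Qed.

Lemma det_mx3 a b c d e f g h i : \det (mx3 a b c d e f g h i) =
  a * (e * i - f * h) - b * (d * i - f * g) + c * (d * h - e * g).
Proof.
have det2 (A : 'M[F]_2) : \det A = A ord0 ord0 * A ord_max ord_max - A ord0 ord_max * A ord_max ord0.
  by have [? [? [? [? ->]]]] := mx2P A; rewrite det_mx2 !mxE.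
rewrite (expand_det_row _ ord0) !big_ord_recl big_ord0 /cofactor !det2 !mxE /=.
by rewrite addr0 mul1r expr1 mulN1r mulrN -signr_odd /= expr0 mul1r addrA.
Qed.

Lemma mxtrace_mx3 a b c d e f g h i : \tr (mx3 a b c d e f g h i) = a + e + i.
Proof. by rewrite /mxtrace !big_ord_recl big_ord0 !mxE /= addr0 addrA. Qed.

End Matrices3.

(** * Elementary 2 x 2 matrices, padding, and rank-one perturbations of the identity *)

Section ElementaryMatrices.
Local Open Scope ring_scope.
Variable F : fieldType.
Implicit Types (a b c d s x y : F).

Lemma eq_subr_eq x y z : x = y -> x - y = z -> z = 0.
Proof. by move=> ->; rewrite subrr. Qed.

Definition elem21 s := mx2 1 0 s 1.
Definition elem12 s := mx2 1 s 0 1.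
(* The transvection [v |-> v + s * det ((x, y), v) *: (x, y)]. *)
Definition root2 x y s := mx2 (1 - s * x * y) (- (s * y * y)) (s * x * x) (1 + s * x * y).

Lemma mx2_elementary a b c d : a * d - b * c = 1 -> c != 0 ->
  mx2 a b c d = elem12 ((a - 1) / c) *m elem21 c *m elem12 ((d - 1) / c).
Proof.
move=> dt nz; rewrite !mx2M; congr mx2; try by field.
have -> : b = (a * d - 1) / c by rewrite -dt; field.
by field.
Qed.

Lemma mx2_elem21 a b c d : mx2 a b c d = elem21 (-1) *m mx2 a b (a + c) (b + d).
Proof. by rewrite mx2M; congr mx2; ring. Qed.

Lemma det_elem21 a b c d : a * (b + d) - b * (a + c) = a * d - b * c.
Proof. by ring. Qed.

Lemma elem12_basis a b c d s : a * d - b * c != 0 ->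
  elem12 s *m mx2 a b c d = mx2 a b c d *m root2 c d (- s / (a * d - b * c)).
Proof. by move=> nz; rewrite !mx2M; congr mx2; field. Qed.

Lemma elem21_basis a b c d s : a * d - b * c != 0 ->
  elem21 s *m mx2 a b c d = mx2 a b c d *m root2 a b (s / (a * d - b * c)).
Proof. by move=> nz; rewrite !mx2M; congr mx2; field. Qed.

Lemma elem12D s t : elem12 s *m elem12 t = elem12 (s + t).
Proof. by rewrite mx2M; congr mx2; ring. Qed.

Lemma elem21D s t : elem21 s *m elem21 t = elem21 (s + t).
Proof. by rewrite mx2M; congr mx2; ring. Qed.

Lemma elem12_0 : elem12 0 = 1%:M. Proof. by rewrite mx2_1. Qed.
Lemma elem21_0 : elem21 0 = 1%:M. Proof. by rewrite mx2_1. Qed.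

Lemma root2_01 s : root2 0 1 s = elem12 (- s).
Proof. by congr mx2; ring. Qed.

Lemma det_root2 x y s : (1 - s * x * y) * (1 + s * x * y) - (- (s * y * y)) * (s * x * x) = 1.
Proof. by ring. Qed.

Lemma det_elem12 s : \det (elem12 s) = 1.
Proof. by rewrite det_mx2 mulr1 mulr0 subr0. Qed.

Lemma det_elem21_1 s : \det (elem21 s) = 1.
Proof. by rewrite det_mx2 mulr1 mul0r subr0. Qed.

Definition pad (A : 'M[F]_2) : 'M[F]_3 :=
  mx3 (A ord0 ord0) (A ord0 ord_max) 0 (A ord_max ord0) (A ord_max ord_max) 0 0 0 1.

Lemma pad_mx2 a b c d : pad (mx2 a b c d) = mx3 a b 0 c d 0 0 0 1.
Proof. by rewrite /pad !mxE. Qed.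

Lemma padM A B : pad A *m pad B = pad (A *m B).
Proof.
have [a [b [c [d ->]]]] := mx2P A; have [a' [b' [c' [d' ->]]]] := mx2P B.
by rewrite mx2M !pad_mx2 mx3M; congr mx3; ring.
Qed.

Lemma pad1 : pad 1%:M = 1%:M.
Proof. by rewrite mx2_1 pad_mx2 mx3_1. Qed.

Lemma pad_inj : injective pad.
Proof.
move=> A B; have [a [b [c [d ->]]]] := mx2P A; have [a' [b' [c' [d' ->]]]] := mx2P B.
by rewrite !pad_mx2 => /mx3_inj E; rewrite !E.
Qed.

Lemma det_pad A : \det (pad A) = \det A.
Proof.
have [a [b [c [d ->]]]] := mx2P A.
have -> : pad (mx2 a b c d) = block_mx (mx2 a b c d) 0 0 (1%:M : 'M_1) :> 'M_(2 + 1).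
  rewrite pad_mx2; apply/matrixP=> x y; rewrite !mxE.
  case: splitP => -[[|[|?]] //= ?] Ex; rewrite !mxE; case: splitP => -[[|[|?]] //= ?] Ey;
   by rewrite !mxE /= ?Ex ?Ey //=.
by rewrite (@det_ublock _ 2 1) det1 mulr1.
Qed.

(* Acting on rows by w |-> w + (w f) v; a transvection only when v f = 0. *)
Definition transv n (v : 'rV[F]_n) (f : 'cV[F]_n) : 'M[F]_n := 1%:M + f *m v.

Lemma transvM n (v v' : 'rV[F]_n) f f' : transv v f *m transv v' f' =
  1%:M + f *m v + f' *m v' + f *m (v *m f') *m v'.
Proof.
rewrite /transv mulmxDl mul1mx mulmxDr mulmx1 !mulmxA -!addrA; congr (_ + _).
by rewrite addrCA.
Qed.

Lemma transvD n (v v' : 'rV[F]_n) f : v *m f = 0 ->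
  transv v f *m transv v' f = transv (v + v') f.
Proof. by move=> vf; rewrite transvM vf mulmx0 mul0mx addr0 /transv mulmxDr addrA. Qed.

Lemma transvDf n (v : 'rV[F]_n) f f' : v *m f' = 0 ->
  transv v f *m transv v f' = transv v (f + f').
Proof. by move=> vf; rewrite transvM vf mulmx0 mul0mx addr0 /transv mulmxDl addrA. Qed.

Lemma transv0 n f : transv (0 : 'rV_n) f = 1%:M.
Proof. by rewrite /transv mulmx0 addr0. Qed.

(** A matrix of square zero has rank at most n / 2, so n <= 3 forces rank 1; the square then
    vanishes only if the pairing does. *)
Lemma transv_form n (N : 'M[F]_n) : (n <= 3)%N -> N != 0 -> N *m N = 0 ->
  exists (v : 'rV[F]_n) (f : 'cV[F]_n), N = f *m v /\ v *m f = 0.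
Proof.
move=> n3 nz NN.
have rk1 : \rank N = 1%N.
  have := mulmx0_rank_max NN; rewrite -mxrank_eq0 in nz.
  by move: (\rank N) nz => r; lia.
have [v [f E]] : exists (v : 'rV_n) (f : 'cV_n), N = f *m v.
  move: (mulmx_base N); move: (col_base N) (row_base N); rewrite rk1 => f v E.
  by exists v, f.
exists v, f; split=> //; move: NN; rewrite E => NN.
have [k Ek] : exists k, v *m f = k%:M by eexists; rewrite [LHS]mx11_scalar.
rewrite Ek; move: NN; rewrite mulmxA -(mulmxA f) Ek mul_mx_scalar -scalemxAl -E.
by move/eqP; rewrite scaler_eq0 (negPf nz) orbF => /eqP->; rewrite raddf0.
Qed.

Lemma transv_rv3 a b x c d y : transv (rv3 a b x) (rv3 c d y)^T =
  mx3 (1 + c * a) (c * b) (c * x) (d * a) (1 + d * b) (d * x) (y * a) (y * b) (1 + y * x).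
Proof.
rewrite /transv.
have -> : (rv3 c d y)^T *m rv3 a b x =
    mx3 (c * a) (c * b) (c * x) (d * a) (d * b) (d * x) (y * a) (y * b) (y * x).
  apply/matrixP=> i j; rewrite !mxE big_ord_recl big_ord0 !mxE addr0.
  by case: i => [[|[|[|i]]] li] //; case: j => [[|[|[|j]]] lj].
by rewrite mx3_1 mx3D; congr mx3; ring.
Qed.

Lemma rv3_dot a b x c d y : rv3 a b x *m (rv3 c d y)^T = (a * c + b * d + x * y)%:M.
Proof.
rewrite [LHS]mx11_scalar !mxE !big_ord_recl big_ord0 !mxE /=; congr (_%:M); ring.
Qed.

Lemma mx3_cV a b c d e f g h i x y z : mx3 a b c d e f g h i *m (rv3 x y z)^T =
  (rv3 (a * x + b * y + c * z) (d * x + e * y + f * z) (g * x + h * y + i * z))^T.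
Proof.
apply/matrixP=> u v; rewrite !mxE !big_ord_recl big_ord0 !mxE /= addr0 addrA.
by case: u => [[|[|[|u]]] lu].
Qed.

Lemma rv3_tr_scale s c d y : s *: (rv3 c d y)^T = (rv3 (s * c) (s * d) (s * y))^T.
Proof. by rewrite -rv3Z; apply/matrixP=> i j; rewrite !mxE. Qed.

Lemma pad_root2 x y s : pad (root2 x y s) = transv (rv3 x y 0) (rv3 (- s * y) (s * x) 0)^T.
Proof. by rewrite pad_mx2 transv_rv3; congr mx3; ring. Qed.

Lemma scalar_mx11_eq0 a : (a%:M == 0 :> 'M[F]_1) = (a == 0).
Proof.
apply/eqP/eqP=> [/matrixP/(_ 0 0) | ->]; last by rewrite raddf0.
by rewrite !mxE mulr1n.
Qed.

Lemma cV3P (f : 'cV[F]_3) : exists c d y, f = (rv3 c d y)^T.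
Proof. by have [c [d [y E]]] := rv3P f^T; exists c, d, y; rewrite -E trmxK. Qed.

End ElementaryMatrices.

(** * Strongly p-embedded subgroups and their p-elements *)

Lemma p_elt_dvd_order (p : nat) (rT : finGroupType) (x : rT) :
  p.-elt x -> x != 1 -> p %| #[x].
Proof.
move=> px ntx; have [k ok] := p_natP px.
by move: ntx; rewrite -order_eq1 ok; case: k {ok} => // k _; rewrite expnS dvdn_mulr.
Qed.

Section StronglyEmbedded.
Variables (p : nat) (rT : finGroupType) (G H : {group rT}).
Hypothesis (p_pr : prime p) (speH : strongly_p_embedded p G H).

Lemma spe_sub : H \subset G. Proof. by case: speH => /proper_sub. Qed.

(** The element [x] makes p divide the order of the intersection of [H] and [H :^ y], which is
    excluded for [y] outside [H]. *)
Lemma spe_inJ x y : y \in G -> p.-elt x -> x != 1 -> x \in H -> x \in H :^ y -> y \in H.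
Proof.
move=> Gy px ntx Hx Hxy; apply/idPn=> nHy.
have [_ _ /(_ y)] := speH; rewrite inE nHy Gy => /(_ isT) /negP[].
apply: dvdn_trans (p_elt_dvd_order px ntx) _.
by apply: order_dvdG; rewrite inE Hx.
Qed.

Lemma spe_conj_eq x k l : k \in G -> l \in G -> p.-elt x -> x != 1 ->
  x \in H :^ k -> x \in H :^ l -> H :^ k = H :^ l.
Proof.
move=> Gk Gl px ntx xk xl.
have: l * k^-1 \in H.
  apply: (@spe_inJ (x ^ k^-1)); rewrite ?p_eltJ ?conjg_eq1 //.
  - by rewrite groupM ?groupV.
  - by rewrite -mem_conjg.
  - by rewrite conjsgM memJ_conjg.
by move=> Hlk; rewrite -{1}(conjGid Hlk) -conjsgM mulgKV.
Qed.

(** Conjugation by [y] fixes [x], so [x] lies in [H :^ k] and in its image under [y], and these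
    coincide. Chains of commuting nontrivial p-elements thus never leave a conjugate. *)
Lemma spe_commute x y k : k \in G -> p.-elt x -> x != 1 -> x \in H :^ k ->
  y \in G -> commute x y -> y \in H :^ k.
Proof.
move=> Gk px ntx xk Gy cxy; rewrite mem_conjg.
apply: (@spe_inJ (x ^ k^-1)); rewrite ?p_eltJ ?conjg_eq1 //.
- by rewrite groupJ ?groupV.
- by rewrite -mem_conjg.
have -> : x ^ k^-1 = (x ^ k^-1) ^ (y ^ k^-1) by rewrite -conjJg (conjgE x y) cxy mulKg.
by rewrite memJ_conjg -mem_conjg.
Qed.

(** If P is Sylow in [H] and Q is a Sylow subgroup of [G] above it, the normaliser of P in Q lies in
    [H] by [spe_inJ], hence equals P; in a p-group this forces Q = P. *)
Lemma spe_Sylow : exists2 P : {group rT}, p.-Sylow(G) P & P \subset H.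
Proof.
have [P sylP] := Sylow_exists p H; have [sPH pP _] := and3P sylP.
have [Q sylQ sPQ] := Sylow_superset (subset_trans sPH spe_sub) pP.
have [sQG pQ _] := and3P sylQ.
have ntP : P :!=: 1.
  by rewrite -rank_gt0 (rank_Sylow sylP) p_rank_gt0 mem_primes p_pr cardG_gt0; case: speH.
have sNH : 'N_Q(P) \subset H.
  apply/subsetP=> y /setIP[Qy Ny]; have [x Px ntx] := trivgPn _ ntP.
  apply: (@spe_inJ x); rewrite ?(mem_p_elt pP) ?(subsetP sPH) ?(subsetP sQG) //.
  by apply: (subsetP _ _ Px); rewrite -(normP Ny) conjSg.
suffices eQP : 'N_Q(P) \subset P.
  have defP := nilpotent_sub_norm (pgroup_nil pQ) sPQ eQP.
  by exists Q => //; rewrite defP.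
rewrite (sub_pHall sylP _ _ sNH) ?(pgroupS _ pQ) ?subsetIl //.
by rewrite subsetI sPQ normG.
Qed.

Lemma spe_cover x : x \in G -> p.-elt x -> exists2 k, k \in G & x \in H :^ k.
Proof.
move=> Gx px; have [P sylP sPH] := spe_Sylow.
have sxG: <[x]> \subset G by rewrite cycle_subG.
have [k Gk] := Sylow_subJ sylP sxG px.
by rewrite cycle_subG => Px; exists k => //; apply: subsetP Px; rewrite conjSg.
Qed.

(** A common nontrivial p-element would make the two conjugates equal, so [g] would normalise [H]
    and lie in it. [k] stays free so that [H :^ k] can be the conjugate around a given element. *)
Lemma spe_proper_conj : exists g, [/\ g \in G, g \notin H &
  forall x k, p.-elt x -> x != 1 -> k \in G -> x \in H :^ k -> x \in H :^ (g * k) -> False].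
Proof.
have [/properP[_ [g Gg nHg]] _ _] := speH; exists g; split=> // x k px ntx Gk xk xgk.
have E := spe_conj_eq Gk (groupM Gg Gk) px ntx xk xgk.
have [P sylP sPH] := spe_Sylow.
have ntP : P :!=: 1.
  rewrite -rank_gt0 (rank_Sylow sylP) p_rank_gt0 mem_primes p_pr cardG_gt0.
  by apply: dvdn_trans (cardSg spe_sub); case: speH.
have [y Py nty] := trivgPn _ ntP.
have /negP[] := nHg; apply: (@spe_inJ y) => //.
- by case/and3P: sylP => _ pP _; rewrite (mem_p_elt pP).
- exact: (subsetP sPH).
have -> : H :^ g = H by apply: (can_inj (conjsgK k)); rewrite -conjsgM -E.
exact: (subsetP sPH).
Qed.

(** A normal p-subgroup lies in every Sylow subgroup, hence in all conjugates of [H], and two of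
    these share no nontrivial p-element. *)
Lemma spe_pcore_trivial (N : {group rT}) : N <| G -> p.-group N -> N :=: 1.
Proof.
move=> nNG pN; apply/eqP/idPn=> ntN.
have [x Nx ntx] := trivgPn _ ntN.
have px := mem_p_elt pN Nx; have Gx := subsetP (normal_sub nNG) x Nx.
have [P sylP sPH] := spe_Sylow.
have sNP : N \subset P.
  by apply: subset_trans (pcore_sub_Hall sylP); rewrite pcore_max.
have [g [Gg _ Hg]] := spe_proper_conj.
apply: (Hg x 1); rewrite ?conjsg1 ?mulg1 //; first by rewrite (subsetP sPH) ?(subsetP sNP).
have : x \in N :^ g by rewrite (normsP (normal_norm nNG)).
by apply: subsetP; rewrite conjSg (subset_trans sNP).
Qed.

End StronglyEmbedded.

Lemma Opprime_sub (p : nat) (rT : finGroupType) (G : {group rT}) : Opprime p G \subset G.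
Proof. by rewrite gen_subG; apply/subsetP=> x; rewrite inE => /andP[]. Qed.

(** * Faithful representations over the prime field *)

Section SL2Generation.
Local Open Scope ring_scope.
Variables (F : fieldType) (P : 'M[F]_2 -> Prop).
Hypothesis PM : forall A B, P A -> P B -> P (A *m B).

Lemma SL2_elementary_ind :
  (forall s, P (elem12 s)) -> (forall s, P (elem21 s)) -> forall A, \det A = 1 -> P A.
Proof.
move=> P12 P21.
have main (a b c d : F) : a * d - b * c = 1 -> c != 0 -> P (mx2 a b c d).
  by move=> dt nz; rewrite mx2_elementary //; do 2?apply: PM.
move=> A; have [a [b [c [d ->]]]] := mx2P A; rewrite det_mx2 => dt.
have [c0|] := eqVneq c 0; last exact: main.
(* A zero lower left entry is replaced by [a], nonzero because the determinant is 1. *)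
rewrite mx2_elem21; apply: PM => //; apply: main.
  by rewrite det_elem21.
rewrite c0 addr0; apply/eqP=> a0; move: dt; rewrite a0 c0 mul0r mulr0 subrr.
by move/eqP; rewrite eq_sym oner_eq0.
Qed.

End SL2Generation.

(** The matrix whose rows are the two centres conjugates the elementary groups into these root
    groups, up to rescaling the parameter. *)
Lemma SL2_roots_ind (F : fieldType) (P : 'M[F]_2 -> Prop) (a b c d : F) :
  (forall A B, P A -> P B -> P (A *m B)%R) -> (a * d - b * c != 0)%R ->
  (forall s, P (root2 a b s)) -> (forall s, P (root2 c d s)) ->
  forall A, (\det A = 1)%R -> P A.
Proof.
move=> PM nz P1 P2 A dA; pose h := mx2 a b c d.
have uh : h \in unitmx by rewrite unitmxE det_mx2 unitfE.
pose Q B := P (invmx h *m B *m h)%R.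
have QM B C : Q B -> Q C -> Q (B *m C)%R.
  by move=> QB QC; have := PM _ _ QB QC; rewrite /Q !mulmxA mulmxK.
have Qh B C : (B *m h = h *m C)%R -> P C -> Q B.
  by rewrite /Q => E; rewrite -mulmxA E mulKmx.
have QA : Q (h *m A *m invmx h)%R.
  apply: SL2_elementary_ind => // [s|s|].
  - by apply: (Qh _ _ _ (P2 _)); apply: elem12_basis.
  - by apply: (Qh _ _ _ (P1 _)); apply: elem21_basis.
  by rewrite !det_mulmx det_inv mulrAC dA mulr1 mulrV // -unitmxE.
by move: QA; rewrite /Q !mulmxA mulVmx // mul1mx mulmxKV.
Qed.

(** The row spaces of the powers shrink strictly until they stabilise, and a stable one is zero
    because some power vanishes. *)
Lemma nilpotent_mx_exp (F : fieldType) (n : nat) (N : 'M[F]_n.+1) m :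
  (N ^+ m = 0 -> N ^+ n.+1 = 0)%R.
Proof.
move=> Nm; pose P k : 'M_n.+1 := (N ^+ k)%R.
have PS k : P k.+1 = (P k *m N)%R by rewrite /P exprSr.
have step k : (P k.+1 <= P k)%MS by rewrite /P exprS submxMl.
have stop k : (P k <= P k.+1)%MS -> P k = 0%R.
  move=> le; have lej j : (P k <= P (k + j)%N)%MS.
    elim: j => [|j IH]; first by rewrite addn0.
    by apply: submx_trans le _; rewrite addnS !PS submxMr.
  apply/eqP; rewrite -submx0; apply: submx_trans (lej m) _.
  by rewrite /P addnC exprD Nm mul0r.
have rk k : (\rank (P k) + k <= n.+1)%N \/ P k = 0%R.
  elim: k => [|k [IH|IH]]; first by left; rewrite addn0 rank_leq_row.
    have [le|nle] := boolP (P k <= P k.+1)%MS.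
      by right; rewrite PS (stop k le) mul0mx.
    left; rewrite addnS; apply: leq_trans IH; rewrite ltn_add2r.
    rewrite ltn_neqAle mxrankS // andbT; apply: contra nle => /eqP e.
    by rewrite -(geq_leqif (mxrank_leqif_sup (step k))) e.
  by right; rewrite PS IH mul0mx.
case: (rk n.+1) => // le; apply/eqP; rewrite -mxrank_eq0.
by move: le; move: (\rank _) => r; lia.
Qed.

(** A plain function constrained only on [G]: change of basis, padding and the contragredient are
    then ordinary functions again. *)
Definition faithful_rep (F : fieldType) (rT : finGroupType) n (G : {set rT}) (rho : rT -> 'M[F]_n) :=
  [/\ rho 1 = (1%:M)%R, {in G &, forall x y, rho (x * y) = (rho x *m rho y)%R}
    & {in G &, injective rho}].

Definition mxG (F : fieldType) (rT : finGroupType) n (rho : rT -> 'M[F]_n) (K : {set rT}) A :=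
  exists2 x, x \in K & rho x = A.

Section Representations.
Variables (p : nat) (F : fieldType).
Hypotheses (p_pr : prime p) (charF : p \in [pchar F]%R).
Hypothesis natF : forall a : F, exists k : nat, a = (k%:R)%R.
Variables (rT : finGroupType) (n : nat) (G : {group rT}) (rho : rT -> 'M[F]_n.+1).
Hypothesis frho : faithful_rep G rho.
Implicit Types (K : {group rT}) (x y : rT).
Local Open Scope ring_scope.

Lemma rep1 : rho 1%g = 1%:M. Proof. by case: frho. Qed.

Lemma repM x y : x \in G -> y \in G -> rho (x * y)%g = rho x *m rho y.
Proof. by case: frho => _ + _; apply. Qed.

Lemma rep_inj x y : x \in G -> y \in G -> rho x = rho y -> x = y.
Proof. by case: frho => _ _ inj Gx Gy; apply: inj. Qed.

Lemma repV x : x \in G -> rho x *m rho x^-1%g = 1%:M.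
Proof. by move=> Gx; rewrite -repM ?groupV // mulgV rep1. Qed.

Lemma repVr x : x \in G -> rho x^-1%g *m rho x = 1%:M.
Proof. by move=> Gx; rewrite -repM ?groupV // mulVg rep1. Qed.

Lemma rep_unit x : x \in G -> rho x \in unitmx.
Proof. by move/repV/mulmx1_unit=> []. Qed.

Lemma rep_exp x k : x \in G -> rho (x ^+ k)%g = rho x ^+ k.
Proof.
move=> Gx; elim: k => [|k IH]; first by rewrite rep1.
by rewrite expgS exprS repM ?groupX // IH.
Qed.

Lemma repJ x y : x \in G -> y \in G -> rho y *m rho (x ^ y)%g = rho x *m rho y.
Proof. by move=> Gx Gy; rewrite -!repM ?groupJ // -conjgC. Qed.

Lemma rep_commute x y : x \in G -> y \in G -> rho x *m rho y = rho y *m rho x -> commute x y.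
Proof. by move=> Gx Gy E; apply: rep_inj; rewrite ?groupM // !repM. Qed.

Lemma mxG_mem x : x \in G -> forall K, K \subset G -> mxG rho K (rho x) -> x \in K.
Proof.
by move=> Gx K /subsetP sKG [y Ky /rep_inj <- //]; apply: sKG.
Qed.

Lemma mxGM K A B : K \subset G -> mxG rho K A -> mxG rho K B -> mxG rho K (A *m B).
Proof.
move=> /subsetP sKG [x Kx <-] [y Ky <-]; exists (x * y)%g; rewrite ?groupM //.
by rewrite repM ?sKG.
Qed.

(** Frobenius fixes every natural multiple of 1, and by [natF] the field has no other elements. *)
Lemma expF_pX (a : F) k : a ^+ (p ^ k) = a.
Proof.
have aux b : b ^+ p = b :> F.
  by have [m ->] := natF b; rewrite -(pFrobenius_autE charF) rmorph_nat.
by elim: k => [|k IH]; rewrite ?expr1 // expnSr exprM IH aux.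
Qed.

Lemma p_elt_exp (x : rT) : p.-elt x -> exists k, (x ^+ (p ^ k) = 1)%g.
Proof. by case/p_natP=> k ok; exists k; rewrite -ok expg_order. Qed.

(** In characteristic p the power (M - 1)^(p^k) is M^(p^k) - 1, so M - 1 is nilpotent; the dimension
    then bounds the exponent. *)
Lemma p_elt_unipotent x : x \in G -> p.-elt x -> (rho x - 1) ^+ n.+1 = 0.
Proof.
move=> Gx /p_elt_exp[k xk]; apply: (@nilpotent_mx_exp _ _ _ (p ^ k)).
have chM : p \in [pchar 'M[F]_n.+1] by rewrite pchar_lalg.
have E j : (rho x - 1) ^+ (p ^ j) = rho x ^+ (p ^ j) - 1.
  elim: j => [|j IH]; first by rewrite !expr1.
  rewrite expnSr !exprM IH.
  have := pFrobenius_autB_comm chM (commr1 (rho x ^+ (p ^ j))).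
  by rewrite !pFrobenius_autE expr1n.
by rewrite E -rep_exp // xk rep1 subrr.
Qed.

Lemma p_elt_det x : x \in G -> p.-elt x -> \det (rho x) = 1.
Proof.
move=> Gx /p_elt_exp[k xk]; have := congr1 (fun x => \det (rho x)) xk.
rewrite rep_exp // rep1 det1.
have -> : \det (rho x ^+ (p ^ k)) = \det (rho x) ^+ (p ^ k).
  move: (p ^ k)%N => m; elim: m => [|m IH]; first by rewrite det1.
  by rewrite !exprS det_mulmx IH.
by rewrite expF_pX.
Qed.

Lemma p_elt_eigen x (v : 'rV_n.+1) l :
  x \in G -> p.-elt x -> v != 0 -> v *m rho x = l *: v -> l = 1.
Proof.
move=> Gx /p_elt_exp[k xk] nz E.
have Ek m : v *m rho x ^+ m = l ^+ m *: v.
  elim: m => [|m IH]; first by rewrite mulmx1 scale1r.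
  by rewrite exprSr mulmxA IH -scalemxAl E scalerA exprSr.
have := Ek (p ^ k)%N; rewrite -rep_exp // xk rep1 mulmx1 expF_pX => /eqP.
by rewrite -{1}[v]scale1r -subr_eq0 -scalerBl scaler_eq0 (negPf nz) orbF subr_eq0 => /eqP.
Qed.

Lemma Opprime_rep_ind (P : 'M[F]_n.+1 -> Prop) :
  P 1%:M -> (forall A B, P A -> P B -> P (A *m B)) ->
  (forall x, x \in G -> p.-elt x -> P (rho x)) -> forall x, x \in Opprime p G -> P (rho x).
Proof.
move=> P1 PM Pp x /gen_prodgP[m [c cP ->]]; elim: m c cP => [|m IH] c cP.
  by rewrite big_ord0 rep1.
have Gc i : c i \in G by have := cP i; rewrite inE => /andP[].
rewrite big_ord_recl repM ?Gc //; last by apply: group_prod => i _; apply: Gc.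
apply: PM; last by apply: IH => i; apply: cP.
by have := cP ord0; rewrite inE => /andP[]; apply: Pp.
Qed.

Variable M : F -> 'M[F]_n.+1.
Hypotheses (M0 : M 0 = 1%:M) (MD : forall s t, M s *m M t = M (s + t)).

(** By [natF] the parameter [s] is a natural multiple of [s0], so [M s] is a power of [M s0]. *)
Lemma one_param K s0 : K \subset G -> s0 != 0 -> mxG rho K (M s0) -> forall s, mxG rho K (M s).
Proof.
move=> sKG nz Ks0 s; have [k Ek] := natF (s / s0).
have -> : s = k%:R * s0 by rewrite -Ek mulfVK.
elim: k {Ek} => [|k IH]; first by rewrite mul0r M0; exists 1%g; rewrite ?group1 ?rep1.
by rewrite -natr1 mulrDl mul1r -MD; apply: mxGM.
Qed.

Lemma one_param_exp x s k : x \in G -> rho x = M s -> rho (x ^+ k)%g = M (k%:R * s).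
Proof.
move=> Gx Ex; elim: k => [|k IH]; first by rewrite mul0r M0 rep1.
by rewrite expgSr repM ?groupX // IH Ex MD -natr1 mulrDl mul1r.
Qed.

Lemma one_param_p_elt x s : x \in G -> rho x = M s -> p.-elt x.
Proof.
move=> Gx Ex; apply: (@pnat_dvd _ p); last by rewrite pnat_id.
rewrite order_dvdn; apply/eqP/rep_inj; rewrite ?groupX ?group1 //.
by rewrite (one_param_exp _ Gx Ex) (pcharf0 charF) mul0r M0 rep1.
Qed.

End Representations.

Lemma faithful_rep_basis (F : fieldType) (rT : finGroupType) n (G : {set rT})
    (rho : rT -> 'M[F]_n) (B : 'M[F]_n) :
  B \in unitmx -> faithful_rep G rho ->
  faithful_rep G (fun x => B *m rho x *m invmx B)%R.
Proof.
move=> uB [r1 rM rI]; split=> [|x y Gx Gy|x y Gx Gy E].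
- by rewrite r1 mulmx1 mulmxV.
- by rewrite rM // !mulmxA mulmxKV.
- by apply: rI => //; apply: (can_inj (mulKmx uB)); apply: (can_inj (mulmxK (_ : invmx B \in unitmx)));
    rewrite ?unitmx_inv.
Qed.

(** * Groups containing a transvection *)

Section Transvections.
Variables (p : nat) (F : fieldType).
Hypotheses (p_pr : prime p) (charF : p \in [pchar F]%R).
Hypothesis natF : forall a : F, exists k : nat, a = (k%:R)%R.
Variables (rT : finGroupType) (G : {group rT}).
Local Open Scope ring_scope.

Section Chains.
Variables (n : nat) (rho : rT -> 'M[F]_n.+1) (H : {group rT}).
Hypotheses (frho : faithful_rep G rho) (speH : strongly_p_embedded p G H).

Lemma transv_p_elt x (v : 'rV_n.+1) f :
  x \in G -> v *m f = 0 -> rho x = transv v f -> p.-elt x.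
Proof.
move=> Gx vf Ex.
apply: (@one_param_p_elt _ _ p_pr charF _ _ _ _ frho (fun s => transv v (s *: f)) _ _ x 1) => //.
- by rewrite scale0r /transv mul0mx addr0.
- by move=> s t; rewrite transvDf ?scalerDl // -scalemxAr vf scaler0.
by rewrite scale1r.
Qed.

(* w is the commutator of x and y. *)
Lemma transv_commutator x y (v v' : 'rV_n.+1) f f' : x \in G -> y \in G ->
  v *m f = 0 -> v' *m f' = 0 -> v *m f' = 0 ->
  rho x = transv v f -> rho y = transv v' f' ->
  exists w, [/\ w \in G, p.-elt w, commute x w, commute y w & w = 1%g -> commute x y].
Proof.
move=> Gx Gy vf vf' vff Ex Ey.
pose w := ((x * y)^-1 * (y * x))%g; have Gw : w \in G by rewrite !(groupM, groupV).
pose k := (v' *m f) 0 0.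
have Ek : v' *m f = k%:M by apply: mx11_scalar.
have Ew : rho w = transv (k *: v) f'.
  have uxy : rho (x * y)%g \in unitmx by apply: (rep_unit frho); rewrite groupM.
  have Exy : ((x * y) * w = y * x)%g by rewrite /w mulKVg.
  apply: (can_inj (mulKmx uxy)); rewrite -(repM frho (groupM Gx Gy) Gw) Exy.
  rewrite (repM frho Gy Gx) (repM frho Gx Gy) Ex Ey !transvM vff mulmx0 mul0mx addr0 Ek.
  rewrite /transv mulmxDr mulmx1 !mulmxDl mul1mx -!mulmxA !(mulmxA _ f') vff vf'.
  rewrite !mul0mx !mulmx0 !addr0 mul_scalar_mx; congr (_ + _).
  by rewrite -!addrA; congr (_ + _); rewrite addrC.
have vk : (k *: v) *m f' = 0 by rewrite -scalemxAl vff scaler0.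
exists w; split=> //.
- exact: transv_p_elt vk Ew.
- apply: (rep_commute frho) => //; rewrite Ex Ew !transvM vff.
  by rewrite -!scalemxAl vf !(scaler0, mulmx0, mul0mx, addr0, scalemxAl) addrAC.
- apply: (rep_commute frho) => //; rewrite Ey Ew !transvM vf'.
  by rewrite -!scalemxAl vff !(scaler0, mulmx0, mul0mx, addr0, scalemxAl) addrAC.
move=> w1; have : ((x * y) * w = y * x)%g by rewrite /w mulKVg.
by rewrite w1 mulg1.
Qed.

(** If the commutator [w] is trivial, [x] and [y] commute; otherwise [w] is a nontrivial p-element
    commuting with both, and links them in two steps. *)
Lemma transv_chain x y (v v' : 'rV_n.+1) f f' k : x \in G -> y \in G ->
  v *m f = 0 -> v' *m f' = 0 -> (v *m f' = 0 \/ v' *m f = 0) -> x != 1%g ->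
  rho x = transv v f -> rho y = transv v' f' ->
  k \in G -> x \in H :^ k -> y \in H :^ k.
Proof.
move=> Gx Gy vf vf' vff ntx Ex Ey Gk Hx; have px := transv_p_elt Gx vf Ex.
have [w [Gw pw cxw cyw cxy]] : exists w,
    [/\ w \in G, p.-elt w, commute x w, commute y w & w = 1%g -> commute x y].
  case: vff => e; first exact: transv_commutator Ex Ey.
  have [w [Gw pw cyw cxw cyx]] := transv_commutator Gy Gx vf' vf e Ey Ex.
  by exists w; split=> // w1; apply/commute_sym/cyx.
have [w1 | ntw] := eqVneq w 1%g.
  exact: (spe_commute speH Gk px ntx Hx Gy (cxy w1)).
have Hw := spe_commute speH Gk px ntx Hx Gw cxw.
exact: (spe_commute speH Gk pw ntw Hw Gy (commute_sym cyw)).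
Qed.

End Chains.

Section ContainsSL2.
Variables (rho : rT -> 'M[F]_3) (H : {group rT}).
Hypotheses (frho : faithful_rep G rho) (speH : strongly_p_embedded p G H).
Hypothesis subG : forall A, \det A = 1 -> mxG rho G (pad A).
Hypothesis nconc : forall k, k \in G -> exists2 A, \det A = 1 & ~ mxG rho (H :^ k) (pad A).

Let sHkG k : k \in G -> H :^ k \subset G.
Proof. by move=> Gk; rewrite conj_subG ?(spe_sub speH). Qed.

(** Root elements of the embedded SL_2 whose centre is along (a, b), or is killed by (c, d), lie in
    the conjugate of [H] containing [x]. If the conclusion failed, two independent root groups of
    this kind would put all of SL_2 there, against [nconc]. *)
Lemma transv_step1 x a b al c d be : x \in G -> x != 1%g ->
  rho x = transv (rv3 a b al) (rv3 c d be)^T -> a * c + b * d + al * be = 0 ->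
  [/\ a * c + b * d = 0, (a, b) != (0, 0) & (c, d) != (0, 0)].
Proof.
move=> Gx ntx Ex e0.
have vf : rv3 a b al *m (rv3 c d be)^T = 0 by rewrite rv3_dot e0 raddf0.
have px := transv_p_elt frho Gx vf Ex.
have [k Gk Hx] := spe_cover p_pr speH Gx px.
have inK y z : a * z = b * y \/ y * c + z * d = 0 ->
    forall s, mxG rho (H :^ k) (pad (root2 y z s)).
  move=> cond s; have [g Gg Eg] : mxG rho G (pad (root2 y z s)).
    by apply: subG; rewrite det_mx2 det_root2.
  exists g => //.
  have dot0 : rv3 y z 0 *m (rv3 (- s * z) (s * y) 0)^T = 0.
    by rewrite rv3_dot; apply/eqP; rewrite scalar_mx11_eq0; apply/eqP; ring.
  apply: (transv_chain frho speH Gx Gg vf dot0 _ ntx Ex _ Gk Hx); last by rewrite Eg pad_root2.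
  rewrite !rv3_dot; case: cond => [az|yc]; [left | right]; apply/eqP; rewrite scalar_mx11_eq0; apply/eqP.
    have -> : a * (- s * z) + b * (s * y) + al * 0 = s * (b * y - a * z) by ring.
    by rewrite az subrr mulr0.
  by rewrite yc add0r mul0r.
have no y z y' z' : y * z' - z * y' != 0 ->
    (forall s, mxG rho (H :^ k) (pad (root2 y z s))) ->
    (forall s, mxG rho (H :^ k) (pad (root2 y' z' s))) -> False.
  move=> nz K1 K2; have [A dA] := nconc Gk; apply.
  apply: (SL2_roots_ind (P := fun A => mxG rho (H :^ k) (pad A)) _ nz K1 K2 dA) => B C KB KC.
  by rewrite -padM; apply: (mxGM frho (K := (H :^ k)%G)) => //; apply: sHkG.
have nz01 : 1 * 1 - 0 * 0 != 0 :> F by rewrite mulr1 mulr0 subr0 oner_neq0.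
split.
- apply/eqP/negPn/negP=> nz; apply: (no a b (- d) c); first by apply: contra nz => /eqP e; apply/eqP; rewrite -e; ring.
    by apply: inK; left; ring.
  by apply: inK; right; ring.
- apply/eqP=> -[a0 b0]; apply: (no 1 0 0 1 nz01); apply: inK; left; rewrite a0 b0; ring.
- apply/eqP=> -[c0 d0]; apply: (no 1 0 0 1 nz01); apply: inK; right; rewrite c0 d0; ring.
Qed.

(** Let [y] be the element of the embedded SL_2 with the same first two coordinates as [x]. A
    nonzero third coordinate would make [x * y^-1] or [y^-1 * x] a transvection whose centre or form
    has zero first two coordinates, against [transv_step1]. *)
Lemma transv_step3 x : x \in G -> (rho x - 1) *m (rho x - 1) = 0 ->
  exists2 A, \det A = 1 & rho x = pad A.
Proof.
move=> Gx N2; have [N0 | nzN] := eqVneq (rho x - 1) 0.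
  by exists 1%:M; rewrite ?det1 // pad1; apply/eqP; rewrite -subr_eq0 N0.
have [v [f [EN vf]]] := transv_form (leqnn 3) nzN N2.
have [a [b [al Ev]]] := rv3P v; have [c [d [be Ef]]] := cV3P f.
have Ex : rho x = transv v f by rewrite /transv -EN addrC subrK.
have e0 : a * c + b * d + al * be = 0.
  by apply/eqP; rewrite -scalar_mx11_eq0 -rv3_dot -Ev -Ef vf.
have nt y w g : y \in G -> rho y = transv w g -> g *m w != 0 -> y != 1%g.
  move=> Gy Ey; apply: contra => /eqP y1; move: Ey.
  by rewrite y1 (rep1 frho) /transv -{1}[1%:M]addr0 => /addrI<-.
rewrite Ev Ef in Ex EN.
have ntx : x != 1%g by apply: (nt _ _ _ Gx Ex); rewrite -EN.
have [ac nzab nzcd] := transv_step1 Gx ntx Ex e0.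
have albe : al * be = 0 by rewrite -e0 ac add0r.
pose A0 := mx2 (1 + c * a) (c * b) (d * a) (1 + d * b).
have E0 : pad A0 = transv (rv3 a b 0) (rv3 c d 0)^T.
  by rewrite pad_mx2 transv_rv3; congr mx3; ring.
have dA0 : \det A0 = 1.
  rewrite det_mx2; have -> : (1 + c * a) * (1 + d * b) - c * b * (d * a) = 1 + (a * c + b * d) by ring.
  by rewrite ac addr0.
have [y Gy Ey] := subG dA0; rewrite E0 in Ey.
have GyV : y^-1%g \in G by rewrite groupV.
have EyV : rho y^-1%g = transv (- rv3 a b 0) (rv3 c d 0)^T.
  apply: (can_inj (mulKmx (rep_unit frho Gy))); rewrite (repV frho) // Ey.
  by rewrite transvD ?subrr ?transv0 // rv3_dot ac mulr0 addr0 raddf0.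
have rep_nt z A : rho z = A -> A != 1%:M -> z != 1%g.
  by move=> Ez; apply: contra => /eqP z1; rewrite -Ez z1 (rep1 frho).
have [al0 | nzal] := eqVneq al 0; last first.
  have be0 : be = 0 by apply/eqP; move/eqP: albe; rewrite mulf_eq0 (negPf nzal).
  have Ez : rho (x * y^-1)%g = transv (rv3 0 0 al) (rv3 c d 0)^T.
    rewrite (repM frho) // Ex EyV be0 transvD; last by rewrite -be0 -Ev -Ef.
    by rewrite -[- rv3 a b 0]scaleN1r rv3Z rv3D; congr transv; congr rv3; ring.
  have ntz : (x * y^-1)%g != 1%g.
    apply: rep_nt Ez _; rewrite transv_rv3 mx3_1; apply: contra nzcd => /eqP/mx3_inj.
    move=> [[[[[[[[_ _] e3] _] _] e6] _] _] _].
    move/eqP: e3; rewrite mulf_eq0 (negPf nzal) orbF => /eqP->.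
    by move/eqP: e6; rewrite mulf_eq0 (negPf nzal) orbF => /eqP->.
  by have [|_ /eqP[]] := transv_step1 (groupM Gx GyV) ntz Ez; rewrite ?(mul0r, mulr0, addr0).
have [be0 | nzbe] := eqVneq be 0; last first.
  have Ez : rho (y^-1 * x)%g = transv (rv3 a b 0) (rv3 0 0 be)^T.
    have EyV' : rho y^-1%g = transv (rv3 a b 0) (- (rv3 c d 0)^T).
      by rewrite EyV /transv mulmxN mulNmx.
    rewrite (repM frho) // Ex EyV' al0.
    rewrite transvDf; last by rewrite -{1}al0 -Ev -Ef.
    congr transv; rewrite -scaleN1r rv3_tr_scale; apply/matrixP=> i j; rewrite !mxE.
    by case: i => [[|[|[|i]]] li] //=; ring.
  have ntz : (y^-1 * x)%g != 1%g.
    apply: rep_nt Ez _; rewrite transv_rv3 mx3_1; apply: contra nzab => /eqP/mx3_inj.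
    move=> [[[[[[[[_ _] _] _] _] _] e7] e8] _].
    move/eqP: e7; rewrite mulf_eq0 (negPf nzbe) orFb => /eqP->.
    by move/eqP: e8; rewrite mulf_eq0 (negPf nzbe) orFb => /eqP->.
  by have [|_ _ /eqP[]] := transv_step1 (groupM GyV Gx) ntz Ez; rewrite ?(mul0r, mulr0, addr0).
by exists A0 => //; rewrite E0 Ex al0 be0.
Qed.

(** A conjugate of the padded element still satisfies (g - 1)^2 = 0, so [transv_step3] applies to
    it; [y] is any element of [G]. *)
Lemma pad_conj A y : y \in G -> \det A = 1 -> (pad A - 1) *m (pad A - 1) = 0 ->
  exists B, pad A *m rho y = rho y *m pad B.
Proof.
move=> Gy dA A1; have [t Gt Et] := subG dA.
have [|B _ EB] := @transv_step3 (t ^ y)%g (groupJ Gt Gy).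
  have -> : rho (t ^ y)%g - 1 = invmx (rho y) *m (pad A - 1) *m rho y.
    rewrite mulmxBr mulmxBl mulmx1 mulVmx ?(rep_unit frho) // -Et.
    by rewrite -mulmxA -(repJ frho Gt Gy) mulKmx // (rep_unit frho).
  rewrite !mulmxA mulmxK ?(rep_unit frho) // -(mulmxA (invmx _)) A1.
  by rewrite mulmx0 mul0mx.
by exists B; rewrite -EB (repJ frho) // Et.
Qed.

Lemma p_elt_pad x : x \in G -> p.-elt x -> exists2 A, \det A = 1 & rho x = pad A.
Proof.
move=> Gx px.
have d12 := det_elem12 (1 : F).
have d21 := det_elem21_1 (1 : F).
have u12 : (pad (elem12 (1 : F)) - 1) *m (pad (elem12 1) - 1) = 0.
  by rewrite pad_mx2 mx3_oner mx3_0 !mx3N !mx3D !mx3M; congr mx3; ring.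
have u21 : (pad (elem21 (1 : F)) - 1) *m (pad (elem21 1) - 1) = 0.
  by rewrite pad_mx2 mx3_oner mx3_0 !mx3N !mx3D !mx3M; congr mx3; ring.
(* Third columns of the two intertwining identities kill the column above the corner; the row beside
   the corner will come from [x^-1]. *)
have half y : y \in G -> exists a b c d h i j, rho y = mx3 a b 0 c d 0 h i j.
  move=> Gy; have [B1 E1] := pad_conj Gy d12 u12; have [B2 E2] := pad_conj Gy d21 u21.
  have [a [b [c [d [e [f [h [i [j Ey]]]]]]]]] := mx3P (rho y).
  move: E1 E2; rewrite Ey; have [? [? [? [? ->]]]] := mx2P B1; have [? [? [? [? ->]]]] := mx2P B2.
  rewrite !pad_mx2 !mx3M => /mx3_inj[[[[[[[[_ _] e3] _] _] _] _] _] _].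
  move=> /mx3_inj[[[[[[[[_ _] _] _] _] e6] _] _] _].
  have f0 : f = 0 by apply: (eq_subr_eq e3); ring.
  have c0 : c = 0 by apply: (eq_subr_eq e6); ring.
  by rewrite f0 c0; do 7!eexists.
have [a [b [c [d [h [i [j Ex]]]]]]] := half x Gx.
have GxV : x^-1%g \in G by rewrite groupV.
have [B1 E1] := pad_conj GxV d12 u12; have [B2 E2] := pad_conj GxV d21 u21.
have swap A B : pad A *m rho x^-1%g = rho x^-1%g *m pad B -> rho x *m pad A = pad B *m rho x.
  move=> E; apply: (can_inj (mulmxK (rep_unit frho GxV))).
  rewrite -!mulmxA E (repV frho) // mulmx1 mulmxA (repV frho) // mul1mx //.
have h0 : h = 0 /\ i = 0.
  move: (swap _ _ E1) (swap _ _ E2); rewrite Ex.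
  have [? [? [? [? ->]]]] := mx2P B1; have [? [? [? [? ->]]]] := mx2P B2.
  rewrite !pad_mx2 !mx3M => /mx3_inj[[[[[[[[_ _] _] _] _] _] _] e8] _].
  move=> /mx3_inj[[[[[[[[_ _] _] _] _] _] e7] _] _].
  by split; [apply: (eq_subr_eq e8) | apply: (eq_subr_eq e7)]; ring.
have j1 : j = 1.
  apply: (p_elt_eigen charF natF frho (v := rv3 0 0 1) Gx px).
    by apply/eqP; rewrite rv3_0 => /rv3_inj[_ /eqP]; rewrite oner_eq0.
  by rewrite Ex h0.1 h0.2 rv3M rv3Z; congr rv3; ring.
have Ex' : rho x = pad (mx2 a b c d) by rewrite pad_mx2 Ex h0.1 h0.2 j1.
by exists (mx2 a b c d) => //; rewrite -det_pad -Ex' (p_elt_det charF natF frho).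
Qed.

Lemma Opprime_pad x : x \in Opprime p G -> exists2 A, \det A = 1 & rho x = pad A.
Proof.
move: x; apply: (Opprime_rep_ind frho (P := fun M => exists2 A, \det A = 1 & M = pad A)).
- by exists 1%:M; rewrite ?det1 ?pad1.
- move=> _ _ [A dA ->] [B dB ->]; exists (A *m B); last by rewrite padM.
  by rewrite det_mulmx dA dB mulr1.
exact: p_elt_pad.
Qed.

Lemma pad_Opprime A : \det A = 1 -> mxG rho (Opprime p G) (pad A).
Proof.
have sOG : Opprime p G \subset G by apply: Opprime_sub.
have in_O (M : F -> 'M[F]_2) : M 0 = 1%:M -> (forall s t, M s *m M t = M (s + t)) ->
    (forall s, \det (M s) = 1) -> forall s, mxG rho (Opprime p G) (pad (M s)).
  move=> M0 MD dM s; have [x Gx Ex] := subG (dM s).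
  exists x => //; apply: mem_gen; rewrite inE Gx /=.
  apply: (@one_param_p_elt _ _ p_pr charF _ _ _ _ frho (fun s => pad (M s)) _ _ x s) => //.
    by rewrite M0 pad1.
  by move=> u v; rewrite padM MD.
move: A; apply: SL2_elementary_ind => [A B OA OB|s|s].
- by rewrite -padM; apply: (mxGM frho (K := <<_>>%G)).
- apply: in_O => [|u v|u]; rewrite ?elem12_0 ?elem12D ?det_elem12 //.
apply: in_O => [|u v|u]; rewrite ?elem21_0 ?elem21D ?det_elem21_1 //.
Qed.

End ContainsSL2.

(** The basis consists of the two centres and a vector [e] killed by both forms; the nonzero
    pairings make the centres independent modulo [e]. *)
Lemma transvection_basis (v v' : 'rV[F]_3) (f f' : 'cV[F]_3) :
  v *m f = 0 -> v' *m f' = 0 -> v *m f' != 0 -> v' *m f != 0 ->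
  exists B s t, [/\ B \in unitmx, s != 0, t != 0,
    pad (elem21 s) *m B = B *m transv v f & pad (elem12 t) *m B = B *m transv v' f'].
Proof.
move=> vf vf' nz nz'.
have [s Es] : exists s, v' *m f = s%:M by eexists; apply: mx11_scalar.
have [t Et] : exists t, v *m f' = t%:M by eexists; apply: mx11_scalar.
rewrite Es scalar_mx11_eq0 in nz'; rewrite Et scalar_mx11_eq0 in nz.
have [e [nze ef ef']] : exists e : 'rV[F]_3, [/\ e != 0, e *m f = 0 & e *m f' = 0].
  have : kermx (row_mx f f') != 0.
    rewrite kermx_eq0 /row_free; apply/eqP=> e.
    by have := rank_leq_col (row_mx f f'); rewrite e.
  case/rowV0Pn=> e /sub_kermxP; rewrite mul_mx_row => /eqP.
  rewrite -row_mx0 => /eqP/eq_row_mx[ef ef'] nze; by exists e.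
have [v0 [v1 [v2 Ev]]] := rv3P v; have [v0' [v1' [v2' Ev']]] := rv3P v'.
have [e0 [e1 [e2 Ee]]] := rv3P e.
pose B := mx3 v0 v1 v2 v0' v1' v2' e0 e1 e2.
have mulB x y z : rv3 x y z *m B = x *: v + y *: v' + z *: e.
  by rewrite Ev Ev' Ee !rv3Z !rv3D rv3M.
have rowB (M : 'M_3) : B *m M =
  \matrix_(i, j) (nth 0 [:: v *m M; v' *m M; e *m M] i) 0 j.
  apply/matrixP=> i j; rewrite Ev Ev' Ee !mxE.
  by case: i => [[|[|[|i]]] li] //=; rewrite mxE; apply: eq_bigr => k _; rewrite !mxE.
have uB : B \in unitmx.
  rewrite -row_free_unit -kermx_eq0; apply/rowV0P=> w /sub_kermxP.
  have [x [y [z ->]]] := rv3P w; rewrite mulB => E.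
  have := congr1 (mulmxr f) E; have := congr1 (mulmxr f') E; rewrite /= !mulmxDl -!scalemxAl.
  rewrite vf vf' ef ef' Es Et !mul0mx !scaler0 !addr0 add0r.
  rewrite !scale_scalar_mx => /eqP; rewrite scalar_mx11_eq0 mulf_eq0 (negPf nz) orbF => /eqP x0.
  move=> /eqP; rewrite scalar_mx11_eq0 mulf_eq0 (negPf nz') orbF => /eqP y0.
  move: E; rewrite x0 y0 !scale0r !add0r => /eqP; rewrite scaler_eq0 (negPf nze) orbF => /eqP->.
  by rewrite rv3_0.
have tv (w : 'rV[F]_3) g u k : w *m g = k%:M -> w *m transv u g = w + k *: u.
  by move=> E; rewrite /transv mulmxDr mulmx1 mulmxA E mul_scalar_mx.
exists B, s, t; split=> //; rewrite rowB.
  rewrite (tv v f v 0) ?vf ?raddf0 // (tv v' f v s) // (tv e f v 0) ?ef ?raddf0 //.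
  rewrite !scale0r !addr0 pad_mx2 /B mx3M Ev Ev' Ee rv3Z rv3D.
  apply/matrixP=> i j; rewrite !mxE.
  by case: i => [[|[|[|i]]] li] //; case: j => [[|[|[|j]]] lj] //=; rewrite !mxE /=; ring.
rewrite (tv v f' v' t) // (tv v' f' v' 0) ?vf' ?raddf0 // (tv e f' v' 0) ?ef' ?raddf0 //.
rewrite !scale0r !addr0 pad_mx2 /B mx3M Ev Ev' Ee rv3Z rv3D.
apply/matrixP=> i j; rewrite !mxE.
by case: i => [[|[|[|i]]] li] //; case: j => [[|[|[|j]]] lj] //=; rewrite !mxE /=; ring.
Qed.

Theorem transvection_Opprime (rho : rT -> 'M[F]_3) x0 :
  faithful_rep G rho -> has_strongly_p_embedded p G ->
  x0 \in G -> x0 != 1%g -> (rho x0 - 1) *m (rho x0 - 1) = 0 ->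
  exists rho' : rT -> 'M[F]_3, [/\ faithful_rep G rho',
    forall x, x \in Opprime p G -> exists2 A, \det A = 1 & rho' x = pad A
    & forall A, \det A = 1 -> mxG rho' (Opprime p G) (pad A)].
Proof.
move=> frho [H speH] Gx0 nt0 N2.
have nzN : rho x0 - 1 != 0.
  apply: contra nt0; rewrite subr_eq0 => /eqP E; apply/eqP/(rep_inj frho) => //.
  by rewrite E (rep1 frho).
have [v [f [EN vf]]] := transv_form (leqnn 3) nzN N2.
have Ex0 : rho x0 = transv v f by rewrite /transv -EN addrC subrK.
have p0 := transv_p_elt frho Gx0 vf Ex0.
have [k Gk Hx0] := spe_cover p_pr speH Gx0 p0.
have [g [Gg _ Hg]] := spe_proper_conj p_pr speH.
(* [h] carries [H :^ k] to [H :^ (g * k)], so [x0] and its conjugate [x1] lie in no common conjugate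
   of [H]; by [transv_chain] both pairings are nonzero. *)
pose h := (k^-1 * (g * k))%g; have Gh : h \in G by rewrite !(groupM, groupV).
pose x1 := (x0 ^ h)%g; have Gx1 : x1 \in G by rewrite groupJ.
have nt1 : x1 != 1%g by rewrite conjg_eq1.
have Hx1 : x1 \in H :^ (g * k) by rewrite -[(g * k)%g](mulKVg k) conjsgM memJ_conjg.
have Ggk : (g * k)%g \in G by rewrite groupM.
pose v' := v *m rho h; pose f' := rho h^-1%g *m f.
have Ex1 : rho x1 = transv v' f'.
  apply: (can_inj (mulKmx (rep_unit frho Gh))); rewrite (repJ frho Gx0 Gh) Ex0.
  by rewrite /transv mulmxDl mulmxDr mul1mx mulmx1 !mulmxA (repV frho Gh) mul1mx.
have vf' : v' *m f' = 0 by rewrite /v' /f' mulmxA -(mulmxA v) (repV frho Gh) mulmx1.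
have notboth l : l \in G -> x0 \in H :^ l -> x1 \in H :^ l -> False.
  move=> Gl x0l x1l; apply: (Hg x0 k p0 nt0 Gk Hx0).
  have p1 : p.-elt x1 by rewrite p_eltJ.
  by rewrite -(spe_conj_eq speH Gl Ggk p1 nt1 x1l Hx1).
have [nz nz'] : v *m f' != 0 /\ v' *m f != 0.
  by split; apply/eqP=> e0; apply: (notboth k Gk Hx0);
   apply: (transv_chain frho speH Gx0 Gx1 vf vf' _ nt0 Ex0 Ex1 Gk Hx0); [left | right].
have [B [s [t [uB s0 t0 E21 E12]]]] := transvection_basis vf vf' nz nz'.
pose rho' x := B *m rho x *m invmx B.
have frho' : faithful_rep G rho' := faithful_rep_basis uB frho.
have E0' : rho' x0 = pad (elem21 s) by rewrite /rho' Ex0 -E21 mulmxK.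
have E1' : rho' x1 = pad (elem12 t) by rewrite /rho' Ex1 -E12 mulmxK.
have gen (K : {group rT}) : K \subset G -> x0 \in K -> x1 \in K ->
    forall A, \det A = 1 -> mxG rho' K (pad A).
  move=> sKG K0 K1; apply: SL2_elementary_ind => [A C KA KC|u|u].
  - by rewrite -padM; apply: (mxGM frho' sKG KA KC).
  - apply: (@one_param _ natF _ _ _ _ frho' (fun a => pad (elem12 a)) _ _ K t sKG t0) => [|a b|].
    + by rewrite elem12_0 pad1.
    + by rewrite padM elem12D.
    by exists x1.
  apply: (@one_param _ natF _ _ _ _ frho' (fun a => pad (elem21 a)) _ _ K s sKG s0) => [|a b|].
  - by rewrite elem21_0 pad1.
  - by rewrite padM elem21D.
  by exists x0.
have subG := gen G (subxx _) Gx0 Gx1.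
have nconc l : l \in G -> exists2 A, \det A = 1 & ~ mxG rho' (H :^ l) (pad A).
  move=> Gl; have sHl : H :^ l \subset G by rewrite conj_subG ?(spe_sub speH).
  have [x0l|nx0] := boolP (x0 \in H :^ l).
    exists (elem12 t); rewrite ?det_elem12 // -E1'.
    by move/(mxG_mem frho' Gx1 (K := (H :^ l)%G) sHl)/(notboth l Gl x0l).
  exists (elem21 s); rewrite ?det_elem21_1 // -E0'.
  by move/(mxG_mem frho' Gx0 (K := (H :^ l)%G) sHl); apply/negP.
exists rho'; split=> // [x|A dA].
  exact: (Opprime_pad frho' speH subG nconc).
exact: (pad_Opprime frho' subG dA).
Qed.

End Transvections.

(** * Groups without transvections *)

Section Unipotent3.
Local Open Scope ring_scope.
Variable F : fieldType.
Hypothesis F2 : 2%:R != 0 :> F.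

(** The exponential of [s] times the nilpotent Jordan block, so that parameters add. *)
Definition unip3 (s : F) := mx3 1 s (s ^+ 2 / 2%:R) 0 1 s 0 0 1.

Lemma unip3D s t : unip3 s *m unip3 t = unip3 (s + t).
Proof. by rewrite mx3M; congr mx3; field. Qed.

Lemma unip3_0 : unip3 0 = 1%:M.
Proof. by rewrite mx3_1; congr mx3; field. Qed.

Lemma rv3_unip3_sub1 a b c :
  rv3 a b c *m unip3 1 + (-1) *: rv3 a b c = rv3 0 a (a / 2%:R + b).
Proof. by rewrite rv3M rv3Z rv3D; congr rv3; field. Qed.

(* The basis is e, e n, e n^2, where n is the logarithm of M. *)
Lemma regular_basis (M : 'M[F]_3) (e : 'rV[F]_3) : (M - 1) ^+ 3 = 0 ->
  e *m ((M - 1) *m (M - 1)) != 0 ->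
  let n := (M - 1) - 2%:R^-1 *: ((M - 1) *m (M - 1)) in
  exists B, [/\ B \in unitmx, B *m M = unip3 1 *m B & forall z eps,
    z *m n = - (n *m z) -> e *m z = eps *: e ->
    B *m z = eps *: mx3 1 0 0 0 (-1) 0 0 0 1 *m B].
Proof.
set N := M - 1; have EM0 : M = 1 + N by rewrite addrC subrK.
clearbody N => N3; set N2 := N *m N => nz n.
have N2N : N2 *m N = 0 by rewrite /N2 -mulmxA -[RHS]N3.
have NN2 : N *m N2 = 0 by rewrite -[RHS]N3.
have N2N2 : N2 *m N2 = 0 by rewrite {1}/N2 -mulmxA NN2 mulmx0.
have nn : n *m n = N2.
  rewrite /n mulmxBl !mulmxBr -!scalemxAl -!scalemxAr N2N NN2 N2N2.
  by rewrite !scaler0 !subr0.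
have nN : n *m N = N2 by rewrite /n mulmxBl -scalemxAl N2N scaler0 subr0.
pose e2 := e *m n; pose e3 := e *m N2.
have [a0 [a1 [a2 Ee]]] := rv3P e; have [b0 [b1 [b2 Ee2]]] := rv3P e2.
have [c0 [c1 [c2 Ee3]]] := rv3P e3.
pose B := mx3 a0 a1 a2 b0 b1 b2 c0 c1 c2.
have mulB x y z : rv3 x y z *m B = x *: e + y *: e2 + z *: e3.
  by rewrite Ee Ee2 Ee3 !rv3Z !rv3D rv3M.
have uB : B \in unitmx.
  rewrite -row_free_unit -kermx_eq0; apply/rowV0P=> w /sub_kermxP.
  have [x [y [z ->]]] := rv3P w; rewrite mulB => E.
  have e2N : e2 *m N = e3 by rewrite /e2 -mulmxA nN.
  have x0 : x = 0.
    have := congr1 (mulmxr N2) E; rewrite /= !mulmxDl -!scalemxAl mul0mx.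
    have -> : e2 *m N2 = 0 by rewrite /N2 mulmxA e2N /e3 -mulmxA N2N mulmx0.
    rewrite /e3 -mulmxA N2N2 mulmx0 !scaler0 !addr0 => /eqP.
    by rewrite scaler_eq0 (negPf nz) orbF => /eqP.
  have y0 : y = 0.
    have := congr1 (mulmxr N) E; rewrite /= x0 scale0r add0r mulmxDl -!scalemxAl mul0mx e2N.
    rewrite /e3 -mulmxA N2N mulmx0 scaler0 addr0 => /eqP.
    by rewrite scaler_eq0 (negPf nz) orbF => /eqP.
  move: E; rewrite x0 y0 !scale0r !add0r => /eqP; rewrite scaler_eq0 (negPf nz) orbF => /eqP->.
  by rewrite rv3_0.
have rowsP (A C : 'M_3) : e *m A = rv3 1 0 0 *m C -> e2 *m A = rv3 0 1 0 *m C ->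
    e3 *m A = rv3 0 0 1 *m C -> B *m A = C.
  have [? [? [? [? [? [? [? [? [? ->]]]]]]]]] := mx3P A.
  have [? [? [? [? [? [? [? [? [? ->]]]]]]]]] := mx3P C.
  rewrite Ee Ee2 Ee3 !rv3M mx3M !(mul0r, mul1r, add0r, addr0).
  by move=> /rv3_inj E1 /rv3_inj E2 /rv3_inj E3; rewrite !E1 !E2 !E3.
have EM v : v *m M = v + v *m N by rewrite EM0 mulmxDr mulmx1.
exists B; split=> // [|z eps zn ez].
  apply: rowsP; rewrite EM mulmxA rv3M mulB !(mul0r, mul1r, add0r, addr0, scale0r, scale1r).
  - rewrite -addrA; congr (_ + _); rewrite /e2 /e3 /n mulmxBr -scalemxAr.
    by rewrite expr1n mul1r subrK.
  - by rewrite /e2 -mulmxA nN.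
  by rewrite /e3 -mulmxA N2N mulmx0 addr0.
have e2z : e2 *m z = - eps *: e2.
  by rewrite /e2 -mulmxA -[n *m z]opprK -zn mulmxN mulmxA ez -scalemxAl scaleNr.
have e3z : e3 *m z = eps *: e3.
  have E3 : e3 = e2 *m n by rewrite /e2 -mulmxA nn.
  by rewrite E3 -mulmxA -[n *m z]opprK -zn mulmxN mulmxA e2z scaleNr mulNmx opprK -scalemxAl.
apply: rowsP; rewrite -scalemxAl -scalemxAr mulmxA rv3M mulB !(mul0r, mul1r, add0r, addr0, scale0r, scale1r) //.
by rewrite scaleN1r scalerN -scaleNr.
Qed.

(** With T = N z N the hypothesis reads N z + z N + T = 0. Multiplying by N on one side gives N N z
    = - T = z N N, once N N z N and N z N N are known to vanish. *)
Lemma log_antimorph_aux (R : nzRingType) (N z : R) : N * N * N = 0 ->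
  (1 + N) * z * (1 + N) = z -> N * N * z + z * N * N = (N * z + z * N) *+ 2.
Proof.
move=> N3 E; pose T := N * z * N.
have E1 : N * z + z * N + T = 0.
  move: E; rewrite mulrDl mul1r mulrDr mulr1 mulrDl -addrA => /eqP.
  by rewrite -subr_eq0 addrAC subrr add0r addrA => /eqP.
have A : N * N * z * N = 0.
  have := congr1 (fun x => N * N * x) E1; rewrite /T /= mulr0 !mulrDr !mulrA N3.
  by rewrite !mul0r add0r addr0.
have A' : N * z * N * N = 0.
  have := congr1 (fun x => x * (N * N)) E1; rewrite /T /= mul0r !mulrDl !mulrA.
  by rewrite -(mulrA z) -(mulrA z) N3 -(mulrA (N * z)) -(mulrA (N * z)) N3 !mulr0 !addr0.
have E2 : N * N * z = - T.
  apply/eqP; rewrite -addr_eq0; apply/eqP.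
  have := congr1 (fun x => N * x) E1; rewrite /T /= mulr0 !mulrDr !mulrA A.
  by rewrite addr0.
have E3 : z * N * N = - T.
  apply/eqP; rewrite -addr_eq0; apply/eqP.
  have := congr1 (fun x => x * N) E1; rewrite /T /= mul0r !mulrDl A'.
  by rewrite addr0 addrC.
have -> : N * z + z * N = - T by apply/eqP; rewrite -addr_eq0 E1.
by rewrite E2 E3 mulr2n.
Qed.

(* z inverts M, hence negates its logarithm. *)
Lemma log_antimorph (M z : 'M[F]_3) : (M - 1) ^+ 3 = 0 -> M *m z *m M = z ->
  let n := (M - 1) - 2%:R^-1 *: ((M - 1) *m (M - 1)) in z *m n = - (n *m z).
Proof.
set N := M - 1; have EM : M = 1 + N by rewrite addrC subrK.
clearbody N => N3 MzM n.
have /(log_antimorph_aux (R := 'M[F]_3)) : N * N * N = 0 by rewrite -mulrA -expr2 -exprS.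
move/(_ z); rewrite -EM => /(_ MzM) E.
apply/eqP; rewrite -addr_eq0 /n mulmxBr mulmxBl -scalemxAr -scalemxAl mulmxA.
rewrite addrACA -opprD -scalerDr subr_eq0.
rewrite [X in _ *: X]addrC (_ : N *m N *m z + z *m N *m N = (N *m z + z *m N) *+ 2) //.
by rewrite -scaler_nat scalerA mulVf // scale1r addrC.
Qed.

End Unipotent3.

Section NoTransvection.
Variables (p : nat) (F : fieldType).
Hypotheses (p_pr : prime p) (charF : p \in [pchar F]%R).
Hypothesis natF : forall a : F, exists k : nat, a = (k%:R)%R.
Local Open Scope ring_scope.
Hypothesis F2 : 2%:R != 0 :> F.
Variables (rT : finGroupType) (G : {group rT}).

Definition no_transvection (rho : rT -> 'M[F]_3) :=
  forall x, x \in G -> (rho x - 1) *m (rho x - 1) = 0 -> x = 1%g.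

Section Normalized.
Variables (rho : rT -> 'M[F]_3) (x : rT).
Hypotheses (frho : faithful_rep G rho) (ntv : no_transvection rho).
Hypotheses (Gx : x \in G) (Ex : rho x = unip3 1).

Lemma rho_exp k : rho (x ^+ k)%g = unip3 k%:R.
Proof.
rewrite (@one_param_exp _ _ _ _ _ frho (@unip3 F) (unip3_0 F2) (unip3D F2) x 1) //.
by rewrite mulr1.
Qed.

(** A power of [x] cancels the entry [b], and a unitriangular matrix g with that entry 0 satisfies
    (g - 1)^2 = 0. *)
Lemma unitriangular_cycle y b c f : y \in G -> rho y = mx3 1 b c 0 1 f 0 0 1 -> y \in <[x]>%g.
Proof.
move=> Gy Ey; have [k Ek] := natF (- b).
have w1 : (y * x ^+ k = 1)%g.
  apply: ntv; rewrite ?groupM ?groupX // (repM frho) ?groupX // rho_exp -Ek Ey.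
  rewrite mx3M mx3_oner mx3N mx3D mx3M mx3_0; congr mx3; field; exact: F2.
have -> : y = ((x ^+ k)^-1)%g by apply/eqP; rewrite eq_mulgV1 invgK w1.
by rewrite groupV mem_cycle.
Qed.

(** A matrix commuting with [unip3 1] is upper triangular with constant diagonal, and the eigenvalue
    of a p-element is 1. *)
Lemma centralizer_cycle_norm y : y \in G -> p.-elt y -> commute x y -> y \in <[x]>%g.
Proof.
move=> Gy py cxy; have := congr1 rho cxy; rewrite !(repM frho) // Ex.
have [a [b [c [d [e [f [g [h [i Ey]]]]]]]]] := mx3P (rho y).
rewrite Ey !mx3M => /mx3_inj[[[[[[[[e1 e2] e3] e4] e5] e6] e7] e8] e9].
have g0 : g = 0 by apply: (eq_subr_eq e4); ring.
have h0 : h = 0 by rewrite g0 in e9; apply: (eq_subr_eq (esym e9)); field.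
have d0 : d = 0 by rewrite h0 in e5; apply: (eq_subr_eq (esym e5)); ring.
have ei : e = i by apply/esym/eqP; rewrite -subr_eq0; apply/eqP; rewrite d0 in e6; apply: (eq_subr_eq e6); field.
have ae : a = e by apply/esym/eqP; rewrite -subr_eq0; apply/eqP; rewrite h0 in e2; apply: (eq_subr_eq e2); field.
have i1 : i = 1.
  apply: (p_elt_eigen charF natF frho (v := rv3 0 0 1) Gy py).
    by apply/eqP; rewrite rv3_0 => /rv3_inj[_ /eqP]; rewrite oner_eq0.
  by rewrite Ey g0 h0 rv3M rv3Z; congr rv3; ring.
by apply: (unitriangular_cycle (b := b) (c := c) (f := f) Gy); rewrite Ey g0 h0 d0 ae ei i1.
Qed.

(** Modulo the common fixed line [y] acts by a 2 x 2 block of determinant 1. If this block moves the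
    line fixed by [x] there, [x] and its conjugate by [y] generate SL_2 on the quotient, so some [k]
    acts as -1. The commutator of [k] and [x] is trivial on quotient and line, hence trivial by
    [ntv], which forces 2 = 0. *)
Lemma fixed_line_cycle_norm y : y \in G -> p.-elt y -> rv3 0 0 1 *m rho y = rv3 0 0 1 -> y \in <[x]>%g.
Proof.
move=> Gy py.
have [a [b [c [d [e [f [g [h [i Ey]]]]]]]]] := mx3P (rho y).
rewrite Ey rv3M !(mul0r, mul1r, add0r) => /rv3_inj[[g0 h0] i1]; rewrite g0 h0 i1 in Ey.
have Epad : rho y = mx3 a b c d e f 0 0 1 by [].
have dt : a * e - b * d = 1.
  have := p_elt_det charF natF frho Gy py; rewrite Ey.
  have -> : mx3 a b c d e f 0 0 1 = block_mx (mx2 a b d e) (\col_i nth 0 [:: c; f] i) 0 (1%:M : 'M_1) :> 'M_(2 + 1).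
    apply/matrixP=> u v; rewrite !mxE.
    case: splitP => -[[|[|?]] //= ?] Eu; rewrite !mxE; case: splitP => -[[|[|?]] //= ?] Ev;
     by rewrite !mxE /= ?Eu ?Ev //=.
  by rewrite (@det_ublock _ 2 1) det1 mulr1 det_mx2.
have [d0 | nzd] := eqVneq d 0.
  have a1 : a = 1.
    have := p_elt_unipotent charF frho Gy py; rewrite exprS expr2 Ey d0.
    change ((mx3 a b c 0 e f 0 0 1 - 1) *m ((mx3 a b c 0 e f 0 0 1 - 1) *m (mx3 a b c 0 e f 0 0 1 - 1)) = 0 -> a = 1).
    rewrite mx3_oner mx3_0 !mx3N !mx3D !mx3M => /mx3_inj[[[[[[[[e1 _] _] _] _] _] _] _] _].
    have a3 : (a - 1) ^+ 3 = 0 by apply: (eq_subr_eq e1); ring.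
    by move/eqP: a3; rewrite expf_eq0 subr_eq0 => /eqP.
  apply: (unitriangular_cycle (b := b) (c := c) (f := f) Gy); rewrite Ey d0 a1.
  by move: dt; rewrite d0 a1 mulr0 subr0 mul1r => ->.
(* The column [u], [v] is left free: only the action modulo the fixed line is tracked. *)
pose P (A : 'M[F]_2) := exists g, [/\ g \in G & exists u v, rho g =
   mx3 (A ord0 ord0) (A ord0 ord_max) u (A ord_max ord0) (A ord_max ord_max) v 0 0 1].
have PE a1 b1 c1 d1 : P (mx2 a1 b1 c1 d1) <-> exists2 g, g \in G & exists u v, rho g = mx3 a1 b1 u c1 d1 v 0 0 1.
  rewrite /P !mxE /=; split=> [[g1 []]|[g1]]; by exists g1.
have PM A B : P A -> P B -> P (A *m B).
  have [? [? [? [? ->]]]] := mx2P A; have [? [? [? [? ->]]]] := mx2P B.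
  rewrite mx2M !PE => -[g1 Gg1 [u1 [v1 E1]]] [g2 Gg2 [u2 [v2 E2]]].
  exists (g1 * g2)%g; rewrite ?groupM // (repM frho) // E1 E2 mx3M.
  by do 2!eexists; congr mx3; ring.
have P12 s : P (root2 0 1 s).
  apply/PE; have [k Ek] := natF (- s).
  exists (x ^+ k)%g; rewrite ?groupX // rho_exp -Ek.
  by do 2!eexists; congr mx3; ring.
have PY : P (mx2 a b d e) by apply/PE; exists y => //; exists c, f.
have PYV : P (mx2 e (- b) (- d) a).
  apply/PE; exists y^-1%g; rewrite ?groupV //; exists (b * f - e * c), (d * c - a * f).
  apply: (can_inj (mulKmx (rep_unit frho Gy))); rewrite (repV frho) // Ey mx3M mx3_1.
  by congr mx3; first [ring | rewrite -dt; ring].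
have Pde s : P (root2 d e s).
  have -> : root2 d e s = mx2 e (- b) (- d) a *m root2 0 1 s *m mx2 a b d e.
    rewrite root2_01 !mx2M !(mul1r, mulr1, mulr0, addr0, add0r, mul0r).
    by congr mx2; rewrite -?dt; ring.
  exact: (PM _ _ (PM _ _ PYV (P12 s)) PY).
have [] : P (mx2 (-1) 0 0 (-1)).
  have nz : 0 * e - 1 * d != 0 by rewrite mul0r mul1r sub0r oppr_eq0.
  by apply: (SL2_roots_ind PM nz P12 Pde); rewrite det_mx2; ring.
move=> k [Gk [u [v]]]; rewrite !mxE /= => Ek.
have : (k * x)%g = (x * k)%g.
  pose w := ((x * k)^-1 * (k * x))%g; have Gw : w \in G by rewrite !(groupM, groupV).
  suffices w1 : w = 1%g by rewrite -[LHS](mulKVg (x * k)%g) -/w w1 mulg1.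
  have Ew : rho w = mx3 1 0 (v - 1) 0 1 2%:R 0 0 1.
    have uxk : rho (x * k)%g \in unitmx by apply: (rep_unit frho); rewrite groupM.
    apply: (can_inj (mulKmx uxk)).
    rewrite -(repM frho (groupM Gx Gk) Gw) /w mulKVg !(repM frho) // Ex Ek !mx3M.
    by congr mx3; field.
  apply: ntv => //; rewrite Ew mx3_oner mx3N mx3D mx3M mx3_0; congr mx3; ring.
move/(congr1 rho); rewrite !(repM frho) // Ex Ek !mx3M => /mx3_inj[[[[[[[[_ _] _] _] _] e6] _] _] _].
have F20 : 2%:R = 0 :> F by apply: (eq_subr_eq (esym e6)); ring.
by case/eqP: F2.
Qed.

End Normalized.

Section Regular.
Variable rho : rT -> 'M[F]_3.
Hypotheses (frho : faithful_rep G rho) (ntv : no_transvection rho).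

Lemma no_transvection_basis B :
  B \in unitmx -> no_transvection (fun x => B *m rho x *m invmx B).
Proof.
move=> uB x Gx; have -> : B *m rho x *m invmx B - 1 = B *m (rho x - 1) *m invmx B.
  by rewrite mulmxBr mulmxBl mulmx1 mulmxV.
rewrite !mulmxA mulmxKV // -(mulmxA B) => E; apply: ntv => //.
apply: (can_inj (mulKmx uB)); rewrite mulmx0.
by apply: (can_inj (mulmxK (_ : invmx B \in unitmx))); rewrite ?unitmx_inv // mul0mx.
Qed.

Lemma p_elt_regular x : x \in G -> p.-elt x -> x != 1%g ->
  (rho x - 1) ^+ 3 = 0 /\ exists e : 'rV_3, e *m ((rho x - 1) *m (rho x - 1)) != 0.
Proof.
move=> Gx px ntx; split; first exact: (p_elt_unipotent charF frho).
have nz : (rho x - 1) *m (rho x - 1) != 0 by apply: contra ntx => /eqP/(ntv Gx)->.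
move: ((rho x - 1) *m _) nz => N nz.
have [i nzi] : exists i, row i N != 0.
  apply/existsP; apply: contraR nz; rewrite negb_exists => /forallP z; apply/eqP/row_matrixP=> i.
  by rewrite row0; apply/eqP/negPn.
by exists (delta_mx 0 i); rewrite -rowE.
Qed.

Lemma p_elt_normal_form x : x \in G -> p.-elt x -> x != 1%g ->
  exists2 B, B \in unitmx & B *m rho x *m invmx B = unip3 1.
Proof.
move=> Gx px ntx; have [N3 [e nz]] := p_elt_regular Gx px ntx.
by have [B [uB EB _]] := regular_basis N3 nz; exists B; rewrite // EB mulmxK.
Qed.

Lemma centralizer_cycle x y : x \in G -> p.-elt x -> x != 1%g ->
  y \in G -> p.-elt y -> commute x y -> y \in <[x]>%g.
Proof.
move=> Gx px ntx Gy py; have [B uB EB] := p_elt_normal_form Gx px ntx.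
exact: (centralizer_cycle_norm (faithful_rep_basis uB frho) (no_transvection_basis uB) Gx EB).
Qed.

Lemma fixed_line_cycle x y (v : 'rV_3) : x \in G -> p.-elt x -> x != 1%g ->
  y \in G -> p.-elt y -> v != 0 -> v *m rho x = v -> v *m rho y = v -> y \in <[x]>%g.
Proof.
move=> Gx px ntx Gy py nzv vx vy; have [B uB EB] := p_elt_normal_form Gx px ntx.
apply: (fixed_line_cycle_norm (faithful_rep_basis uB frho) (no_transvection_basis uB) Gx EB) => //.
pose w := v *m invmx B.
have wx : w *m unip3 1 = w by rewrite -EB /w !mulmxA mulmxKV // vx.
have wy : w *m (B *m rho y *m invmx B) = w by rewrite /w !mulmxA mulmxKV // vy.
have nzw : w != 0.
  by apply: contra nzv => /eqP w0; rewrite -[v](mulmxKV uB) -/w w0 mul0mx.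
have [a [b [c Ew]]] := rv3P w; move: wx; rewrite Ew rv3M => /rv3_inj[[_ e2] e3].
have a0 : a = 0 by apply: (eq_subr_eq e2); ring.
have b0 : b = 0 by rewrite a0 in e3; apply: (eq_subr_eq e3); ring.
have nzc : c != 0 by apply: contra nzw => /eqP c0; rewrite Ew a0 b0 c0 rv3_0.
have Ec : w = c *: rv3 0 0 1 by rewrite Ew a0 b0 rv3Z; congr rv3; ring.
by move: wy; rewrite Ec -scalemxAl => /(scalerI nzc).
Qed.

End Regular.

Section Dual.
Variable rho : rT -> 'M[F]_3.
Hypotheses (frho : faithful_rep G rho) (ntv : no_transvection rho).

Let rhoD x := (rho x^-1%g)^T.

Lemma faithful_rep_dual : faithful_rep G rhoD.
Proof.
split=> [|x y Gx Gy|x y Gx Gy /trmx_inj E]; rewrite /rhoD.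
- by rewrite invg1 (rep1 frho) trmx1.
- by rewrite invMg (repM frho) ?groupV // trmx_mul.
by apply: invg_inj; apply: (rep_inj frho); rewrite ?groupV.
Qed.

Lemma no_transvection_dual : no_transvection rhoD.
Proof.
move=> x Gx; have -> : rhoD x - 1 = (rho x^-1%g - 1)^T by rewrite linearB /= trmx1.
rewrite -trmx_mul => /(congr1 trmx); rewrite trmxK trmx0 => /ntv E.
by apply: invg_inj; rewrite invg1 E ?groupV.
Qed.

(** This is [fixed_line_cycle] for the contragredient representation. *)
Lemma fixed_plane_cycle x y (f : 'cV_3) : x \in G -> p.-elt x -> x != 1%g ->
  y \in G -> p.-elt y -> f != 0 -> rho x *m f = f -> rho y *m f = f -> y \in <[x]>%g.
Proof.
move=> Gx px ntx Gy py nzf fx fy.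
have fixV z : z \in G -> rho z *m f = f -> f^T *m rhoD z = f^T.
  move=> Gz fz; rewrite -trmx_mul; congr trmx.
  by rewrite -{1}fz mulmxA (repVr frho) // mul1mx.
apply: (fixed_line_cycle faithful_rep_dual no_transvection_dual (v := f^T)) => //; try exact: fixV.
by rewrite -trmx0 (inj_eq trmx_inj).
Qed.

Lemma p_elt_coeigen y (f : 'cV_3) l : y \in G -> p.-elt y -> f != 0 ->
  rho y *m f = l *: f -> l = 1.
Proof.
move=> Gy py nzf E; apply: (p_elt_eigen charF natF faithful_rep_dual (x := y^-1%g) (v := f^T)).
- by rewrite groupV.
- by rewrite p_eltV.
- by rewrite -trmx0 (inj_eq trmx_inj).
by rewrite /rhoD invgK -trmx_mul E linearZ.
Qed.

End Dual.

(** The cyclic group of [x] lies in one conjugate of [H], while conjugates of [x] reach another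
    one. *)
Lemma spe_p_elt_outside x : has_strongly_p_embedded p G ->
  x \in G -> p.-elt x -> x != 1%g -> exists y, [/\ y \in G, p.-elt y & y \notin <[x]>%g].
Proof.
case=> H speH Gx px ntx; have [k Gk Hx] := spe_cover p_pr speH Gx px.
have [g [Gg _ Hg]] := spe_proper_conj p_pr speH.
pose h := (k^-1 * (g * k))%g; have Gh : h \in G by rewrite !(groupM, groupV).
have sxH : <[x]>%g \subset H :^ k by rewrite cycle_subG.
exists (x ^ h)%g; split; rewrite ?p_eltJ //; first exact: groupJ.
apply/negP=> xh; apply: (Hg (x ^ h)%g k _ _ Gk); rewrite ?p_eltJ ?conjg_eq1 //.
  exact: (subsetP sxH).
by rewrite -[(g * k)%g](mulKVg k) conjsgM memJ_conjg.
Qed.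

Lemma spe_p_elt : has_strongly_p_embedded p G -> exists x, [/\ x \in G, p.-elt x & x != 1%g].
Proof.
case=> H speH; have [P sylP sPH] := spe_Sylow p_pr speH.
have ntP : P :!=: 1%g.
  rewrite -rank_gt0 (rank_Sylow sylP) p_rank_gt0 mem_primes p_pr cardG_gt0.
  by apply: dvdn_trans (cardSg (spe_sub speH)); case: speH.
have [x Px ntx] := trivgPn _ ntP.
exists x; split=> //; first exact: (subsetP (pHall_sub sylP)).
by case/and3P: sylP => _ pP _; apply: mem_p_elt pP Px.
Qed.

(** In a Jordan basis of [x] the invariant set contains the last basis vector. A p-element [y]
    outside the cyclic group of [x] stabilises neither the line nor the plane that [x] stabilises,
    so some vector of the set has nonzero first coordinate, and [x] spreads it over the whole
    space. *)
Lemma no_transvection_irreducible (rho : rT -> 'M[F]_3) (X : 'rV[F]_3 -> Prop) :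
  faithful_rep G rho -> no_transvection rho -> has_strongly_p_embedded p G ->
  (forall v w, X v -> X w -> X (v + w)) -> (forall a v, X v -> X (a *: v)) ->
  (forall g v, g \in G -> X v -> X (v *m rho g)) ->
  (exists2 v, v != 0 & X v) -> forall v, X v.
Proof.
move=> frho ntv spe XD XZ XG [v0 nzv0 Xv0].
have [x [Gx px ntx]] := spe_p_elt spe.
have [y [Gy py nxy]] := spe_p_elt_outside spe Gx px ntx.
have [B uB EB] := p_elt_normal_form frho ntv Gx px ntx.
pose X' w := X (w *m B); pose rho' g := B *m rho g *m invmx B.
have frho' : faithful_rep G rho' := faithful_rep_basis uB frho.
have ntv' : no_transvection rho' := no_transvection_basis ntv uB.
have XD' v w : X' v -> X' w -> X' (v + w) by rewrite /X' mulmxDl; apply: XD.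
have XZ' a v : X' v -> X' (a *: v) by rewrite /X' -scalemxAl; apply: XZ.
have XG' g v : g \in G -> X' v -> X' (v *m rho' g).
  by move=> Gg Xv; rewrite /X' /rho' !mulmxA mulmxKV //; apply: XG.
have XB v : X' v -> X' (v *m unip3 1 + (-1) *: v).
  by move=> Xv; apply: (XD'); [rewrite -EB; apply: (XG') | apply: (XZ')].
have down a b c : X' (rv3 a b c) -> X' (rv3 0 a (a / 2%:R + b)).
  by move=> Xv; rewrite -(rv3_unip3_sub1 F2 _ _ c); apply: XB.
have scale1 a b c : X' (rv3 a b c) -> forall k, X' (rv3 (k * a) (k * b) (k * c)).
  by move=> Xv k; rewrite -rv3Z; apply: (XZ').
have X'e3 b c : b != 0 -> X' (rv3 0 b c) -> X' (rv3 0 0 1).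
  move=> nz /down; rewrite mul0r add0r => /scale1/(_ b^-1).
  by rewrite !mulr0 mulVf.
have X'e2 b c : b != 0 -> X' (rv3 0 b c) -> X' (rv3 0 1 0).
  move=> nz X0; have X3 := X'e3 b c nz X0.
  have -> : rv3 0 1 0 = b^-1 *: rv3 0 b c + (- (c / b)) *: rv3 0 0 1.
    by rewrite !rv3Z rv3D; congr rv3; field.
  by apply: (XD'); apply: (XZ').
have X'e3a a b c : a != 0 -> X' (rv3 a b c) -> X' (rv3 0 0 1).
  by move=> nz /down; apply: X'e3.
have X3 : X' (rv3 0 0 1).
  have : X' (v0 *m invmx B) by rewrite /X' mulmxKV.
  have : v0 *m invmx B != 0.
    by apply: contra nzv0 => /eqP w0; rewrite -[v0](mulmxKV uB) w0 mul0mx.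
  have [a [b [c ->]]] := rv3P (v0 *m invmx B) => nz Xw.
  have [a0|] := eqVneq a 0; last by move=> nza; apply: X'e3a Xw.
  rewrite a0 in nz Xw; have [b0|] := eqVneq b 0; last by move=> nzb; apply: X'e3 Xw.
  rewrite b0 in nz Xw; have nzc : c != 0 by apply: contra nz => /eqP->; rewrite rv3_0.
  by have := scale1 _ _ _ Xw c^-1; rewrite !mulr0 mulVf.
have [a [b [c [d [e [f [g [h [i Ey]]]]]]]]] := mx3P (rho' y).
have [u1 [u2 [u3 [nz1 Xu]]]] : exists u1 u2 u3, u1 != 0 /\ X' (rv3 u1 u2 u3).
  have : X' (rv3 g h i).
    by have := XG' _ _ Gy X3; rewrite Ey rv3M !(mul0r, mul1r, add0r).
  have [g0|nzg] := eqVneq g 0; last by exists g, h, i.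
  have [h0|nzh] := eqVneq h 0.
    have nz3 : rv3 0 0 1 != 0 :> 'rV[F]_3.
      by apply/eqP; rewrite rv3_0 => /rv3_inj[_ /eqP]; rewrite oner_eq0.
    have Ey3 : rv3 0 0 1 *m rho' y = i *: rv3 0 0 1.
      by rewrite Ey g0 h0 rv3M rv3Z; congr rv3; ring.
    have i1 := p_elt_eigen charF natF frho' Gy py nz3 Ey3.
    case/negP: nxy; apply: (fixed_line_cycle frho' ntv' Gx px ntx Gy py nz3).
      by rewrite /rho' EB rv3M; congr rv3; ring.
    by rewrite Ey3 i1 scale1r.
  rewrite g0 => /(X'e2 _ _ nzh) X2.
  have : X' (rv3 d e f).
    by have := XG' _ _ Gy X2; rewrite Ey rv3M !(mul0r, mul1r, add0r, addr0).
  have [d0|nzd] := eqVneq d 0; last by exists d, e, f.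
  have nzf : (rv3 1 0 0)^T != 0 :> 'cV[F]_3.
    rewrite -trmx0 (inj_eq trmx_inj).
    by apply/eqP; rewrite rv3_0 => /rv3_inj[[/eqP]]; rewrite oner_eq0.
  have Eyf : rho' y *m (rv3 1 0 0)^T = a *: (rv3 1 0 0)^T.
    by rewrite Ey g0 d0 mx3_cV rv3_tr_scale; congr (_^T); congr rv3; ring.
  have a1 := p_elt_coeigen frho' Gy py nzf Eyf.
  case/negP: nxy; apply: (fixed_plane_cycle frho' ntv' Gx px ntx Gy py nzf).
    by rewrite /rho' EB mx3_cV; congr (_^T); congr rv3; ring.
  by rewrite Eyf a1 scale1r.
have X2 : X' (rv3 0 1 0) := X'e2 _ _ nz1 (down _ _ _ Xu).
move=> v; rewrite -[v](mulmxKV uB) -/(X' _).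
have [w1 [w2 [w3 ->]]] := rv3P (v *m invmx B).
have -> : rv3 w1 w2 w3 = (w1 / u1) *: rv3 u1 u2 u3 +
    ((w2 - w1 / u1 * u2) *: rv3 0 1 0 + (w3 - w1 / u1 * u3) *: rv3 0 0 1).
  by rewrite !rv3Z !rv3D; congr rv3; field.
by apply: (XD'); [apply: (XZ') | apply: (XD'); apply: (XZ')].
Qed.

End NoTransvection.

(** * The symmetric square and reflections *)

Section Sym2.
Local Open Scope ring_scope.
Variable F : fieldType.
Hypothesis F2 : 2%:R != 0 :> F.

(** The exponential of the lower triangular nilpotent matrix with subdiagonal [a], [b]. *)
Definition low3 (a b : F) := mx3 1 0 0 a 1 0 (a * b / 2%:R) b 1.

Lemma low3D a b s t : low3 (s * a) (s * b) *m low3 (t * a) (t * b) = low3 ((s + t) * a) ((s + t) * b).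
Proof. by rewrite mx3M; congr mx3; field. Qed.

Lemma low3_0 : low3 0 0 = 1%:M.
Proof. by rewrite mx3_1; congr mx3; field. Qed.

Definition reflx := mx3 1 0 0 0 (-1) 0 0 0 1 : 'M[F]_3.

(** Shears commute with [unip3] and [reflx]: up to scalars they are the freedom left in the basis
    once both have their normal form. *)
Definition shear (k : F) := mx3 1 0 k 0 1 0 0 0 1.

Lemma shearM k l : shear k *m shear l = shear (k + l).
Proof. by rewrite mx3M; congr mx3; ring. Qed.

Lemma shear0 : shear 0 = 1%:M. Proof. by rewrite mx3_1. Qed.

Lemma shear_unit k : shear k \in unitmx.
Proof. by have /mulmx1_unit[] : shear k *m shear (- k) = 1%:M by rewrite shearM subrr shear0. Qed.

Lemma invmx_shear k : invmx (shear k) = shear (- k).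
Proof.
apply: (can_inj (mulKmx (shear_unit k))); rewrite mulmxV ?shear_unit //.
by rewrite shearM subrr shear0.
Qed.

Lemma shear_unip3 k s : shear k *m unip3 s = unip3 s *m shear k.
Proof. by rewrite !mx3M; congr mx3; ring. Qed.

Lemma shear_reflx k : shear k *m reflx = reflx *m shear k.
Proof. by rewrite !mx3M; congr mx3; ring. Qed.

Lemma reflx_sqr : reflx *m reflx = 1%:M.
Proof. by rewrite mx3M mx3_1; congr mx3; ring. Qed.

(** At r = 1 this is the symmetric square of [elem12 (-2)] times [elem21 1], a matrix of trace 0
    whose square is -1. The constants thus make the square trivial at r = 1, and only there by
    [bad_unip_eq1]. *)
Definition bad_unip (r : F) := unip3 (-2%:R) *m low3 2%:R (2%:R * r).

(* The product of two reflections in which exactly one of the two pairings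
   between centers and axes vanishes; its square is a transvection. *)
Lemma bad_unip_transv r : let g := bad_unip r *m bad_unip r in (g - 1) *m (g - 1) = 0.
Proof.
rewrite /= /bad_unip !mx3M mx3_oner mx3N mx3D mx3M mx3_0.
by congr mx3; field.
Qed.

Lemma bad_unip_eq1 r : bad_unip r *m bad_unip r = 1%:M -> r = 1.
Proof.
rewrite /bad_unip !mx3M mx3_1 => /mx3_inj[[[[[[[[e1 _] _] _] _] _] _] _] _].
have r0 : 4%:R * (1 - r) = 0 by apply: (eq_subr_eq e1); field.
move/eqP: r0; rewrite mulf_eq0 subr_eq0 => /orP[|/eqP->//].
by rewrite (natrM _ 2 2) mulf_eq0 (negPf F2).
Qed.

(** The scales are chosen so that, for nonzero [q], the product has trace -1 and eigenvalues 1, -1,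
    -1, hence a unipotent square. [q^-1] will be the difference of two shears. *)
Definition bad_low (q : F) := low3 (-2%:R) (-2%:R) *m
  (shear (- q^-1) *m low3 (2%:R * q) (2%:R * q) *m shear (q^-1)).

Lemma bad_lowE q : q != 0 -> bad_low q =
  mx3 (1 - 2%:R * q) (-2%:R) (-2%:R) (6%:R * q - 2%:R) 5%:R 6%:R
      (2%:R * q ^+ 2 - 8%:R * q + 2%:R) (2%:R * q - 6%:R) (2%:R * q - 7%:R).
Proof. by move=> q0; rewrite /bad_low !mx3M; congr mx3; field; rewrite ?q0 ?F2. Qed.

Lemma bad_low_transv q : q != 0 -> let g := bad_low q *m bad_low q in (g - 1) *m (g - 1) = 0.
Proof.
move=> q0; rewrite /= bad_lowE // !mx3M mx3_oner mx3N mx3D mx3M mx3_0.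
by congr mx3; ring.
Qed.

Lemma bad_low_neq1 q : q != 0 -> bad_low q *m bad_low q != 1%:M.
Proof.
move=> q0; apply/eqP; rewrite bad_lowE // !mx3M mx3_1 => /mx3_inj[[[[[[[[_ _] _] _] e5] _] _] _] _].
have : 8%:R = 0 :> F by apply: (eq_subr_eq (esym e5)); ring.
move/eqP; rewrite (natrM _ 2 4) (natrM _ 2 2) !mulf_eq0 (negPf F2) //.
Qed.

(** The symmetric square in the basis x^2, 2xy, 2y^2, a scaling that turns [elem12 s] into
    [unip3 s]. *)
Definition sym2 (A : 'M[F]_2) : 'M[F]_3 :=
  let a := A ord0 ord0 in let b := A ord0 ord_max in
  let c := A ord_max ord0 in let d := A ord_max ord_max in
  mx3 (a ^+ 2) (a * b) (b ^+ 2 / 2%:R) (2%:R * a * c) (a * d + b * c) (b * d)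
      (2%:R * c ^+ 2) (2%:R * c * d) (d ^+ 2).

Lemma sym2_mx2 a b c d : sym2 (mx2 a b c d) =
  mx3 (a ^+ 2) (a * b) (b ^+ 2 / 2%:R) (2%:R * a * c) (a * d + b * c) (b * d)
      (2%:R * c ^+ 2) (2%:R * c * d) (d ^+ 2).
Proof. by rewrite /sym2 !mxE. Qed.

Lemma sym2M A B : sym2 (A *m B) = sym2 A *m sym2 B.
Proof.
have [a [b [c [d ->]]]] := mx2P A; have [a' [b' [c' [d' ->]]]] := mx2P B.
by rewrite mx2M !sym2_mx2 mx3M; congr mx3; field.
Qed.

Lemma sym2_1 : sym2 1%:M = 1%:M.
Proof. by rewrite mx2_1 mx3_1 sym2_mx2; congr mx3; field. Qed.

Lemma sym2_elem12 s : sym2 (elem12 s) = unip3 s.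
Proof. by rewrite sym2_mx2; congr mx3; field. Qed.

Lemma sym2_elem21 s : sym2 (elem21 s) = low3 (2%:R * s) (2%:R * s).
Proof. by rewrite sym2_mx2; congr mx3; field. Qed.

End Sym2.

Section RegularReflection.
Variables (p : nat) (F : fieldType).
Hypotheses (p_pr : prime p) (charF : p \in [pchar F]%R).
Hypothesis natF : forall a : F, exists k : nat, a = (k%:R)%R.
Local Open Scope ring_scope.
Hypothesis F2 : 2%:R != 0 :> F.
Variables (rT : finGroupType) (G : {group rT}).

Section PElt.
Variable rho : rT -> 'M[F]_3.
Hypotheses (frho : faithful_rep G rho) (ntv : no_transvection G rho).

Lemma p_elt_trace x : x \in G -> p.-elt x -> x != 1%g -> \tr (rho x) = 3%:R.
Proof.
move=> Gx px ntx; have [B uB EB] := p_elt_normal_form charF frho ntv Gx px ntx.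
have -> : rho x = invmx B *m unip3 1 *m B by rewrite -EB !mulmxA mulVmx // mul1mx mulmxKV.
by rewrite mxtrace_mulC mulmxA mulmxV // mul1mx mxtrace_mx3; ring.
Qed.

Lemma p_elt_expp x : x \in G -> p.-elt x -> (x ^+ p = 1)%g.
Proof.
move=> Gx px; have [->|ntx] := eqVneq x 1%g; first by rewrite expg1n.
have [B uB EB] := p_elt_normal_form charF frho ntv Gx px ntx.
have frho' := faithful_rep_basis uB frho.
apply: (rep_inj frho'); rewrite ?groupX ?group1 //.
by rewrite (rho_exp F2 frho' Gx EB) (pcharf0 charF) unip3_0 // (rep1 frho').
Qed.

Lemma p_elt_fixed x : x \in G -> p.-elt x -> exists2 v : 'rV_3, v != 0 & v *m rho x = v.
Proof.
move=> Gx px; have [->|ntx] := eqVneq x 1%g.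
  exists (rv3 1 0 0); last by rewrite (rep1 frho) mulmx1.
  by apply/eqP; rewrite rv3_0 => /rv3_inj[[/eqP]]; rewrite oner_eq0.
have [N3 [e nz]] := p_elt_regular charF frho ntv Gx px ntx.
exists (e *m ((rho x - 1) *m (rho x - 1))) => //.
have : e *m ((rho x - 1) *m (rho x - 1)) *m (rho x - 1) = 0.
  by rewrite -mulmxA -[X in e *m X]/((rho x - 1) * (rho x - 1) * (rho x - 1)) -mulrA -expr2 -exprS N3 mulmx0.
by rewrite mulmxBr mulmx1 => /eqP; rewrite subr_eq0 => /eqP.
Qed.

(* Both x and its reflection generate the stabiliser of the line of v, and the
   reflection acts on this group of order p by an involution. *)
Lemma reflx_line x (v : 'rV_3) eps : x \in G -> p.-elt x -> x != 1%g ->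
  (forall g, g \in G -> mxG rho G (@reflx F *m rho g *m @reflx F)) ->
  v != 0 -> v *m rho x = v -> v *m @reflx F = eps *: v ->
  @reflx F *m rho x *m @reflx F = rho x \/ @reflx F *m rho x *m @reflx F *m rho x = 1%:M.
Proof.
set Z := @reflx F => Gx px ntx nZ nzv vx vZ.
have ZZ : Z *m Z = 1%:M by apply: reflx_sqr.
have [t Gt Et] := nZ x Gx.
have tX m : rho (t ^+ m)%g = Z *m rho (x ^+ m)%g *m Z.
  elim: m => [|m IH]; first by rewrite (rep1 frho) mulmx1 ZZ.
  by rewrite !expgSr !(repM frho) ?groupX // IH Et !mulmxA -(mulmxA _ Z Z) ZZ mulmx1.
have pt : p.-elt t.
  apply: (@pnat_dvd _ p); last by rewrite pnat_id.
  rewrite order_dvdn; apply/eqP/(rep_inj frho); rewrite ?groupX ?group1 //.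
  by rewrite tX p_elt_expp // (rep1 frho) mulmx1 ZZ.
have vt : v *m rho t = v.
  have ee : eps *: (eps *: v) = v.
    by rewrite -vZ scalemxAl -vZ -mulmxA ZZ mulmx1.
  by rewrite Et !mulmxA vZ -!scalemxAl vx vZ ee.
have /cycleP[k Ek] : t \in <[x]>%g.
  exact: (fixed_line_cycle charF natF F2 frho ntv Gx px ntx Gt pt nzv vx vt).
have xkk : (x ^+ (k * k) = x ^+ 1)%g.
  apply: (rep_inj frho); rewrite ?groupX //.
  rewrite expgM -Ek tX -Ek Et expg1.
  by rewrite !mulmxA ZZ mul1mx -mulmxA ZZ mulmx1.
have ox : #[x]%g = p.
  apply/eqP; rewrite eqn_dvd; apply/andP; split; last exact: p_elt_dvd_order.
  by rewrite order_dvdn p_elt_expp.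
move/eqP: xkk; rewrite eq_expg_mod_order ox => kk1.
have k_gt0 : (0 < k)%N.
  by case: k kk1 {Ek} => //; rewrite mod0n modn_small ?prime_gt1.
have /orP[dk|dk] : ((p %| k.-1) || (p %| k.+1))%N.
- rewrite -Euclid_dvdM //; move: kk1; rewrite eqn_mod_dvd ?muln_gt0 ?k_gt0 //.
  by congr (p %| _)%N; case: k k_gt0 {Ek} => // k _ /=; lia.
- left; rewrite -Et Ek; congr rho; rewrite -(prednK k_gt0) expgS.
  by have/eqP -> : (x ^+ k.-1 == 1)%g; rewrite ?mulg1 // -order_dvdn ox.
right; rewrite -Et Ek -(repM frho) ?groupX // -expgSr.
by have/eqP -> : (x ^+ k.+1 == 1)%g; rewrite ?(rep1 frho) // -order_dvdn ox.
Qed.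

End PElt.

Section NormalizedReflection.
Variable rho : rT -> 'M[F]_3.
Hypotheses (frho : faithful_rep G rho) (ntv : no_transvection G rho).
Hypothesis nZ : forall g, g \in G -> mxG rho G (@reflx F *m rho g *m @reflx F).
Variable u : rT.
Hypotheses (Gu : u \in G) (Eu : rho u = unip3 1).

Lemma rv3_neq0 (a b c : F) : (a != 0) || (b != 0) || (c != 0) -> rv3 a b c != 0.
Proof.
move=> nz; apply/eqP; rewrite rv3_0 => /rv3_inj E; move: nz.
by rewrite !E eqxx.
Qed.

Lemma low3_exp x a b k : x \in G -> rho x = low3 a b -> rho (x ^+ k)%g = low3 (k%:R * a) (k%:R * b).
Proof.
move=> Gx Ex; have := @one_param_exp _ _ _ _ _ frho (fun s => low3 (s * a) (s * b)) _ _ x 1 k Gx.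
rewrite !mul1r mulr1; apply=> //; first by rewrite !mul0r low3_0.
by move=> s t; apply: low3D.
Qed.

(** Suitable powers of [u] and [x] multiply to [bad_unip (h / d)]; its square g satisfies (g - 1)^2
    = 0, so it is trivial and h / d = 1. *)
Lemma not_bad x d h : x \in G -> d != 0 -> rho x = low3 d h -> d = h.
Proof.
move=> Gx nzd Ex; have [k Ek] := natF (2%:R / d); have [l El] := natF (-2%:R).
pose g := (u ^+ l * x ^+ k)%g; have Gg : g \in G by rewrite groupM ?groupX.
have Eg : rho g = bad_unip (h / d).
  rewrite /g (repM frho) ?groupX // (rho_exp F2 frho Gu Eu) (low3_exp k Gx Ex) -Ek -El.
  by congr (_ *m low3 _ _); field.
have g2 : (g * g = 1)%g.
  by apply: ntv; [exact: groupM | rewrite (repM frho) // Eg; apply: bad_unip_transv].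
have := congr1 rho g2; rewrite (repM frho) // Eg (rep1 frho) => /(bad_unip_eq1 F2) hd.
by rewrite -[LHS]mul1r -hd mulfVK.
Qed.

(** [reflx] fixes the vector fixed by [x], so it centralises or inverts [x]. Centralising gives (rho
    x - 1)^2 = 0; inverting leaves [low3 d h] as the only other shape, and [not_bad] equates [d] and
    [h]. *)
Lemma opposite_form x : x \in G -> p.-elt x -> x != 1%g ->
  rv3 1 0 0 *m rho x = rv3 1 0 0 -> exists2 d, d != 0 & rho x = low3 d d.
Proof.
move=> Gx px ntx vx; have tr3 := p_elt_trace frho ntv Gx px ntx.
have nz1 : rv3 1 0 0 != 0 :> 'rV[F]_3 by rewrite rv3_neq0 ?oner_neq0.
have vZ : rv3 1 0 0 *m @reflx F = 1 *: rv3 1 0 0.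
  by rewrite rv3M rv3Z; congr rv3; ring.
have ZxZ := reflx_line frho ntv Gx px ntx nZ nz1 vx vZ.
have nN2 : (rho x - 1) *m (rho x - 1) <> 0 by move/(ntv Gx)/eqP; rewrite (negPf ntx).
have [a [b [c [d [e [f [g [h [i Ex]]]]]]]]] := mx3P (rho x).
rewrite Ex rv3M !(mul1r, mul0r, addr0) in vx.
have [[a1 b0] c0] := rv3_inj vx.
rewrite a1 b0 c0 in Ex; rewrite Ex mxtrace_mx3 in tr3.
rewrite Ex /reflx !mx3M mx3_1 in ZxZ.
have F2c (y : F) : y *+ 2 = 0 -> y = 0.
  by move/eqP; rewrite -mulr_natr mulf_eq0 (negPf F2) orbF => /eqP.
have noN : (mx3 0 0 0 d (e - 1) f g h (i - 1)) *m (mx3 0 0 0 d (e - 1) f g h (i - 1)) <> 0.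
  move=> E; apply: nN2; rewrite -[RHS]E Ex mx3_oner mx3N mx3D.
  by congr (_ *m _); congr mx3; ring.
case: ZxZ => /mx3_inj[[[[[[[[_ _] _] e4] e5] e6] e7] e8] e9]; last first.
  (* Otherwise f = h = 0 decouples the last two coordinates, and unipotency makes both diagonal
     entries 1. *)
  have ei : e = i.
    apply/eqP; rewrite -subr_eq0; apply: contraT => nz.
    have f0 : f = 0.
      by apply: (mulIf nz); rewrite mul0r; apply: (eq_subr_eq e6); ring.
    have h0 : h = 0.
      by apply: (mulIf nz); rewrite mul0r; apply: (eq_subr_eq (esym e8)); ring.
    have e1 : e = 1.
      apply: (p_elt_coeigen charF natF frho (f := (rv3 0 1 0)^T) Gx px).
        by rewrite -trmx0 (inj_eq trmx_inj) rv3_neq0 // oner_neq0 orbT.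
      by rewrite Ex h0 mx3_cV rv3_tr_scale; congr (_^T); congr rv3; ring.
    have i1 : i = 1.
      apply: (p_elt_coeigen charF natF frho (f := (rv3 0 0 1)^T) Gx px).
        by rewrite -trmx0 (inj_eq trmx_inj) rv3_neq0 // oner_neq0 orbT.
      by rewrite Ex f0 mx3_cV rv3_tr_scale; congr (_^T); congr rv3; ring.
    by rewrite e1 i1 subrr eqxx in nz.
  have e1 : e = 1.
    apply/eqP; rewrite -subr_eq0; apply/eqP/F2c; rewrite -ei in tr3.
    by apply: (eq_subr_eq tr3); ring.
  rewrite -ei e1 in Ex noN e4 e5 e7; have fh : f * h = 0 by apply: (eq_subr_eq (esym e5)); ring.
  have [f0 | nzf] := eqVneq f 0.
    have g2 : g *+ 2 = h * d by apply/eqP; rewrite -subr_eq0; apply/eqP/(eq_subr_eq e7); ring.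
    have Eg : g = d * h / 2%:R by rewrite [d * h]mulrC -g2 -[g *+ 2]mulr_natr mulfK.
    have nzd : d != 0.
      by apply/eqP=> d0; apply: noN; rewrite Eg d0 f0 mx3M mx3_0; congr mx3; ring.
    have Elow : rho x = low3 d h by rewrite Ex f0 Eg.
    by exists d => //; rewrite Elow -(not_bad Gx nzd Elow).
  have h0 : h = 0 by move/eqP: fh; rewrite mulf_eq0 (negPf nzf) => /eqP.
  have g0 : g = 0.
    by apply: (mulfI nzf); rewrite mulr0; apply: (eq_subr_eq (esym e4)); ring.
  by case: noN; rewrite h0 g0 mx3M mx3_0; congr mx3; ring.
have d0 : d = 0 by apply: F2c; apply: (eq_subr_eq (esym e4)); ring.
have f0 : f = 0 by apply: F2c; apply: (eq_subr_eq (esym e6)); ring.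
have h0 : h = 0 by apply: F2c; apply: (eq_subr_eq (esym e8)); ring.
have e1 : e = 1.
  apply: (p_elt_eigen charF natF frho (v := rv3 0 1 0) Gx px).
    by rewrite rv3_neq0 // oner_neq0 orbT.
  by rewrite Ex d0 f0 rv3M rv3Z; congr rv3; ring.
have i1 : i = 1.
  by apply/eqP; rewrite -subr_eq0; apply/eqP; rewrite e1 in tr3; apply: (eq_subr_eq tr3); ring.
by case: noN; rewrite d0 f0 h0 e1 i1 mx3M mx3_0; congr mx3; ring.
Qed.

(** The middle vector is an eigenvector of [reflx], so [x] is centralised or inverted; with trace 3
    and determinant 1 both cases give (rho x - 1)^2 = 0. *)
Lemma middle_not_fixed x : x \in G -> p.-elt x -> x != 1%g ->
  rv3 0 1 0 *m rho x <> rv3 0 1 0.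
Proof.
move=> Gx px ntx vx; have tr3 := p_elt_trace frho ntv Gx px ntx.
have nz1 : rv3 0 1 0 != 0 :> 'rV[F]_3 by rewrite rv3_neq0 // oner_neq0 orbT.
have vZ : rv3 0 1 0 *m @reflx F = (-1) *: rv3 0 1 0.
  by rewrite rv3M rv3Z; congr rv3; ring.
have ZxZ := reflx_line frho ntv Gx px ntx nZ nz1 vx vZ.
have nN2 : (rho x - 1) *m (rho x - 1) <> 0 by move/(ntv Gx)/eqP; rewrite (negPf ntx).
have [a [b [c [d [e [f [g [h [i Ex]]]]]]]]] := mx3P (rho x).
rewrite Ex rv3M !(mul1r, mul0r, addr0, add0r) in vx.
have [[d0 e1] f0] := rv3_inj vx.
rewrite d0 e1 f0 in Ex; rewrite Ex mxtrace_mx3 in tr3.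
have F2c (y : F) : y *+ 2 = 0 -> y = 0.
  by move/eqP; rewrite -mulr_natr mulf_eq0 (negPf F2) orbF => /eqP.
have dt : a * i - c * g = 1.
  have <- : \det (rho x) = 1 := p_elt_det charF natF frho Gx px.
  by rewrite Ex det_mx3; ring.
have ai2 : a + i = 2%:R by apply/eqP; rewrite -subr_eq0; apply/eqP/(eq_subr_eq tr3); ring.
have noN : (mx3 (a - 1) b c 0 0 0 g h (i - 1)) *m (mx3 (a - 1) b c 0 0 0 g h (i - 1)) <> 0.
  move=> E; apply: nN2; rewrite -[RHS]E Ex mx3_oner mx3N mx3D.
  by congr (_ *m _); congr mx3; ring.
rewrite Ex /reflx !mx3M mx3_1 in ZxZ.
have Ei : i = 2%:R - a by rewrite -ai2; ring.
case: ZxZ => /mx3_inj[[[[[[[[e1' e2] e3] _] _] _] e7] e8] e9].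
  have b0 : b = 0 by apply: F2c; apply: (eq_subr_eq (esym e2)); ring.
  have h0 : h = 0 by apply: F2c; apply: (eq_subr_eq (esym e8)); ring.
  have cg : c * g = a * i - 1 by rewrite -dt; ring.
  apply: noN; rewrite b0 h0 mx3M mx3_0 Ei; congr mx3; try ring.
    transitivity ((a - 1) ^+ 2 + c * g); first by ring.
    by rewrite cg Ei; ring.
  transitivity ((1 - a) ^+ 2 + c * g); first by ring.
  by rewrite cg Ei; ring.
have c0 : c = 0 by apply: F2c; apply: (eq_subr_eq e3); rewrite Ei; ring.
have g0 : g = 0 by apply: F2c; apply: (eq_subr_eq e7); rewrite Ei; ring.
have a1 : a = 1.
  have : (a - 1) ^+ 2 = 0 by rewrite c0 Ei in dt; apply: (eq_subr_eq (esym dt)); ring.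
  by move/eqP; rewrite expf_eq0 subr_eq0 => /eqP.
apply: noN; rewrite c0 g0 Ei a1 mx3M mx3_0; congr mx3; ring.
Qed.

End NormalizedReflection.

Section NormalizedReflection2.
Variable rho : rT -> 'M[F]_3.
Hypotheses (frho : faithful_rep G rho) (ntv : no_transvection G rho).
Hypothesis nZ : forall g, g \in G -> mxG rho G (@reflx F *m rho g *m @reflx F).
Variable u : rT.
Hypotheses (Gu : u \in G) (Eu : rho u = unip3 1).

Let sheared k x := shear k *m rho x *m invmx (shear k).

Lemma shearedP k : [/\ faithful_rep G (sheared k), no_transvection G (sheared k),
  forall g, g \in G -> mxG (sheared k) G (@reflx F *m sheared k g *m @reflx F)
  & sheared k u = unip3 1].
Proof.
have us := shear_unit k; split.
- exact: faithful_rep_basis.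
- exact: no_transvection_basis.
- move=> g /nZ[t Gt Et]; exists t => //.
  rewrite /sheared Et !mulmxA shear_reflx -!mulmxA; congr (_ *m (_ *m (_ *m _))).
  by rewrite invmx_shear shear_reflx.
by rewrite /sheared Eu shear_unip3 mulmxK.
Qed.

(** A power of [u] clears the second coordinate of the vector fixed by [x], and a shear then makes
    it (1, 0, 0). If the first coordinate is 0, the vector moves to (0, 1, 0), excluded by
    [middle_not_fixed], or spans the line fixed by [u], which puts [x] in the cyclic group of
    [u]. *)
Lemma opposite_exists x : x \in G -> p.-elt x -> x \notin <[u]>%g ->
  exists k kap d, d != 0 /\ sheared kap (x ^ (u ^+ k))%g = low3 d d.
Proof.
move=> Gx px nux; have ntx : x != 1%g by apply: contraNneq nux => ->; apply: group1.
have pu : p.-elt u.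
  by apply: (@one_param_p_elt _ _ p_pr charF _ _ _ _ frho (@unip3 F) (unip3_0 F2) (unip3D F2) u 1).
have [v nzv vx] := p_elt_fixed frho ntv Gx px.
have Eui j : rho (u ^+ j)%g = unip3 j%:R by apply: (rho_exp F2 frho).
have conjv j : v *m unip3 j%:R *m rho (x ^ (u ^+ j))%g = v *m unip3 j%:R.
  by rewrite -Eui -mulmxA (repJ frho) ?groupX // mulmxA vx.
have Gxj j : (x ^ (u ^+ j))%g \in G by rewrite groupJ ?groupX.
have pxj j : p.-elt (x ^ (u ^+ j))%g by rewrite p_eltJ.
have ntxj j : (x ^ (u ^+ j) != 1)%g by rewrite conjg_eq1.
have [a [b [c Ev]]] := rv3P v.
have [a0 | nza] := eqVneq a 0; last first.
  have [j Ej] := natF (- (b / a)).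
  pose kap := (a * (j%:R ^+ 2 / 2%:R) + b * j%:R + c) / a.
  exists j, kap; have [frho' ntv' nZ' Eu'] := shearedP kap.
  have Ev' : v *m unip3 j%:R = a *: (rv3 1 0 0 *m shear kap).
    by rewrite -Ej Ev !rv3M rv3Z /kap -Ej; congr rv3; field; rewrite ?F2 ?nza.
  have [|d nzd Ed] := opposite_form frho' ntv' nZ' Gu Eu' (Gxj j) (pxj j) (ntxj j); last by exists d.
  have := conjv j; rewrite Ev' -scalemxAl => /(scalerI nza) E.
  by rewrite /sheared !mulmxA E mulmxK ?shear_unit.
have [b0 | nzb] := eqVneq b 0; last first.
  have [j Ej] := natF (- (c / b)).
  have Ev' : v *m unip3 j%:R = b *: rv3 0 1 0.
    by rewrite -Ej Ev a0 !rv3M rv3Z; congr rv3; field; rewrite ?F2 ?nzb.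
  have := conjv j; rewrite Ev' -scalemxAl => /(scalerI nzb) E.
  by case: (middle_not_fixed frho ntv nZ (Gxj j) (pxj j) (ntxj j) E).
case/negP: nux; have ntu : u != 1%g.
  apply/eqP=> u1; move: Eu; rewrite u1 (rep1 frho) mx3_1 => /mx3_inj[[[[[[[[_ /eqP]]]]]]]].
  by rewrite eq_sym oner_eq0.
apply: (fixed_line_cycle charF natF F2 frho ntv Gu pu ntu Gx px nzv) => //.
by rewrite Eu Ev a0 b0 rv3M; congr rv3; ring.
Qed.

(** With different shears, powers of [x] and [y] multiply to [bad_low] at the inverse of the
    difference, whose square g is nontrivial with (g - 1)^2 = 0. *)
Lemma opposite_unique x y k l d e : x \in G -> y \in G -> d != 0 -> e != 0 ->
  sheared k x = low3 d d -> sheared l y = low3 e e -> k = l.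
Proof.
move=> Gx Gy nzd nze Ex Ey; apply/eqP; rewrite eq_sym -subr_eq0; apply: contraT => nz.
have [frho' ntv' _ _] := shearedP k.
have shd z : rho z = shear (- l) *m sheared l z *m shear l.
  by rewrite -invmx_shear /sheared !mulmxA mulVmx ?shear_unit // mul1mx mulmxKV ?shear_unit.
pose q := (l - k)^-1; have nzq : q != 0 by rewrite invr_eq0.
have [m Em] := natF (- 2%:R / d); have [n En] := natF (2%:R * q / e).
have [frhol _ _ _] := shearedP l.
pose g := (x ^+ m * y ^+ n)%g; have Gg : g \in G by rewrite groupM ?groupX.
have Eg : sheared k g = bad_low q.
  rewrite /g (repM frho') ?groupX // (low3_exp frho' m Gx Ex) -Em.
  have -> : sheared k (y ^+ n)%g = shear (k - l) *m low3 (2%:R * q) (2%:R * q) *m shear (l - k).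
    rewrite /sheared shd (low3_exp frhol n Gy Ey) -En invmx_shear !mulmxA shearM mulfVK //.
    by rewrite -!mulmxA shearM.
  by rewrite mulfVK // /bad_low invrK opprB.
have g2 : (g * g = 1)%g.
  by apply: ntv'; [exact: groupM | rewrite (repM frho') // Eg; apply: bad_low_transv].
have := congr1 (sheared k) g2; rewrite (repM frho') // Eg (rep1 frho') => /eqP.
by rewrite (negPf (bad_low_neq1 F2 nzq)).
Qed.

End NormalizedReflection2.

Theorem reflection_Opprime (rho : rT -> 'M[F]_3) u z :
  faithful_rep G rho -> no_transvection G rho -> has_strongly_p_embedded p G ->
  u \in G -> p.-elt u -> u != 1%g ->
  z *m z = 1%:M -> (forall g, g \in G -> mxG rho G (z *m rho g *m z)) ->
  rho u *m z *m rho u = z ->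
  exists rho' : rT -> 'M[F]_3, [/\ faithful_rep G rho',
    forall x, x \in Opprime p G -> exists2 A, \det A = 1 & rho' x = sym2 A
    & forall A, \det A = 1 -> mxG rho' (Opprime p G) (sym2 A)].
Proof.
move=> frho ntv spe Gu pu ntu zz nz uzu.
have [N3 [e0 nze0]] := p_elt_regular charF frho ntv Gu pu ntu.
have zn := log_antimorph F2 N3 uzu.
(* [e0 + e0 z] and [e0 - e0 z] are eigenvectors of [z] with sum twice [e0], so (rho u - 1)^2 does
   not kill both. *)
have [e [eps [nze ez eps2]]] : exists (e : 'rV[F]_3) (eps : F),
    [/\ e *m ((rho u - 1) *m (rho u - 1)) != 0, e *m z = eps *: e & eps * eps = 1].
  pose N2 := (rho u - 1) *m (rho u - 1); rewrite -/N2 in nze0 *.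
  have [n1 | n1] := eqVneq ((e0 + e0 *m z) *m N2) 0; last first.
    by exists (e0 + e0 *m z), 1; split; rewrite ?mulr1 // scale1r mulmxDl -mulmxA zz mulmx1 addrC.
  exists (e0 - e0 *m z), (-1); split; last by rewrite mulrNN mulr1.
    apply: contra nze0 => /eqP n2; have : 2%:R *: (e0 *m N2) = 0.
      have -> : 2%:R *: (e0 *m N2) = (e0 + e0 *m z) *m N2 + (e0 - e0 *m z) *m N2.
        by rewrite mulmxDl mulmxBl addrACA subrr addr0 scaler_nat mulr2n.
      by rewrite n1 n2 addr0.
    by move/eqP; rewrite scaler_eq0 (negPf F2).
  by rewrite mulmxBl -mulmxA zz mulmx1 scaleN1r opprB.
have [B [uB EuB EzB]] := regular_basis N3 nze.
have Bz : B *m z = eps *: @reflx F *m B := EzB z eps zn ez.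
pose rho1 x := B *m rho x *m invmx B.
have frho1 : faithful_rep G rho1 := faithful_rep_basis uB frho.
have ntv1 : no_transvection G rho1 := no_transvection_basis ntv uB.
have Eu1 : rho1 u = unip3 1 by rewrite /rho1 EuB mulmxK.
have Rz : @reflx F = eps *: (B *m z *m invmx B).
  by rewrite Bz mulmxK // scalerA eps2 scale1r.
have nZ1 g : g \in G -> mxG rho1 G (@reflx F *m rho1 g *m @reflx F).
  move=> /nz[t Gt Et]; exists t => //; rewrite Rz -!scalemxAl -!scalemxAr scalerA eps2 scale1r.
  by rewrite /rho1 Et !mulmxA mulmxKV // mulmxKV.
have [w [Gw pw nuw]] := spe_p_elt_outside p_pr spe Gu pu ntu.
(* One p-element [w] outside the cyclic group of [u] fixes the shear; [opposite_unique] imposes it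
   on all the others. *)
have [k0 [kap0 [d0 [nzd0 Ew]]]] := opposite_exists frho1 ntv1 nZ1 Gu Eu1 Gw pw nuw.
have [frho' ntv' _ Eu'] := shearedP frho1 ntv1 nZ1 Eu1 kap0.
set rho' := (fun x => _) in frho' ntv' Eu'.
have Gj x j : x \in G -> (x ^ (u ^+ j))%g \in G by move=> Gx; rewrite groupJ ?groupX.
have Euj j : rho' (u ^+ j)%g = unip3 j%:R by apply: (rho_exp F2 frho').
have sOG := Opprime_sub p G.
have pO x : x \in G -> p.-elt x -> x \in Opprime p G.
  by move=> Gx px; apply: mem_gen; rewrite inE Gx.
exists rho'; split=> //.
  apply: (Opprime_rep_ind frho' (P := fun M => exists2 A, \det A = 1 & M = sym2 A)).
  - by exists 1%:M; rewrite ?det1 ?sym2_1.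
  - move=> _ _ [A dA ->] [C dC ->]; exists (A *m C); last by rewrite sym2M.
    by rewrite det_mulmx dA dC mulr1.
  move=> x Gx px; have [/cycleP[j ->] | nux] := boolP (x \in <[u]>%g).
    by exists (elem12 j%:R); rewrite ?det_elem12 // sym2_elem12 // Euj.
  have [k [kap [d [nzd Ex]]]] := opposite_exists frho1 ntv1 nZ1 Gu Eu1 Gx px nux.
  have Ekap : kap = kap0.
    exact: (opposite_unique frho1 ntv1 nZ1 Eu1 (Gj _ _ Gx) (Gj _ _ Gw) nzd nzd0 Ex Ew).
  rewrite Ekap in Ex.
  exists (elem12 k%:R *m elem21 (d / 2%:R) *m elem12 (- k%:R)).
    by rewrite !det_mulmx !det_elem12 det_elem21_1 !mulr1.
  rewrite !sym2M // !sym2_elem12 // sym2_elem21 // mulrCA mulfV // mulr1.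
  rewrite -Ex -/(rho' _) -Euj (repJ frho') ?groupX // -mulmxA Euj unip3D // subrr unip3_0 //.
  by rewrite mulmx1.
apply: SL2_elementary_ind => [A C OA OC|s|s].
- by rewrite sym2M //; apply: (mxGM frho' (K := <<_>>%G)).
- rewrite sym2_elem12 //.
  apply: (@one_param _ natF _ _ _ _ frho' (@unip3 F) (unip3_0 F2) (unip3D F2) <<_>>%G 1) => //.
    exact: oner_neq0.
  by exists u => //; apply: pO.
rewrite sym2_elem21 //.
apply: (@one_param _ natF _ _ _ _ frho' (fun s => low3 (2%:R * s) (2%:R * s)) _ _ <<_>>%G (d0 / 2%:R)) => //.
- by rewrite mulr0 low3_0.
- by move=> a b; rewrite ![2%:R * _]mulrC low3D.
- by rewrite mulf_neq0 ?invr_eq0.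
exists (w ^ (u ^+ k0))%g; first by apply: pO; rewrite ?p_eltJ ?Gj.
by rewrite mulrCA mulfV // mulr1.
Qed.

End RegularReflection.

(** * Isomorphisms with SL2 and PSL2 *)

Section LiftMorphism.
Variables (F : fieldType) (aT rT : finGroupType) (m n : nat).
Variables (D : {group aT}) (G O : {group rT}).
Variables (val : aT -> 'M[F]_m.+1) (rho : rT -> 'M[F]_n.+1) (s : 'M[F]_m.+1 -> 'M[F]_n.+1).
Hypotheses (fval : faithful_rep D val) (frho : faithful_rep G rho) (sOG : O \subset G).
Hypothesis sM : forall A B, s (A *m B)%R = (s A *m s B)%R.
Hypothesis toO : forall x, x \in D -> mxG rho O (s (val x)).
Hypothesis ofO : forall y, y \in O -> exists2 x, x \in D & rho y = s (val x).

(** The pick is unique since [rho] is injective on [O], and [toO] keeps the default 1 from being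
    used on [D]. *)
Definition lift_rep x := if [pick y in O | rho y == s (val x)] is Some y then y else 1.

Lemma lift_repP x : x \in D -> lift_rep x \in O /\ rho (lift_rep x) = s (val x).
Proof.
move=> /toO[y Oy Ey]; rewrite /lift_rep; case: pickP => [z /andP[Oz /eqP]|/(_ y)] //.
by rewrite Oy Ey eqxx.
Qed.

Lemma lift_rep_morph : {in D &, {morph lift_rep : x y / x * y}}.
Proof.
move=> x y Dx Dy; have [Ox Ex] := lift_repP Dx; have [Oy Ey] := lift_repP Dy.
have [Oxy Exy] := lift_repP (groupM Dx Dy).
apply: (rep_inj frho); rewrite ?(subsetP sOG) ?groupM //.
by rewrite Exy (repM frho) ?(subsetP sOG) // Ex Ey (repM fval).
Qed.
Canonical lift_rep_morphism := Morphism lift_rep_morph.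

Lemma lift_rep_im : lift_rep @* D = O.
Proof.
apply/setP=> y; apply/morphimP/idP=> [[x Dx _ ->] | Oy]; first by case: (lift_repP Dx).
have [x Dx Ey] := ofO Oy; exists x => //; have [Ox Ex] := lift_repP Dx.
by apply: (rep_inj frho); rewrite ?(subsetP sOG) // Ey Ex.
Qed.

Lemma lift_rep_ker x : x \in D -> (x \in 'ker lift_rep) = (s (val x) == 1%:M)%R.
Proof.
move=> Dx; have [Ox Ex] := lift_repP Dx; rewrite -Ex.
apply/kerP/eqP=> // [-> | E1]; first exact: rep1 frho.
by apply: (rep_inj frho); rewrite ?(subsetP sOG) ?group1 // E1 (rep1 frho).
Qed.

Lemma lift_rep_isog (K : {group aT}) :
  (forall x, x \in D -> (x \in K) = (s (val x) == 1%:M)%R) -> K \subset D -> D / K \isog O.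
Proof.
move=> KE sKD; have -> : K :=: 'ker lift_rep.
  apply/setP=> x; have [Dx|nDx] := boolP (x \in D); first by rewrite KE // lift_rep_ker.
  by rewrite (contraNF (subsetP sKD x) nDx) (contraNF (subsetP (subsetIl _ _) x) nDx).
by rewrite -[X in _ \isog X]lift_rep_im; apply: first_isog.
Qed.

End LiftMorphism.

Section SL2Isomorphisms.
Variables (F : fieldType) (aT rT : finGroupType) (D : {group aT}) (G O : {group rT}).
Variables (val : aT -> 'M[F]_2) (rho : rT -> 'M[F]_3).
Hypotheses (fval : faithful_rep D val) (frho : faithful_rep G rho) (sOG : O \subset G).
Local Open Scope ring_scope.
Hypothesis detD : forall x, x \in D -> \det (val x) = 1.
Hypothesis onD : forall A, \det A = 1 -> mxG val D A.

Lemma pad_isog : (forall x, x \in O -> exists2 A, \det A = 1 & rho x = pad A) ->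
  (forall A, \det A = 1 -> mxG rho O (pad A)) -> O \isog D.
Proof.
move=> toA ofA; rewrite isog_sym.
have ofO y : y \in O -> exists2 x, x \in D & rho y = pad (val x).
  by move=> /toA[A /onD[x Dx Ex] ->]; exists x; rewrite ?Ex.
have := lift_rep_isog (K := 1%G) fval frho sOG (fun A B => esym (padM A B))
  (fun x Dx => ofA _ (detD Dx)) ofO _ (sub1G _).
move=> iso; apply: (isog_trans (quotient1_isog D)); apply: iso => x Dx.
rewrite -(pad1 F) (inj_eq (@pad_inj F)) -(rep1 fval) inE.
apply/eqP/eqP=> [->//|]; exact: (rep_inj fval).
Qed.

Hypothesis F2 : 2%:R != 0 :> F.

(** Both sides mean that [val x] is 1 or -1: commuting with elementary matrices makes it scalar, and
    the symmetric square kills only scalars of square 1. *)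
Lemma center_SL2 x : x \in D -> (x \in 'Z(D)%g) = (sym2 (val x) == 1%:M).
Proof.
move=> Dx; have dx := detD Dx; have [a [b [c [d Ex]]]] := mx2P (val x).
rewrite Ex det_mx2 in dx; apply/centerP/eqP=> [[_ cx] | E].
  have com s : (val x *m elem12 s = elem12 s *m val x) /\ (val x *m elem21 s = elem21 s *m val x).
    have [y Dy <-] := onD (det_elem12 s); have [z Dz <-] := onD (det_elem21_1 s).
    by rewrite -!(repM fval) // (cx y) // (cx z).
  have [] := com 1; rewrite Ex !mx2M => /mx2_inj[[[e1 e2] e3] e4] /mx2_inj[[[e5 e6] e7] e8].
  have c0 : c = 0 by apply: (eq_subr_eq (esym e1)); ring.
  have b0 : b = 0 by apply: (eq_subr_eq e5); ring.
  have ad : a = d by apply/eqP; rewrite -subr_eq0; apply/eqP/(eq_subr_eq e2); ring.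
  have d2 : d ^+ 2 = 1 by rewrite -dx ad c0 b0; ring.
  by rewrite b0 c0 ad sym2_mx2 mx3_1 -expr2 d2; congr mx3; ring.
split=> // y Dy; rewrite /commute; apply: (rep_inj fval); try exact: groupM.
rewrite !(repM fval) //.
move: E; rewrite Ex sym2_mx2 mx3_1 => /mx3_inj[[[[[[[[e1 e2] _] e4] _] _] _] _] _].
have nza : a != 0 by apply/eqP=> a0; move/eqP: e1; rewrite a0 expr0n /= eq_sym oner_eq0.
have b0 : b = 0 by apply: (mulfI nza); rewrite mulr0.
have c0 : c = 0.
  by move/eqP: e4; rewrite !mulf_eq0 (negPf F2) (negPf nza) => /eqP.
have da : d = a.
  by apply: (mulfI nza); rewrite -expr2 e1 -dx b0; ring.
have [a' [b' [c' [d' ->]]]] := mx2P (val y).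
by rewrite b0 c0 da !mx2M; congr mx2; ring.
Qed.

Lemma sym2_isog : (forall x, x \in O -> exists2 A, \det A = 1 & rho x = sym2 A) ->
  (forall A, \det A = 1 -> mxG rho O (sym2 A)) -> O \isog D / 'Z(D)%g.
Proof.
move=> toA ofA; rewrite isog_sym.
have ofO y : y \in O -> exists2 x, x \in D & rho y = sym2 (val x).
  by move=> /toA[A /onD[x Dx Ex] ->]; exists x; rewrite ?Ex.
apply: (lift_rep_isog (K := 'Z(D)%G) fval frho sOG (sym2M F2)
  (fun x Dx => ofA _ (detD Dx)) ofO center_SL2); exact: center_sub.
Qed.

(* The element of D with matrix -1. *)
Lemma central_involution_SL2 :
  exists t, [/\ t \in 'Z(D)%g, t != 1%g & (t * t = 1)%g].
Proof.
have dN : \det (mx2 (-1) 0 0 (-1) : 'M[F]_2) = 1 by rewrite det_mx2; ring.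
have [t Dt Et] := onD dN; exists t; split.
- by rewrite center_SL2 // Et sym2_mx2 mx3_1; apply/eqP; congr mx3; ring.
- apply/eqP=> t1; move: Et; rewrite t1 (rep1 fval) mx2_1 => /mx2_inj[[[e _] _] _].
  have : 2%:R = 0 :> F by apply: (eq_subr_eq e); ring.
  by apply/eqP.
apply: (rep_inj fval); rewrite ?groupM ?group1 // (repM fval) // Et (rep1 fval) mx2M mx2_1.
by congr mx2; ring.
Qed.

End SL2Isomorphisms.

Section SL2p.
Variable p : nat.
Hypothesis p_pr : prime p.

Lemma SL2_group_set : group_set (SL2 p).
Proof.
apply/group_setP; split=> [|x y]; rewrite !inE; first by rewrite det1.
by move=> /eqP dx /eqP dy; rewrite GL_ME det_mulmx dx dy mulr1.
Qed.
Canonical SL2_group := Group SL2_group_set.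

Let GLval_inj2 : injective (@GLval 2 'F_p).
Proof. exact: val_inj. Qed.

Lemma SL2_faithful_rep : faithful_rep (SL2 p) (fun g : {'GL_2['F_p]} => GLval g : 'M_2).
Proof. by split=> [|x y _ _|x y _ _ E]; last exact: GLval_inj2. Qed.

Lemma SL2_det (x : {'GL_2['F_p]}) : x \in SL2 p -> (\det (GLval x : 'M_2) = 1)%R.
Proof. by rewrite inE => /eqP. Qed.

Lemma SL2_onto (A : 'M['F_p]_2) : (\det A = 1)%R -> mxG (fun g : {'GL_2['F_p]} => GLval g : 'M_2) (SL2 p) A.
Proof.
move=> dA; have uA : A \in unitmx by rewrite unitmxE dA unitr1.
by exists (FinRing.unit _ (uA : (A : 'M_2.-1.+1) \is a GRing.unit)); rewrite // inE /= dA.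
Qed.

End SL2p.

(** * p-groups of sectional rank at most 3 *)

Section Grank.
Variables (gT : finGroupType) (p : nat).
Implicit Types G H : {group gT}.

Lemma grankE G : grank G = 'm(G).
Proof.
apply/eqP; rewrite eqn_leq /grank; apply/andP; split.
  have [B genB <-] := grank_witness G.
  have : B \in index_enum {set gT} by rewrite mem_index_enum.
  elim: (index_enum _) => // C s IH; rewrite inE big_cons => /predU1P[<-|Bs].
    by rewrite genB eqxx geq_minl.
  by case: ifP => _; rewrite ?IH // (leq_trans (geq_minr _ _)) ?IH.
elim/big_ind: _ => [|m n lm ln|C /eqP <-]; last exact: grank_min.
  by rewrite -{1}(genGid G) grank_min.
by rewrite leq_min lm ln.
Qed.

(** Burnside's basis theorem: representatives of generators of the Frattini quotient generate,
    because Phi consists of nongenerators. *)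
Lemma pgroup_grank G : p.-group G -> 'm(G) = logn p #|G : 'Phi(G)|.
Proof.
move=> pG; have nG := normal_norm (Phi_normal G); have aG := Phi_quotient_abelem pG.
have -> : logn p #|G : 'Phi(G)| = 'm(G / 'Phi(G)).
  rewrite -card_quotient // grank_abelian ?(abelem_abelian aG) // (rank_abelem aG) //.
apply/eqP; rewrite eqn_leq quotient_grank // andbT.
have [B genB <-] := grank_witness (G / 'Phi(G)).
have sBG : B \subset G / 'Phi(G) by rewrite -genB subset_gen.
pose C := [set repr (val b) | b in B] .
have rB b : b \in B -> repr (val b) \in G /\ coset 'Phi(G) (repr (val b)) = b.
  move=> Bb; have := subsetP sBG b Bb; case/morphimP=> x Nx Gx ->; split; last by rewrite coset_reprK.
  have : repr (val (coset 'Phi(G) x)) \in 'Phi(G) :* x.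
    by rewrite -val_coset // mem_repr_coset.
  by case/rcosetP=> y Py ->; rewrite groupM // (subsetP (Phi_sub G)).
have sCG : C \subset G by apply/subsetP=> _ /imsetP[b /rB[? _] ->].
apply: leq_trans (leq_imset_card (fun b : coset_of 'Phi(G) => repr (val b)) B).
suffices genC : <<C>> = G by rewrite -{1}genC; apply: grank_min.
apply: Phi_nongen; apply/eqP; rewrite eqEsubset join_subG Phi_sub sCG /=.
rewrite -(quotientSGK nG) ?joing_subl // -genB gen_subG.
apply/subsetP=> b Bb; have [Gb eb] := rB b Bb; rewrite -{1}eb mem_quotient //.
by apply: (subsetP (joing_subr _ _)); apply/imsetP; exists b.
Qed.

Lemma sect_rank_Phi (E : {group gT}) H k : prime p -> sect_rank_le E k -> p.-group E -> H \subset E ->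
  #|H : 'Phi(H)| <= p ^ k.
Proof.
move=> p_pr rk pE sHE; have pH := pgroupS sHE pE.
have := rk H sHE; rewrite grankE pgroup_grank //.
have /p_natP[m ->] : p.-nat #|H : 'Phi(H)| by apply: pnat_dvd (dvdn_indexg _ _) pH.
by rewrite pfactorK // leq_exp2l // prime_gt1.
Qed.

End Grank.

Lemma p_leq_index (gT : finGroupType) (p : nat) (A B : {group gT}) :
  prime p -> p.-group B -> ~~ (B \subset A) -> p <= #|B : A|.
Proof.
move=> p_pr pB nBA; have /p_natP[[|k] Ek] : p.-nat #|B : A| by apply: pnat_dvd (dvdn_indexg _ _) pB.
  by move/eqP: Ek; rewrite indexg_eq1 (negPf nBA).
by rewrite Ek expnS leq_pmulr // expn_gt0 prime_gt0.
Qed.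

Section Class2.
Variables (gT : finGroupType) (p : nat) (H : {group gT}).
Hypotheses (p_pr : prime p) (pH : p.-group H).
Hypotheses (ZPhi : 'Z(H) = 'Phi(H)) (ZH' : 'Z(H) = H^`(1)) (iZ : #|H : 'Z(H)| = (p ^ 3)%N).

Let p_gt1 := prime_gt1 p_pr.
Let p_gt0 := prime_gt0 p_pr.

Let sZH : 'Z(H) \subset H := center_sub H.

Lemma class2_p_dvd_Z : p %| #|'Z(H)|.
Proof.
have [Z1|ntZ] := eqVneq 'Z(H) 1.
  have H1 : H :=: 1 by apply/eqP; rewrite -(center_nil_eq1 (pgroup_nil pH)) Z1.
  by move: iZ; rewrite H1 (trivgP (center_sub 1%G)) indexgg => /eqP; rewrite -(expn0 p) eqn_exp2l.
by have [] := pgroup_pdiv (pgroupS sZH pH) ntZ.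
Qed.

(** Factor out a subgroup [Q] of index p in the centre. The quotient has order p^4, so it is not
    extraspecial and has a central element from outside the centre of [H]; the class of a preimage
    lies in a coset of [Q], and [Q] has order at most p. *)
Lemma small_center_cent1 : #|'Z(H)| <= p ^ 2 ->
  exists2 x, x \in H :\: 'Z(H) & #|H : 'C_H[x]| <= p.
Proof.
move=> leZ; have pZ := pgroupS sZH pH; have [r oZ] := p_natP pZ.
have r2 : 0 < r <= 2.
  have := class2_p_dvd_Z; move: leZ; rewrite oZ leq_exp2l // => -> /=.
  by case: r {oZ} => //; rewrite dvdn1 (gtn_eqF p_gt1).
have [Q [sQZ nQH oQ]] : exists Q : {group gT}, [/\ Q \subset 'Z(H), Q <| H & #|Q| = (p ^ r.-1)%N].
  by apply: (normal_pgroup pH (center_normal H)); rewrite oZ pfactorK // leq_pred.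
have sQH := subset_trans sQZ sZH.
have NQ := normal_norm nQH.
have oHQ : #|H / Q| = (p ^ 4)%N.
  rewrite card_quotient //; apply/eqP; rewrite -(eqn_pmul2l (cardG_gt0 Q)) Lagrange //.
  rewrite oQ -(Lagrange sZH) iZ oZ -!expnD; case: r r2 {oZ oQ} => // r _.
  by rewrite /= addSnnS.
have oZQ : #|'Z(H) / Q| = p.
  rewrite card_quotient ?(subset_trans sZH) //; apply/eqP.
  rewrite -(eqn_pmul2l (cardG_gt0 Q)) Lagrange // oQ oZ -expnSr prednK //.
  by case/andP: r2.
have pHQ : p.-group (H / Q) by apply: quotient_pgroup.
have nes : ~ extraspecial (H / Q).
  move=> es; have [n _] := card_extraspecial pHQ es.
  by rewrite oHQ => /eqP; rewrite eqn_exp2l // => /eqP/(congr1 odd); rewrite /= odd_double.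
have : 'Z(H / Q) != 'Z(H) / Q.
  apply/eqP=> Zq; apply: nes; split; last by rewrite Zq oZQ.
  by split; rewrite Zq -?quotient_der // -?(quotient_Phi pH NQ) -?ZPhi -?ZH'.
rewrite eq_sym eqEsubset negb_and.
have -> /= : 'Z(H) / Q \subset 'Z(H / Q).
  by rewrite subsetI quotientS ?quotient_cents // subsetIr.
case/subsetPn=> y Zy nZy; have Hy := subsetP (center_sub _) y Zy.
case/morphimP: Hy Zy nZy => x Nx Hx -> Zx nZx.
exists x; first by rewrite inE Hx andbT; apply: contra nZx => Zx'; rewrite mem_quotient.
have /leq_trans-> // : #|H : 'C_H[x]| <= #|Q|.
  rewrite index_cent1 -(card_rcoset Q x); apply/subset_leq_card/subsetP=> _ /imsetP[h Hh ->].
  have Nh := subsetP NQ h Hh.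
  apply/rcoset_kercosetP; rewrite ?groupJ // morphJ //.
  by have /centerP[_ cx] := Zx; rewrite conjgE cx ?mulKg ?mem_quotient.
by rewrite oQ -{2}(expn1 p) leq_exp2l //; case/andP: r2 => _; case: (r) => [|[|[|]]].
Qed.

(** The centraliser of the element just found has order p^2 modulo Z(H). As [x] is central in it but
    not in [H], it is cyclic modulo a central subgroup. *)
Lemma small_center_maximal_abelian : #|'Z(H)| <= p ^ 2 ->
  exists B : {group gT}, [/\ B \subset H, abelian B, 'Z(H) \subset B & #|H : B| = p].
Proof.
case/small_center_cent1=> x /setDP[Hx nZx] le_p.
have sBH : 'C_H[x] \subset H := subsetIl _ _.
have sZB : 'Z(H) \subset 'C_H[x].
  by rewrite subsetI sZH (subset_trans (subsetIr _ _)) // -cent_set1 centS ?sub1set.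
have iB : #|H : 'C_H[x]| = p.
  have /p_natP[k Ek] : p.-nat #|H : 'C_H[x]| by apply: pnat_dvd (dvdn_indexg _ _) pH.
  have : 0 < k.
    rewrite lt0n; apply: contra nZx => /eqP k0; move: Ek; rewrite k0 expn0 => /eqP.
    rewrite indexg_eq1 subsetI subxx /= => cHx.
    by rewrite inE Hx -sub_cent1.
  by move: le_p; rewrite Ek -{2}(expn1 p) leq_exp2l //; case: k {Ek} => [|[|k]] // _ _; rewrite expn1.
exists ('C_H[x])%G; split=> //=.
have Bx : x \in 'C_H[x] by rewrite inE Hx cent1id.
pose K := ('Z(H) <*> <[x]>)%G; have sKB : K \subset 'C_H[x] by rewrite join_subG sZB cycle_subG.
have sKZ : K \subset 'Z('C_H[x]).
  rewrite subsetI sKB centsC centY subsetI cent_cycle subsetIr andbT.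
  by rewrite (subset_trans sBH) // centsC subsetIr.
have nZK : #|K : 'Z(H)| != 1%N.
  rewrite indexg_eq1; apply: contra nZx => sKZH; apply: (subsetP sKZH).
  by apply: (subsetP (joing_subr _ _)); apply: cycle_id.
have iBZ : (#|'C_H[x] : K| * #|K : 'Z(H)| = p ^ 2)%N.
  rewrite Lagrange_index ?joing_subl //; apply/eqP.
  by rewrite -(eqn_pmul2l p_gt0) -{1}iB Lagrange_index // iZ.
have pB := pgroupS sBH pH.
have /p_natP[j Ej] : p.-nat #|'C_H[x] : K| by apply: pnat_dvd (dvdn_indexg _ _) pB.
have /p_natP[k Ek] : p.-nat #|K : 'Z(H)| by apply: pnat_dvd (dvdn_indexg _ _) (pgroupS sKB pB).
have nKB : 'C_H[x] \subset 'N(K) by apply/normal_norm/sub_center_normal.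
apply: (cyclic_factor_abelian sKZ); apply: (dvdn_prime_cyclic p_pr).
rewrite card_quotient // Ej -{2}(expn1 p) dvdn_exp2l //.
move: iBZ nZK; rewrite Ej Ek -expnD => /eqP; rewrite eqn_exp2l //.
by case: k {Ek} => [|k]; rewrite ?expn0 // addnS eqSS => /eqP <-; rewrite leq_addr.
Qed.

(** Two different ones would generate [H] and meet inside its centre, of index p^3, although their
    intersection has index at most p^2. *)
Lemma maximal_abelian_uniq (B B' : {group gT}) : B \subset H -> B' \subset H ->
  abelian B -> abelian B' -> #|H : B| = p -> #|H : B'| = p -> B :=: B'.
Proof.
move=> sBH sB'H aB aB' iB iB'; apply/eqP/idPn=> neq.
have maxB : maximal B H by apply: p_index_maximal; rewrite ?iB.
have nBB' : ~~ (B' \subset B).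
  apply: contra neq => sB'B; rewrite eq_sym eqEcard sB'B /=.
  by rewrite -(leq_pmul2r p_gt0) -{1}iB -iB' !Lagrange.
have defH : B <*> B' = H.
  have [_ maxP] := maxgroupP maxB; apply/eqP; rewrite eqEproper join_subG sBH sB'H /=.
  apply: contra nBB' => prH; have := maxP (B <*> B')%G prH (joing_subl _ _).
  by move=> /= <-; apply: joing_subr.
have sIZ : B :&: B' \subset 'Z(H).
  rewrite subsetI (subset_trans (subsetIl _ _)) //= -defH centY subsetI.
  by rewrite (subset_trans (subsetIl _ _) aB) (subset_trans (subsetIr _ _) aB').
have := mul_cardG B B'; apply/eqP; rewrite neq_ltn; apply/orP; right.
have oB : (#|B| * p = #|H|)%N by rewrite -{1}iB Lagrange.
have oB' : (#|B'| * p = #|H|)%N by rewrite -{1}iB' Lagrange.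
have oZ : (#|'Z(H)| * p ^ 3 = #|H|)%N by rewrite -iZ Lagrange.
have le1 : #|B * B'| <= #|H| by rewrite subset_leq_card // mul_subG.
have le2 : #|B :&: B'| <= #|'Z(H)| by rewrite subset_leq_card.
apply: leq_ltn_trans (leq_mul le1 le2) _.
have EB : #|B| = (#|'Z(H)| * p ^ 2)%N.
  by apply/eqP; rewrite -(eqn_pmul2r p_gt0) oB -oZ -mulnA -expnSr.
have EB' : #|B'| = (#|'Z(H)| * p ^ 2)%N.
  by apply/eqP; rewrite -(eqn_pmul2r p_gt0) oB' -oZ -mulnA -expnSr.
rewrite EB EB' -oZ mulnAC mulnACA -expnD ltn_pmul2l ?muln_gt0 ?cardG_gt0 //.
by rewrite ltn_exp2l.
Qed.

(** [T] has order p^5 and is generated by the centre and two elements, so Phi(T) lies in the group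
    of order at most p generated by their commutator. *)
Lemma large_center_maximal (T : {group gT}) : (forall x, x \in H -> x ^+ p = 1) ->
  #|'Z(H)| = (p ^ 3)%N -> T \subset H -> 'Z(H) \subset T -> #|H : T| = p ->
  p ^ 4 <= #|T : 'Phi(T)|.
Proof.
move=> expH oZ sTH sZT iT; have pT := pgroupS sTH pH.
have iTZ : #|T : 'Z(H)| = (p ^ 2)%N.
  by apply/eqP; rewrite -(eqn_pmul2l p_gt0) -{1}iT Lagrange_index // iZ.
have cZT : T \subset 'C('Z(H)) by rewrite (subset_trans sTH) // centsC subsetIr.
have [a Ta nZa] : exists2 a, a \in T & a \notin 'Z(H).
  by apply/subsetPn; rewrite -indexg_eq1 iTZ -(expn0 p) eqn_exp2l.
pose L := ('Z(H) <*> <[a]>)%G; have sLT : L \subset T by rewrite join_subG sZT cycle_subG.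
have [b Tb nLb] : exists2 b, b \in T & b \notin L.
  apply/subsetPn; rewrite -indexg_eq1; apply/eqP=> iL.
  have := Lagrange_index sLT (joing_subl 'Z(H) <[a]>); rewrite iTZ iL mul1n => iLZ.
  have : #|L| <= #|'Z(H)| * p.
    rewrite /L /= norm_joinEr; last first.
      by rewrite cycle_subG (subsetP (normal_norm (center_normal H))) ?(subsetP sTH).
    apply: leq_trans (_ : #|'Z(H)| * #|<[a]>| <= _).
      by rewrite mul_cardG leq_pmulr // cardG_gt0.
    rewrite leq_mul2l -orderE; apply/orP; right; apply: dvdn_leq => //.
    by rewrite order_dvdn expH // (subsetP sTH).
  apply/negP; rewrite -ltnNge -(Lagrange (joing_subl 'Z(H) <[a]>)) iLZ.
  by rewrite ltn_pmul2l ?cardG_gt0 // -{1}(expn1 p) ltn_exp2l.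
have sLbT : L <*> <[b]> \subset T by rewrite join_subG sLT cycle_subG.
have defT : L <*> <[b]> = T.
  apply/eqP; rewrite eqEsubset sLbT -indexg_eq1 eqn_leq indexg_gt0 andbT.
  have le1 : p <= #|L <*> <[b]> : L|.
    apply: p_leq_index (pgroupS sLbT pT) _ => //; apply: contra nLb => /subsetP; apply.
    by apply: (subsetP (joing_subr _ _)); apply: cycle_id.
  have le2 : p <= #|L : 'Z(H)|.
    apply: p_leq_index (pgroupS sLT pT) _ => //; apply: contra nZa => /subsetP; apply.
    by apply: (subsetP (joing_subr _ _)); apply: cycle_id.
  have sZL : 'Z(H) \subset L := joing_subl _ _.
  have := leq_mul (leqnn #|T : L <*> <[b]>|) (leq_mul le1 le2).
  rewrite Lagrange_index ?joing_subl // Lagrange_index ?(subset_trans sZL) ?joing_subl //.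
  by rewrite iTZ mulnn -{2}(mul1n (p ^ 2)%N) leq_pmul2r ?expn_gt0 ?p_gt0.
pose k := [~ a, b]; have Zk : k \in 'Z(H) by rewrite ZH' mem_commg ?(subsetP sTH).
have nKT : T \subset 'N(<[k]>).
  by rewrite cents_norm // (subset_trans cZT) // centS ?cycle_subG.
have leK : #|<[k]>| <= p.
  rewrite -orderE; apply: dvdn_leq => //; rewrite order_dvdn expH //.
  exact: subsetP (center_sub H) _ Zk.
have sPhi : 'Phi(T) \subset <[k]>.
  apply: (Phi_min pT nKT); rewrite (abelemE _ p_pr); apply/andP; split; last first.
    apply: dvdn_trans (exponent_quotient _ _) _; apply/exponentP=> x Tx.
    by rewrite expH // (subsetP sTH).
  have Na := subsetP nKT a Ta; have Nb := subsetP nKT b Tb.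
  rewrite /= -defT /L /= !quotientY ?cycle_subG ?(subset_trans sZT) ?(subset_trans sLT) //.
  rewrite !abelianY !quotient_abelian ?center_abelian ?cycle_abelian //=.
  have cZ c : c \in T -> <[c]> / <[k]> \subset 'C('Z(H) / <[k]>).
    by move=> Tc; rewrite quotient_cents // cycle_subG (subsetP cZT).
  rewrite cZ // centY subsetI cZ //= (quotient_cycle Na) (quotient_cycle Nb).
  rewrite cycle_subG /= cent_cycle; apply/cent1P/commgP.
  by rewrite -morphR //= coset_id ?eqxx // -invg_comm groupV cycle_id.
rewrite -(leq_pmul2l (cardG_gt0 'Phi(T))) Lagrange ?Phi_sub //.
rewrite -(Lagrange sZT) oZ iTZ -expnD.
by apply: leq_trans (leq_mul (leq_trans (subset_leq_card sPhi) leK) (leqnn _)) _; rewrite -expnS.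
Qed.

End Class2.

(** The correction term is [y, x] to the power binomial(p, 2), a multiple of p for odd p. *)
Lemma class2_expMp (gT : finGroupType) (p : nat) (H : {group gT}) :
  prime p -> odd p -> H^`(1) \subset 'Z(H) -> (forall z, z \in H^`(1) -> z ^+ p = 1) ->
  {in H &, {morph (fun x => x ^+ p) : x y / x * y}}.
Proof.
move=> p_pr p_odd sH'Z expH' x y Hx Hy.
have Zxy : [~ y, x] \in 'Z(H) by rewrite (subsetP sH'Z) ?mem_commg.
have [_ cxy] := centerP _ _ Zxy.
have c1 := commute_sym (cxy y Hy); have c2 := commute_sym (cxy x Hx).
rewrite (expMg_Rmul _ c1 c2).
have /dvdnP[k ->] : p %| 'C(p, 2) by rewrite prime_dvd_bin // odd_prime_gt2.
by rewrite mulnC expgM (expH' [~ y, x]) ?mem_commg // expg1n mulg1.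
Qed.

(** * Invariant subgroups and the power map on an irreducible Frattini quotient *)

Section InvariantSubgroups.
Variables (gT : finGroupType) (E : {group gT}) (A : {set {perm gT}}).
Hypothesis sAE : A \subset Aut E.

Definition invariant_by (N : {set gT}) := forall a, a \in A -> a @: N = N.

Definition irreducible_mod_Phi (M : {set gT}) :=
  forall N : {group gT}, N \subset M -> invariant_by N -> N :=: M \/ N \subset 'Phi(M).

Lemma Aut_imset a (Ea : a \in Aut E) (N : {set gT}) : N \subset E -> a @: N = autm Ea @* N.
Proof. by move=> sNE; rewrite morphimEsub. Qed.

Lemma invariant_char (M K : {group gT}) : M \subset E -> invariant_by M -> K \char M -> invariant_by K.
Proof.
move=> sME invM chK a Aa; have Ea := subsetP sAE a Aa.
have [sKM chP] := charP _ _ chK.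
have := chP (restrm_morphism sME (autm_morphism Ea)); rewrite morphim_restrm setIid.
rewrite -Aut_imset // invM // => /(_ _ erefl); rewrite morphim_restrm (setIidPr sKM).
by rewrite -Aut_imset ?(subset_trans sKM) //; apply; rewrite injm_restrm ?injm_autm.
Qed.

Lemma invariant_commg (M N : {group gT}) : M \subset E -> N \subset E ->
  invariant_by M -> invariant_by N -> invariant_by [~: M, N].
Proof.
move=> sME sNE invM invN a Aa; have Ea := subsetP sAE a Aa.
by rewrite (Aut_imset Ea) ?comm_subG // morphimR // -!Aut_imset // invM ?invN.
Qed.

Lemma invariant_joing (M N : {group gT}) : M \subset E -> N \subset E ->
  invariant_by M -> invariant_by N -> invariant_by (M <*> N).
Proof.
move=> sME sNE invM invN a Aa; have Ea := subsetP sAE a Aa.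
by rewrite (Aut_imset Ea) ?join_subG ?sME // morphimY // -!Aut_imset // invM ?invN.
Qed.

Lemma invariant_preim (M N : {group gT}) (P : pred gT) : M \subset E -> invariant_by M ->
  (forall a x, a \in A -> x \in M -> P x -> P (a x)) -> N :=: [set x in M | P x] -> invariant_by N.
Proof.
move=> sME invM Pa defN a Aa; apply/eqP; rewrite eqEcard card_imset ?leqnn ?andbT; last exact: perm_inj.
apply/subsetP=> _ /imsetP[x + ->]; rewrite defN !inE => /andP[Mx Px].
by rewrite Pa // andbT -(invM a Aa) imset_f.
Qed.

End InvariantSubgroups.

Lemma Phi_expp (gT : finGroupType) (p : nat) (G : {group gT}) x :
  prime p -> p.-group G -> x \in G -> x ^+ p \in 'Phi(G).
Proof.
move=> p_pr pG Gx; have := Phi_quotient_abelem pG.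
have Nx : x \in 'N('Phi(G)) by apply: subsetP Gx; apply: gFnorm.
case/abelemP=> // _ /(_ (coset 'Phi(G) x)); rewrite mem_quotient // => /(_ isT).
by rewrite -morphX //; apply: coset_idr; rewrite groupX.
Qed.

Lemma der1_sub_Phi (gT : finGroupType) (p : nat) (G : {group gT}) :
  p.-group G -> G^`(1) \subset 'Phi(G).
Proof.
by move=> pG; apply: der1_min; rewrite ?gFnorm // (abelem_abelian (Phi_quotient_abelem pG)).
Qed.

Section IrreducibleStep.
Variables (gT : finGroupType) (p : nat) (E : {group gT}) (A : {set {perm gT}}).
Hypotheses (p_pr : prime p) (p_odd : odd p) (pE : p.-group E) (rkE : sect_rank_le E 3).
Hypothesis sAE : A \subset Aut E.
Variable M : {group gT}.
Hypotheses (sME : M \subset E) (invM : invariant_by A M) (irrM : irreducible_mod_Phi A M).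
Hypotheses (iM : #|M : 'Phi(M)| = (p ^ 3)%N) (ntR : 'Phi(M) != 1).

Let R := 'Phi(M)%G.
Let K0 := ('Phi(R) <*> [~: R, M])%G.

Let pM : p.-group M := pgroupS sME pE.
Let sRM : R \subset M := Phi_sub M.
Let nRM : R <| M := Phi_normal M.
Let pR : p.-group R := pgroupS sRM pM.
Let p_gt1 : 1 < p := prime_gt1 p_pr.
Let p_gt0 : 0 < p := prime_gt0 p_pr.

Let invR : invariant_by A R.
Proof. exact: (invariant_char sAE sME invM (Phi_char M)). Qed.

Let invPhiR : invariant_by A 'Phi(R).
Proof. by apply: (invariant_char sAE _ invR (Phi_char R)); apply: subset_trans sRM sME. Qed.

Let invK0 : invariant_by A K0.
Proof.
apply: (invariant_joing sAE (N := [~: R, M]%G)) => //.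
- exact: subset_trans (Phi_sub R) (subset_trans sRM sME).
- by rewrite comm_subG // (subset_trans sRM).
by apply: (invariant_commg sAE) => //; apply: subset_trans sRM sME.
Qed.

Let sK0R : K0 \subset R.
Proof. by rewrite join_subG Phi_sub /= commg_subl normal_norm. Qed.

Let nK0M : K0 <| M.
Proof.
rewrite normalY // /normal ?comm_subG ?normsR ?normG ?(normal_norm nRM) //.
by apply: char_normal_trans (Phi_char R) nRM.
Qed.

Let nK0 : M \subset 'N(K0) := normal_norm nK0M.

(** Otherwise R = [R, M], since the Frattini factor is redundant, against nilpotency. *)
Let ltK0R : ~~ (R \subset K0).
Proof.
apply/negP=> sRK; have defR : 'Phi(R) <*> [~: R, M] = R.
  by apply/eqP; rewrite eqEsubset sRK andbT; exact: sK0R.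
have := nil_comm_properl (pgroup_nil pM) sRM ntR (_ : M \subset 'N_M(R)).
rewrite subsetI subxx normal_norm // => /(_ isT).
by rewrite -{2}(Phi_nongen defR) genGid properxx.
Qed.

Let H := (M / K0)%G.
Let Rb := (R / K0)%G.
Let pH : p.-group H := quotient_pgroup K0 pM.

Let leRK0 : #|R : K0| <= p ^ 3.
Proof.
have sRE := subset_trans sRM sME.
apply: leq_trans (sect_rank_Phi p_pr rkE pE sRE).
by rewrite dvdn_leq ?indexgS ?indexSg ?joing_subl.
Qed.

Let RbZ : Rb \subset 'Z(H).
Proof. by rewrite subsetI quotientS //= quotient_cents2r // joing_subr. Qed.

Let H'Rb : H^`(1) \subset Rb.
Proof. by rewrite -quotient_der // quotientS ?(der1_sub_Phi pM). Qed.

Let Rb_expp z : z \in Rb -> z ^+ p = 1.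
Proof.
case/morphimP=> y Ny Ry ->; rewrite -morphX //= coset_id //.
by apply: (subsetP (joing_subl _ _)); apply: Phi_expp.
Qed.

Let pow_morph : {in H &, {morph (fun x => x ^+ p) : x y / x * y}}.
Proof.
apply: class2_expMp => //; first exact: subset_trans H'Rb RbZ.
by move=> z H'z; apply: Rb_expp; apply: (subsetP H'Rb).
Qed.

Let powp := Morphism pow_morph.

Let autX a x k : a \in A -> x \in E -> a (x ^+ k) = a x ^+ k.
Proof.
move=> Aa Ex; have Ea := subsetP sAE a Aa.
by rewrite -!(autmE Ea) morphX.
Qed.

(** The preimage of an invariant subgroup under the power map is invariant, so irreducibility
    applies. [L = K0] separates exponent p from injectivity; other [L] carry irreducibility from [M]
    to [R]. *)
Let power_preim (L : {group gT}) : K0 \subset L -> L \subset R -> invariant_by A L ->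
  exists N : {group gT}, [/\ N :=: [set x in M | x ^+ p \in L], invariant_by A N
    & N :=: M \/ N \subset R].
Proof.
move=> sK0L sLR invL.
have nK0L : K0 <| L by apply: normalS sK0L (subset_trans sLR sRM) nK0M.
pose N := (M :&: coset K0 @*^-1 (powp @*^-1 (L / K0)))%G.
have defN : N :=: [set x in M | x ^+ p \in L].
  have preE (aT rT : finGroupType) (D : {group aT}) (f : {morphism D >-> rT}) X y :
    y \in D -> (y \in f @*^-1 X) = (f y \in X) by move=> Dy; rewrite in_setI Dy inE.
  apply/setP=> x; rewrite in_setI [in RHS]in_set; apply: andb_id2l => Mx.
  have Nx := subsetP nK0 x Mx; have Hx : coset K0 x \in H by apply: mem_quotient.
  rewrite preE // preE //= -morphX //.
  by rewrite -{2}(quotientGK nK0L) preE ?groupX.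
have invN : invariant_by A N.
  apply: (invariant_preim sME invM _ defN) => a x Aa Mx Lx.
  by rewrite -autX ?(subsetP sME) // -(invL a Aa) imset_f.
exists N; split=> //; apply: irrM => //; exact: subsetIl.
Qed.

Let oRb : #|Rb| = #|R : K0|.
Proof. by rewrite card_quotient ?(subset_trans sRM). Qed.

Let iHR : #|H : Rb| = (p ^ 3)%N.
Proof.
rewrite -divgS ?quotientS // oRb card_quotient // -(Lagrange_index sRM sK0R) iM.
by rewrite mulnK.
Qed.

Let index_K0 (B : {group gT}) : K0 \subset B -> B \subset M -> #|H : B / K0| = #|M : B|.
Proof.
move=> sKB sBM; have sBH : B / K0 \subset H by apply: quotientS.
have oB : #|B / K0| = #|B : K0| by rewrite card_quotient ?(subset_trans sBM).
apply/eqP; rewrite -(eqn_pmul2l (cardG_gt0 (B / K0))) (Lagrange sBH) oB mulnC.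
by rewrite Lagrange_index // card_quotient.
Qed.

(** The image of the power map has order at least |M : R| = p^3, while sectional rank 3 bounds |R :
    Phi(R)| by p^3; no room is left between Phi(R) and K0. *)
Let power_iso : (forall x, x \in M -> x ^+ p \in K0 -> x \in R) ->
  [/\ K0 :=: 'Phi(R), #|R : K0| = (p ^ 3)%N & powp @* H = Rb].
Proof.
move=> inj.
have kerE : 'ker powp \subset Rb.
  apply/subsetP=> z Kz; have Hz := dom_ker Kz.
  case/morphimP: Hz Kz => x Nx Mx -> /mker /=; rewrite -morphX // => eX.
  by rewrite mem_quotient // inj //; apply: coset_idr; rewrite ?groupX //.
have imE : powp @* H \subset Rb.
  apply/subsetP=> _ /morphimP[_ _ /morphimP[x Nx Mx ->] ->] /=.
  by rewrite -morphX // mem_quotient ?Phi_expp.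
have le1 : p ^ 3 <= #|powp @* H|.
  by rewrite card_morphim setIid -iHR dvdn_leq ?indexgS ?indexg_gt0.
have iRK : #|R : K0| = (p ^ 3)%N.
  by apply/eqP; rewrite eqn_leq leRK0 -oRb (leq_trans le1) ?subset_leq_card.
split=> //; last by apply/eqP; rewrite eqEcard imE oRb iRK le1.
apply/eqP; rewrite eqEsubset joing_subl andbT -indexg_eq1.
have sRE := subset_trans sRM sME.
have := sect_rank_Phi p_pr rkE pE sRE; rewrite -(Lagrange_index sK0R (joing_subl _ _)) iRK.
rewrite -[X in _ <= X]muln1 leq_pmul2l ?expn_gt0 ?p_gt0 //.
by rewrite eqn_leq indexg_gt0 andbT.
Qed.

Let power_step : (forall x, x \in M -> x ^+ p \in K0 -> x \in R) ->
  [/\ #|R : 'Phi(R)| = (p ^ 3)%N, irreducible_mod_Phi A R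
    & forall x, x \in M -> x \notin R -> x ^+ p \notin 'Phi(R)].
Proof.
move=> inj; have [defK0 iRK imE] := power_iso inj; rewrite -defK0; split=> //.
  move=> L sLR invL; rewrite -defK0.
  have sRE := subset_trans sRM sME.
  pose L1 := ('Phi(R) <*> L)%G.
  have sL1R : L1 \subset R by rewrite join_subG Phi_sub.
  have sKL1 : K0 \subset L1 by rewrite defK0 joing_subl.
  have invL1 : invariant_by A L1.
    by apply: (invariant_joing sAE) => //; apply: subset_trans sRE => //; apply: Phi_sub.
  have [N [defN _ [NM | NR]]] := power_preim sKL1 sL1R invL1; [left | right].
    have sRL1 : R \subset L1.
      suffices sRbL : Rb \subset L1 / K0 by rewrite -(quotientSGK _ sKL1) ?(subset_trans sRM).
      rewrite -imE.
      apply/subsetP=> _ /morphimP[_ _ /morphimP[x Nx Mx ->] ->] /=.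
      rewrite -morphX // mem_quotient //.
      by have : x \in N by [rewrite NM]; rewrite defN inE => /andP[].
    by rewrite -[RHS](@Phi_nongen _ R L) ?genGid //; apply/eqP; rewrite eqEsubset sL1R.
  apply/subsetP=> y Ly; have Ry := subsetP sLR y Ly.
  have : coset K0 y \in powp @* H by rewrite imE mem_quotient.
  case/morphimP=> _ _ /morphimP[x Nx Mx ->] /=; rewrite -morphX // => eX.
  have Ny : y \in 'N(K0) by rewrite (subsetP nK0) ?(subsetP sRM).
  have /rcosetP[z Kz Ez] : x ^+ p \in K0 :* y by apply/rcoset_kercosetP; rewrite ?groupX.
  have L1x : x ^+ p \in L1.
    have L1y : y \in L1 by apply: (subsetP (joing_subr _ _)).
    by rewrite Ez; apply: groupM L1y; apply: (subsetP sKL1).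
  have Nx' : x \in N by rewrite defN inE Mx.
  have Rx := subsetP NR x Nx'; have : x ^+ p \in K0 by rewrite defK0 Phi_expp.
  by rewrite Ez groupMl.
by move=> x Mx; apply: contra => /inj->.
Qed.

Section ExponentP.
Hypothesis expM : forall x, x \in M -> x ^+ p \in K0.

Let expH x : x \in H -> x ^+ p = 1.
Proof. by case/morphimP=> y Ny My ->; rewrite -morphX //= coset_id ?expM. Qed.

Let expon (K : {group coset_of K0}) : K \subset H -> exponent K %| p.
Proof. by move=> sKH; apply/exponentP=> x /(subsetP sKH)/expH. Qed.

Let PhiH : 'Phi(H) = Rb.
Proof. by rewrite -(quotient_Phi pM nK0). Qed.

Let ntRb : Rb :!=: 1.
Proof.
apply: contra ltK0R => /eqP R1; rewrite -quotient_sub1 ?(subset_trans sRM) //.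
by rewrite (_ : R / K0 = 1).
Qed.

Let derH : H^`(1) = Rb.
Proof.
apply/eqP; rewrite eqEsubset H'Rb -PhiH (Phi_min pH) ?der_norm //.
by rewrite (abelemE _ p_pr) der_abelian (dvdn_trans (exponent_quotient _ _)) ?expon.
Qed.

(** The preimage of the centre is invariant; if it were all of [M], [H] would be elementary abelian
    and [Rb], its Frattini subgroup, trivial. *)
Let ZH : 'Z(H) = Rb.
Proof.
apply/eqP; rewrite eqEsubset RbZ andbT.
pose Z0 := (M :&: coset K0 @*^-1 'Z(H))%G.
have defZ0 : Z0 :=: [set x in M | [forall y in M, [~ x, y] \in K0]].
  apply/setP=> x; rewrite in_setI [in RHS]in_set; apply: andb_id2l => Mx.
  have Nx := subsetP nK0 x Mx; rewrite in_setI Nx /= inE.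
  have Hx : coset K0 x \in H by apply: mem_quotient.
  apply/centerP/forall_inP=> [[_ cx] y My | cx].
    have Ny := subsetP nK0 y My; apply: coset_idr; rewrite ?groupR //.
    by rewrite morphR //; apply/eqP/commgP/cx/mem_quotient.
  split=> // _ /morphimP[y Ny My ->]; apply/commgP.
  by rewrite -morphR //= coset_id ?cx.
have invZ0 : invariant_by A Z0.
  apply: (invariant_preim sME invM _ defZ0) => a x Aa Mx /forall_inP cx.
  have Ea := subsetP sAE a Aa.
  apply/forall_inP=> y; rewrite -{1}(invM Aa) => /imsetP[z Mz ->].
  rewrite -!(autmE Ea) -morphR ?(subsetP sME) //= autmE.
  by have := imset_f a (cx z Mz); rewrite invK0.
have sZ0M : Z0 \subset M by apply: subsetIl.
have sZ : 'Z(H) \subset Z0 / K0.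
  apply/subsetP=> z Zz; have /morphimP[x Nx Mx Ez] := subsetP (center_sub _) z Zz.
  by rewrite Ez mem_quotient // in_setI Mx in_setI Nx inE -Ez.
have [Z0M | sZ0R] := irrM sZ0M invZ0; last exact: subset_trans sZ (quotientS _ sZ0R).
have cHH : abelian H.
  apply: sub_der1_abelian; rewrite gen_subG; apply/subsetP=> _ /imset2P[x y Mx My ->].
  by have : x \in Z0 by [rewrite Z0M]; rewrite defZ0 inE => /andP[_ /forall_inP]; apply.
case/eqP: ntRb; rewrite -PhiH; apply/eqP; rewrite (trivg_Phi pH).
by rewrite (abelemE _ p_pr) cHH expon.
Qed.

(** The centre of [H] has order at most p^3. Up to p^2, the abelian subgroup of index p is unique,
    hence invariant, although no invariant subgroup of index p exists; at p^3 a maximal subgroup has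
    rank at least 4. *)
Lemma exponent_p_contra : False.
Proof.
have iZ : #|H : 'Z(H)| = (p ^ 3)%N by rewrite ZH.
have ZPhi : 'Z(H) = 'Phi(H) by rewrite ZH PhiH.
have ZH' : 'Z(H) = H^`(1) by rewrite ZH derH.
have oZ : #|'Z(H)| = #|R : K0| by rewrite ZH.
have /p_natP[r Er] : p.-nat #|R : K0| by apply: pnat_dvd (dvdn_indexg _ _) pR.
have r3 : r <= 3 by have := leRK0; rewrite Er leq_exp2l.
have [le2 | gt2] := leqP r 2.
  have leZ : #|'Z(H)| <= p ^ 2 by rewrite oZ Er leq_exp2l.
  have [B [sBH cBB _ iB]] := small_center_maximal_abelian p_pr pH ZPhi ZH' iZ leZ.
  have [B0 defB sK0B0 sB0M] := inv_quotientS nK0M sBH.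
  have iB0 : #|M : B0| = p by rewrite -index_K0 // -defB.
  have invB0 : invariant_by A B0.
    move=> a Aa; have Ea := subsetP sAE a Aa; have sB0E := subset_trans sB0M sME.
    pose B1 := (autm_morphism Ea @* B0)%G.
    have EB1 : a @: B0 = B1 by rewrite (Aut_imset Ea).
    have sB1M : B1 \subset M by rewrite -EB1 -(invM Aa) imsetS.
    have sK0B1 : K0 \subset B1 by rewrite -EB1 -(invK0 Aa) imsetS.
    have oB1 : #|B1| = #|B0| by rewrite -EB1 card_imset //; apply: perm_inj.
    have aB1 : abelian (B1 / K0).
      apply: sub_der1_abelian; rewrite -morphim_der //.
      have sder : B0^`(1) \subset K0.
        by apply: der1_min; rewrite ?(subset_trans sB0M) // -defB.
      by rewrite -Aut_imset ?(subset_trans (der_sub _ _)) // -(invK0 Aa) imsetS.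
    have iB1 : #|H : B1 / K0| = p.
      by rewrite index_K0 // -divgS // oB1 divgS.
    have := maximal_abelian_uniq p_pr iZ (quotientS _ sB1M) sBH aB1 cBB iB1 iB.
    rewrite defB EB1 => /quotient_inj; apply; rewrite /normal ?sK0B1 ?sK0B0 /=.
      exact: subset_trans nK0.
    exact: subset_trans nK0.
  have [B0M | sB0R] := irrM sB0M invB0.
    by move: iB0; rewrite B0M indexgg => /eqP; rewrite (ltn_eqF p_gt1).
  have : #|M : R| <= #|M : B0| by rewrite dvdn_leq ?indexgS ?indexg_gt0.
  by rewrite iM iB0 -{2}(expn1 p) leq_exp2l.
have rE : r = 3 by apply/eqP; rewrite eqn_leq r3.
have [HZ | [T maxT sZT]] := maximal_exists (center_sub H).
  by move/eqP: iZ; rewrite HZ indexgg -(expn0 p) eqn_exp2l.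
have sTH := maxgroupp maxT; have {}sTH := proper_sub sTH.
have := large_center_maximal p_pr pH ZH' iZ expH _ sTH sZT (p_maximal_index pH maxT).
rewrite oZ Er rE => /(_ erefl).
have [T0 defT sK0T0 sT0M] := inv_quotientS nK0M sTH.
have pT := pgroupS sTH pH.
have /p_natP[m Em] : p.-nat #|T : 'Phi(T)| by apply: pnat_dvd (dvdn_indexg _ _) pT.
rewrite Em leq_exp2l // leqNgt ltnS.
suffices -> : m <= 3 by [].
have -> : m = 'm(T) by rewrite (pgroup_grank pT) Em pfactorK.
rewrite defT; apply: leq_trans (quotient_grank (subset_trans sT0M nK0)) _.
by rewrite -grankE; apply: rkE; apply: subset_trans sT0M sME.
Qed.

End ExponentP.

Lemma irr_step :
  [/\ #|R : 'Phi(R)| = (p ^ 3)%N, irreducible_mod_Phi A R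
    & forall x, x \in M -> x \notin R -> x ^+ p \notin 'Phi(R)].
Proof.
have [N [defN _ [NM | NR]]] := power_preim (subxx K0) sK0R invK0.
  by case: exponent_p_contra => x; rewrite -NM defN inE => /andP[].
by apply: power_step => x Mx Kx; apply: (subsetP NR); rewrite defN inE Mx.
Qed.

End IrreducibleStep.

Lemma order_expp (gT : finGroupType) (p : nat) (x : gT) :
  prime p -> p.-elt x -> x != 1 -> #[x] = (p * #[x ^+ p])%N.
Proof.
move=> p_pr px ntx; rewrite orderXdiv; last exact: p_elt_dvd_order.
by rewrite mulnC divnK //; apply: p_elt_dvd_order.
Qed.

Section OrderLemma.
Variables (gT : finGroupType) (p : nat) (E : {group gT}) (A : {set {perm gT}}).
Hypotheses (p_pr : prime p) (p_odd : odd p) (pE : p.-group E) (rkE : sect_rank_le E 3).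
Hypothesis sAE : A \subset Aut E.

(** By [irr_step] the hypotheses pass to Phi(M), and p-th powers of elements outside Phi(M) fall
    outside Phi(Phi(M)). The induction hypothesis compares these powers, and one more factor p
    separates the orders. The non-strict clause is there because the induction consumes it. *)
Lemma order_Phi (M : {group gT}) : M \subset E -> invariant_by A M -> irreducible_mod_Phi A M ->
  #|M : 'Phi(M)| = (p ^ 3)%N -> forall x, x \in M -> x \notin 'Phi(M) ->
  (forall y, y \in M -> #[y] <= #[x]) /\ (forall y, y \in 'Phi(M) -> #[y] < #[x]).
Proof.
have [n] := ubnP #|M|; elim: n M => // n IH M leMn sME invM irrM iM x Mx nRx.
have pM := pgroupS sME pE; have p_gt1 := prime_gt1 p_pr; have p_gt0 := prime_gt0 p_pr.
have sRM := Phi_sub M.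
have ox z : z \in M -> z \notin 'Phi(M) -> #[z] = (p * #[z ^+ p])%N.
  move=> Mz nRz; apply: order_expp (mem_p_elt pM Mz) _ => //.
  by apply: contra nRz => /eqP->; apply: group1.
have [R1 | ntR] := eqVneq ('Phi(M) : {set gT}) 1.
  have Xp z : z \in M -> z ^+ p = 1.
    by move=> Mz; apply/set1P; rewrite -[[set 1]]R1 (Phi_expp p_pr pM).
  have oxp : #[x] = p by rewrite ox // Xp // order1 muln1.
  split=> y.
    by move=> My; rewrite oxp dvdn_leq // order_dvdn Xp.
  by rewrite R1 => /set1P->; rewrite order1 oxp.
have [iR irrR pw] := irr_step p_pr p_odd pE rkE sAE sME invM irrM iM ntR.
have ltR : #|'Phi(M)| < n.
  apply: leq_trans (proper_card (_ : 'Phi(M) \proper M)) _ => //.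
  by rewrite Phi_proper //; apply: contra ntR => /eqP->; rewrite (trivgP (Phi_sub 1%G)).
have invR := invariant_char sAE sME invM (Phi_char M).
have xp := pw x Mx nRx.
have [xp1 xp2] := IH _ ltR (subset_trans sRM sME) invR irrR iR _ (Phi_expp p_pr pM Mx) xp.
have lt1 y : y \in 'Phi(M) -> #[y] < #[x].
  move=> Ry; rewrite (ox x) //; apply: leq_ltn_trans (xp1 y Ry) _.
  by rewrite -{1}[#[_]]mul1n ltn_pmul2r ?order_gt0.
split=> // y My; have [Ry | nRy] := boolP (y \in 'Phi(M)); first exact: ltnW (lt1 y Ry).
rewrite (ox x) // (ox y) // leq_pmul2l // xp1 //.
exact: Phi_expp.
Qed.

End OrderLemma.

(** * Automorphisms acting on the Frattini quotient *)

Lemma AutM (gT : finGroupType) (E : {group gT}) (a : {perm gT}) :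
  a \in Aut E -> {in E &, {morph a : x y / x * y}}.
Proof. by move=> Ea x y Ex Ey; rewrite -!(autmE Ea) morphM. Qed.

Lemma AutV (gT : finGroupType) (E : {group gT}) (a : {perm gT}) :
  a \in Aut E -> {in E, {morph a : x / x^-1}}.
Proof. by move=> Ea x Ex; rewrite -!(autmE Ea) morphV. Qed.

Lemma Aut_mem (gT : finGroupType) (E : {group gT}) (a : {perm gT}) x :
  a \in Aut E -> x \in E -> a x \in E.
Proof. by move=> Ea Ex; rewrite Aut_closed. Qed.

Lemma Aut_imset_id (gT : finGroupType) (E : {group gT}) (a : {perm gT}) :
  a \in Aut E -> a @: E = E.
Proof.
move=> Ea; apply/eqP; rewrite eqEcard card_imset ?leqnn ?andbT; last exact: perm_inj.
by apply/subsetP=> _ /imsetP[x Ex ->]; apply: Aut_mem.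
Qed.

Lemma Aut_char (gT : finGroupType) (E K : {group gT}) (a : {perm gT}) :
  K \char E -> a \in Aut E -> a @: K = K.
Proof.
move=> chK; apply: (invariant_char (subxx (Aut E)) (subxx E) _ chK) => b.
exact: Aut_imset_id.
Qed.

(** An element of prime order q other than p permutes each coset of Phi(E), whose size is prime to
    q, and so fixes a point in it; such points generate [E]. *)
Lemma Aut_trivial_mod_Phi (gT : finGroupType) (p : nat) (E : {group gT}) (a : {perm gT}) :
  p.-group E -> a \in Aut E -> (forall x, x \in E -> x^-1 * a x \in 'Phi(E)) -> p.-elt a.
Proof.
move=> pE Ea aPhi.
have Phi_X k x : x \in E -> x^-1 * (a ^+ k) x \in 'Phi(E).
  move=> Ex; elim: k => [|k IH]; first by rewrite perm1 mulVg group1.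
  rewrite expgSr permM -(mulKVg ((a ^+ k) x) (a _)) mulgA groupM // aPhi //.
  by rewrite Aut_mem ?groupX.
apply/pnatP=> // q q_pr qa; apply/idPn=> npq.
pose d := a ^+ (#[a] %/ q); have od : #[d] = q.
  by rewrite orderXdiv ?dvdn_div // divnA // mulKn.
have Ed : d \in Aut E by apply: groupX.
have C_set : group_set [set x in E | d x == x].
  apply/group_setP; split=> [|x y]; rewrite !inE.
    by rewrite group1 -(autmE Ed) morph1 eqxx.
  by move=> /andP[Ex /eqP ex] /andP[Ey /eqP ey]; rewrite groupM // (AutM Ed) // ex ey eqxx.
have sCE : [set x in E | d x == x] \subset E by apply/subsetP=> x; rewrite inE => /andP[].
suffices EC : <<[set x in E | d x == x]>> = E.
  have d1 : d = 1.
    apply: (eq_Aut Ed (group1 _)) => x; rewrite -{1}EC (gen_set_id C_set) perm1 inE.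
    by case/andP=> _ /eqP.
  by move: q_pr; rewrite -od d1 order1.
apply: Phi_nongen; apply/eqP; rewrite eqEsubset join_subG Phi_sub sCE /=.
apply/subsetP=> x Ex.
have sX : [acts <[d]>, on x *: 'Phi(E) | 'P].
  rewrite cycle_subG !inE; apply/subsetP=> _ /lcosetP[y Py ->]; rewrite inE /= apermE.
  have Ey := subsetP (Phi_sub E) y Py.
  rewrite mem_lcoset (AutM Ed) // mulgA groupM //; first exact: Phi_X.
  rewrite -(mulKVg y (d y)) groupM //; exact: Phi_X.
have qd : q.-group <[d]> by rewrite /pgroup -orderE od pnat_id.
have := pgroup_fix_mod qd sX; rewrite card_lcoset => fixE.
have /set0Pn[z] : 'Fix_(x *: 'Phi(E) | 'P)(<[d]>) != set0.
  apply/eqP=> F0; move: fixE; rewrite F0 cards0 mod0n => /eqP qPhi.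
  case/negP: npq; have pPhi := pgroupS (Phi_sub E) pE.
  by apply: (pnatPpi pPhi); rewrite mem_primes q_pr cardG_gt0.
case/setIP=> /lcosetP[y Py Ez] /afixP fz.
have Ey := subsetP (Phi_sub E) y Py.
rewrite -(mulgK y x) -Ez; apply: groupM; last by rewrite groupV (subsetP (joing_subl _ _)).
apply: (subsetP (joing_subr _ _)); rewrite inE Ez groupM //= -Ez.
by apply/eqP; exact: fz (cycle_id d).
Qed.

Section FrattiniMatrices.
Variables (gT : finGroupType) (p : nat) (F : fieldType) (n : nat) (E : {group gT}).
Hypothesis pE : p.-group E.
Hypothesis natF : forall a : F, exists k : nat, a = (k%:R)%R.
Variable phi : gT -> 'rV[F]_n.
Hypothesis phiM : {in E &, forall x y, phi (x * y) = (phi x + phi y)%R}.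
Hypothesis phi0 : forall x, x \in E -> (phi x == 0%R) = (x \in 'Phi(E)).
Hypothesis phi_onto : forall v, exists2 x, x \in E & phi x = v.

Let phi1 : phi 1 = 0%R.
Proof. by apply/eqP; rewrite phi0 ?group1. Qed.

Lemma phiV x : x \in E -> phi x^-1 = (- phi x)%R.
Proof. by move=> Ex; apply/eqP; rewrite -addr_eq0 -phiM ?groupV // mulVg phi1. Qed.

Lemma phiX x k : x \in E -> phi (x ^+ k) = (k%:R *: phi x)%R.
Proof.
move=> Ex; elim: k => [|k IH]; first by rewrite scale0r.
by rewrite expgSr phiM ?groupX // IH -natr1 scalerDl scale1r.
Qed.

Lemma phi_eq x y : x \in E -> y \in E -> phi x = phi y -> x^-1 * y \in 'Phi(E).
Proof.
by move=> Ex Ey e; rewrite -phi0 ?groupM ?groupV // phiM ?groupV // phiV // e addNr.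
Qed.

Definition phi_lift v := odflt 1 [pick x in E | phi x == v].

Lemma phi_liftP v : phi_lift v \in E /\ phi (phi_lift v) = v.
Proof.
rewrite /phi_lift; case: pickP => [x /andP[Ex /eqP] | no] //=.
by have [x Ex /eqP ev] := phi_onto v; have := no x; rewrite Ex ev.
Qed.

Definition aut_mx (a : {perm gT}) : 'M[F]_n := (\matrix_i phi (a (phi_lift (delta_mx 0 i))))%R.

(** The chosen lifts do not matter since [a] preserves Phi(E), and additivity gives linearity by
    [natF]. *)
Lemma phi_aut a x : a \in Aut E -> x \in E -> phi (a x) = (phi x *m aut_mx a)%R.
Proof.
move=> Ea; pose f v := phi (a (phi_lift v)).
have Elift v : phi_lift v \in E by case: (phi_liftP v).
have wd y z : y \in E -> z \in E -> phi y = phi z -> phi (a y) = phi (a z).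
  move=> Ey Ez /(phi_eq Ey Ez) e; have Pz : a (y^-1 * z) \in 'Phi(E).
    by rewrite -(Aut_char (Phi_char E) Ea) imset_f.
  have Eyz : y^-1 * z \in E by rewrite groupM ?groupV.
  rewrite -(mulKVg y z) (AutM Ea) // phiM ?Aut_mem //.
  by move: Pz; rewrite -phi0 ?Aut_mem // => /eqP->; rewrite addr0.
have phi_f y : y \in E -> phi (a y) = f (phi y).
  by move=> Ey; apply: wd => //; case: (phi_liftP (phi y)).
have fD : {morph f : v w / (v + w)%R}.
  move=> v w; have [[Ev {1}<-] [Ew {1}<-]] := (phi_liftP v, phi_liftP w).
  by rewrite -phiM // -phi_f ?groupM // (AutM Ea) // phiM ?Aut_mem.
have f0 : f 0%R = 0%R by apply: (addrI (f 0%R)); rewrite -fD !addr0.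
have fZ c v : f (c *: v)%R = (c *: f v)%R.
  have [k ->] := natF c; elim: k => [|k IH]; first by rewrite !scale0r.
  by rewrite -natr1 !scalerDl !scale1r fD IH.
move=> Ex; rewrite phi_f // {1}[phi x]row_sum_delta (big_morph f fD f0) mulmx_sum_row.
by apply: eq_bigr => i _; rewrite fZ rowK.
Qed.

Lemma aut_mxP a M : a \in Aut E -> (forall x, x \in E -> phi (a x) = (phi x *m M)%R) -> aut_mx a = M.
Proof.
move=> Ea EM; apply/row_matrixP=> i; rewrite !rowE.
by have [x Ex <-] := phi_onto (delta_mx 0%R i); rewrite -phi_aut // EM.
Qed.

Lemma aut_mxM : {in Aut E &, forall a b, aut_mx (a * b) = (aut_mx a *m aut_mx b)%R}.
Proof.
move=> a b Ea Eb; apply: aut_mxP => [|x Ex]; first exact: groupM.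
by rewrite permM !phi_aut ?Aut_mem // mulmxA.
Qed.

Lemma aut_mx_kernel a : a \in Aut E ->
  (aut_mx a == 1%:M)%R = [forall x in E, x^-1 * a x \in 'Phi(E)].
Proof.
move=> Ea; apply/eqP/forall_inP=> [E1 x Ex | aPhi].
  by apply: phi_eq; rewrite ?Aut_mem // phi_aut // E1 mulmx1.
apply: aut_mxP => // x Ex; rewrite mulmx1 -{1}(mulKVg x (a x)) phiM ?groupM ?groupV ?Aut_mem //.
by have := aPhi x Ex; rewrite -phi0 ?groupM ?groupV ?Aut_mem // => /eqP->; rewrite addr0.
Qed.

Section OuterRep.
Variable A : {group {perm gT}}.
Hypotheses (sAE : A \subset Aut E) (sIA : Inn E \subset A) (p_pr : prime p).
Hypothesis speO : has_strongly_p_embedded p (A / Inn E).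

Lemma Inn_conj a x : a \in Inn E -> x \in E -> exists2 y, y \in E & a x = x ^ y.
Proof.
by case/morphimP=> y _ Ey -> Ex; exists y => //; rewrite norm_conj_autE // (subsetP (normG E)).
Qed.

Lemma aut_mx_Inn a : a \in Inn E -> aut_mx a = 1%:M%R.
Proof.
move=> Ia; have Ea := subsetP sAE a (subsetP sIA a Ia).
apply/eqP; rewrite aut_mx_kernel //; apply/forall_inP=> x Ex.
have [y Ey ->] := Inn_conj Ia Ex; rewrite -/(commg x y).
by rewrite (subsetP (der1_sub_Phi pE)) // mem_commg.
Qed.

Lemma Inn_normal : Inn E <| A.
Proof.
rewrite /normal sIA; apply/subsetP=> a Aa; have Ea := subsetP sAE a Aa.
rewrite inE; apply/subsetP=> _ /imsetP[b Ib ->].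
have [y Ny Ey Eb] := morphimP Ib.
have -> : b ^ a = conj_aut E (a y); last first.
  by apply: mem_morphim; rewrite ?(subsetP (normG E)) ?Aut_mem.
have Eba : b \in Aut E by apply: (subsetP sAE); apply: (subsetP sIA).
have Nay : a y \in 'N(E) by rewrite (subsetP (normG E)) ?Aut_mem.
apply: (eq_Aut (A := E)); rewrite ?groupJ ?Aut_aut // => x Ex.
have Ex' : (a^-1)%g x \in E by rewrite Aut_mem ?groupV.
rewrite norm_conj_autE // conjgE mulgA !permM Eb norm_conj_autE // -!(autmE Ea).
by rewrite morphJ //= !autmE -permM mulVg perm1.
Qed.

Definition out_mx (x : coset_of (Inn E)) := aut_mx (repr x).

Lemma out_mxE a : a \in A -> out_mx (coset (Inn E) a) = aut_mx a.
Proof.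
move=> Aa; have Na := subsetP (normal_norm Inn_normal) a Aa.
have : repr (coset (Inn E) a) \in Inn E :* a by rewrite -val_coset // mem_repr_coset.
case/rcosetP=> b Ib E1; rewrite /out_mx E1 aut_mxM ?(subsetP sAE) //; last exact: (subsetP sIA).
by rewrite aut_mx_Inn // mul1mx.
Qed.

(** The kernel on [A] is a p-group by [Aut_trivial_mod_Phi], so its image modulo [Inn E] is a normal
    p-subgroup, trivial by [spe_pcore_trivial]. *)
Lemma out_mx_faithful : faithful_rep (A / Inn E) out_mx.
Proof.
have nI := normal_norm Inn_normal.
pose K := [set a in A | aut_mx a == 1%:M%R].
have K_set : group_set K.
  apply/group_setP; split=> [|a b]; rewrite !inE; first by rewrite group1 aut_mx_Inn ?group1 ?eqxx.
  case/andP=> Aa /eqP a1 /andP[Ab /eqP b1].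
  by rewrite groupM // aut_mxM ?(subsetP sAE) // a1 b1 mulmx1 eqxx.
pose KG := Group K_set.
have pK : p.-group KG.
  apply/pgroupP => q q_pr /Cauchy[] // a; rewrite inE => /andP[Aa].
  have Ea := subsetP sAE a Aa; rewrite aut_mx_kernel // => /forall_inP aPhi oa.
  have := Aut_trivial_mod_Phi pE Ea aPhi; rewrite /p_elt oa.
  by rewrite pnatE.
have sKI : KG \subset Inn E.
  have nK : KG / Inn E <| A / Inn E.
    apply: quotient_normal; rewrite /normal; apply/andP; split.
      by apply/subsetP=> a; rewrite inE => /andP[].
    apply/subsetP=> b Ab; rewrite inE; apply/subsetP=> _ /imsetP[a + ->].
    rewrite !inE => /andP[Aa /eqP a1]; rewrite groupJ //=.
    have [Ea Eb] := (subsetP sAE a Aa, subsetP sAE b Ab).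
    rewrite conjgE !aut_mxM ?groupM ?groupV // a1 mul1mx -aut_mxM ?groupV // mulVg.
    by rewrite aut_mx_Inn ?group1.
  have [H speH] := speO.
  have := spe_pcore_trivial p_pr speH nK (quotient_pgroup _ pK).
  move/eqP; rewrite -subG1 quotient_sub1 //.
  by apply: subset_trans nI; apply/subsetP=> a; rewrite inE => /andP[].
split=> [|_ _ /morphimP[a Na Aa ->] /morphimP[b Nb Ab ->]|].
- by rewrite -(morph1 (coset_morphism (Inn E))) out_mxE ?group1 // aut_mx_Inn ?group1.
- by rewrite -morphM //= !out_mxE ?groupM // aut_mxM ?(subsetP sAE).
move=> _ _ /morphimP[a Na Aa ->] /morphimP[b Nb Ab ->]; rewrite !out_mxE // => e.
have [Ea Eb] := (subsetP sAE a Aa, subsetP sAE b Ab).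
apply/eqP; rewrite eq_mulgV1 -morphV // -morphM ?groupV //=; apply/eqP/coset_id.
apply: (subsetP sKI); rewrite inE groupM ?groupV //= aut_mxM ?groupV // e -aut_mxM ?groupV //.
by rewrite mulgV aut_mx_Inn ?group1.
Qed.

End OuterRep.

End FrattiniMatrices.

Definition frattini_rep (gT : finGroupType) (F : fieldType) n (E : {group gT}) (A : {set {perm gT}})
    (phi : gT -> 'rV[F]_n) (rho : coset_of (Inn E) -> 'M[F]_n) :=
  [/\ {in E &, forall x y, phi (x * y) = (phi x + phi y)%R},
      forall x, x \in E -> (phi x == 0%R) = (x \in 'Phi(E)),
      forall v, exists2 x, x \in E & phi x = v,
      faithful_rep (A / Inn E) rho
    & forall a x, a \in A -> x \in E -> phi (a x) = (phi x *m rho (coset (Inn E) a))%R].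

Lemma Fp_natF p (a : 'F_p) : exists k : nat, a = (k%:R)%R.
Proof. by exists a; rewrite natr_Zp. Qed.

Lemma frattini_rep_exists (gT : finGroupType) (p : nat) (E : {group gT}) (A : {group {perm gT}}) :
  prime p -> p.-group E -> A \subset Aut E -> Inn E \subset A ->
  has_strongly_p_embedded p (A / Inn E) ->
  exists n phi rho, @frattini_rep gT 'F_p n.+1 E A phi rho /\ #|E : 'Phi(E)| = (p ^ n.+1)%N.
Proof.
move=> p_pr pE sAE sIA spe.
have nPhi := normal_norm (Phi_normal E).
(* Nontriviality of [E] is what lets the dimension be a successor. *)
have ntE : E :!=: 1.
  apply/eqP=> E1; have [x [Ox _ /eqP[]]] := spe_p_elt p_pr spe.
  case/morphimP: Ox => a Na Aa ->; apply: coset_id.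
  suffices -> : a = 1 by apply: group1.
  apply: (eq_Aut (A := E)); rewrite ?(subsetP sAE) ?group1 // => y.
  rewrite E1 => /set1P->; rewrite perm1 -(autmE (subsetP sAE a Aa)).
  by rewrite morph1.
have ntV : E / 'Phi(E) != 1.
  rewrite -subG1 quotient_sub1 //; have := Phi_proper ntE.
  by rewrite properE => /andP[].
have abV := Phi_quotient_abelem pE.
pose phi x := abelem_rV abV ntV (coset 'Phi(E) x).
have Vx x : x \in E -> coset 'Phi(E) x \in E / 'Phi(E) by apply: mem_quotient.
have phiM : {in E &, forall x y, phi (x * y) = (phi x + phi y)%R}.
  move=> x y Ex Ey; have [Nx Ny] := (subsetP nPhi x Ex, subsetP nPhi y Ey).
  by rewrite /phi morphM // abelem_rV_M ?Vx.
have phi0 x : x \in E -> (phi x == 0%R) = (x \in 'Phi(E)).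
  move=> Ex; have Nx := subsetP nPhi x Ex.
  rewrite -[0%R](abelem_rV_1 abV ntV) (inj_in_eq (@abelem_rV_inj _ _ _ abV ntV)) ?group1 ?Vx //.
  apply/eqP/idP => [|Px]; [exact: coset_idr | exact: coset_id].
have onto v : exists2 x, x \in E & phi x = v.
  have := mem_rVabelem abV ntV v; case/morphimP=> x Nx Ex e; exists x => //.
  by rewrite /phi -e rVabelemK.
exists (abelem_dim' (E / 'Phi(E))), phi, (out_mx phi (E := E)); split.
  split=> //; first exact: (out_mx_faithful pE (@Fp_natF p) phiM phi0 onto sAE sIA p_pr spe).
  move=> a x Aa Ex; rewrite (out_mxE pE (@Fp_natF p) phiM phi0 onto sAE sIA) //.
  by rewrite (phi_aut (@Fp_natF p) phiM phi0 onto) // (subsetP sAE).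
rewrite (dim_abelemE abV ntV) -card_quotient // -p_part part_pnat_id //.
exact: abelem_pgroup abV.
Qed.

(** * The alternative between transvections and regularity, and the index of [E] *)

Section Dichotomy.
Variables (p : nat) (F : fieldType) (aT rT : finGroupType) (D : {group aT}) (O : {group rT}).
Hypotheses (p_pr : prime p) (charF : p \in [pchar F]%R) (F2 : (2%:R != 0 :> F)%R).
Hypothesis natF : forall a : F, exists k : nat, a = (k%:R)%R.
Variable val : aT -> 'M[F]_2.
Hypotheses (fval : faithful_rep D val) (detD : forall x, x \in D -> (\det (val x) = 1)%R).
Hypothesis onD : forall A, (\det A = 1)%R -> mxG val D A.
Hypothesis spe : has_strongly_p_embedded p O.

Lemma rep1_no_spe (rho : rT -> 'M[F]_1) : ~ faithful_rep O rho.
Proof.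
move=> frho; have [x [Ox px /eqP[]]] := spe_p_elt p_pr spe.
have := p_elt_unipotent charF frho Ox px; rewrite expr1 => /eqP; rewrite subr_eq0 => /eqP e.
by apply: (rep_inj frho); rewrite ?group1 // (rep1 frho) e.
Qed.

Lemma rep3_dichotomy (rho : rT -> 'M[F]_3) : faithful_rep O rho ->
  Opprime p O \isog D \/ no_transvection O rho.
Proof.
move=> frho.
have [/exists_inP[x Ox /andP[/eqP N2 ntx]] | /exists_inPn no] :=
  boolP [exists x in O, ((rho x - 1) *m (rho x - 1) == 0)%R && (x != 1)].
  left; have [rho' [frho' toA ofA]] := transvection_Opprime p_pr charF natF frho spe Ox ntx N2.
  by apply: (pad_isog fval frho') => //; apply: Opprime_sub.
by right=> x Ox N2; apply/eqP; move: (no x Ox); rewrite N2 eqxx negbK.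
Qed.

(** Unipotent 2 x 2 matrices g satisfy (g - 1)^2 = 0, so after padding to dimension 3 the regular
    alternative cannot occur. *)
Lemma rep2_Opprime (rho : rT -> 'M[F]_2) : faithful_rep O rho -> Opprime p O \isog D.
Proof.
move=> frho; have frho' : faithful_rep O (fun x => pad (rho x)).
  split=> [|x y Ox Oy|x y Ox Oy /pad_inj]; first by rewrite (rep1 frho) pad1.
    by rewrite (repM frho) ?padM.
  exact: (rep_inj frho).
have [//|ntv] := rep3_dichotomy frho'.
have [x [Ox px /eqP[]]] := spe_p_elt p_pr spe; apply: ntv => //.
have := p_elt_unipotent charF frho Ox px.
have [a [b [c [d ->]]]] := mx2P (rho x).
have -> : (mx2 a b c d - 1 = mx2 (a - 1) b c (d - 1) :> 'M[F]_2)%R.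
  by rewrite -[1%R]/(1%:M)%R mx2_1; apply/matrixP=> i j; rewrite !mxE; case: i j => [[|[|i]] hi] [[|[|j]] hj] //=; rewrite ?subr0.
rewrite expr2 -[(_ * _)%R]/(_ *m _)%R mx2M => /matrixP N0.
have [e1 e2 e3 e4] : [/\ (a - 1) * (a - 1) + b * c = 0, (a - 1) * b + b * (d - 1) = 0,
  c * (a - 1) + (d - 1) * c = 0 & c * b + (d - 1) * (d - 1) = 0]%R.
  split; [move: (N0 ord0 ord0) | move: (N0 ord0 (lift ord0 ord0))
         | move: (N0 (lift ord0 ord0) ord0) | move: (N0 (lift ord0 ord0) (lift ord0 ord0))]; by rewrite !mxE.
rewrite pad_mx2 mx3_oner mx3N mx3D mx3M mx3_0; congr mx3; rewrite ?(subrr, subr0, mulr0, mul0r, addr0, add0r) //.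
Qed.

End Dichotomy.

(** A nontrivial p-subgroup centralises some [z] in its centre, hence lies in the cyclic group of
    [z], which has order p. *)
Lemma no_transvection_card (p : nat) (F : fieldType) (rT : finGroupType) (O Q : {group rT}) (rho : rT -> 'M[F]_3) :
  prime p -> p \in [pchar F]%R -> (forall a : F, exists k : nat, a = k%:R)%R -> (2%:R != 0 :> F)%R -> faithful_rep O rho -> no_transvection O rho ->
  Q \subset O -> p.-group Q -> #|Q| %| p.
Proof.
move=> p_pr charF natF F2 frho ntv sQO pQ; have [->|ntQ] := eqVneq (Q : {set rT}) 1; first by rewrite cards1.
have : 'Z(Q) != 1 by rewrite center_nil_eq1 // (pgroup_nil pQ).
case/trivgPn=> z /centerP[Qz cz] ntz.
have Oz := subsetP sQO z Qz; have pz := mem_p_elt pQ Qz.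
have sQz : Q \subset <[z]>.
  apply/subsetP=> y Qy; have Oy := subsetP sQO y Qy.
  by apply: (centralizer_cycle charF natF F2 frho ntv) => //; [exact: mem_p_elt pQ Qy | exact: cz].
apply: dvdn_trans (cardSg sQz) _; rewrite -orderE order_dvdn.
by rewrite (p_elt_expp charF _ frho ntv).
Qed.

(** The order p (p - 1)^2 (p + 1) of GL_2(p) has p-part p. *)
Lemma SL2_card_pgroup p : prime p ->
  forall Q : {group {'GL_2['F_p]}}, Q \subset SL2 p -> p.-group Q -> #|Q| %| p.
Proof.
move=> p_pr Q _ pQ; have [k oQ] := p_natP pQ.
have : #|Q| %| #|'GL_2['F_p]| by apply: cardSg; apply: subsetT.
rewrite card_GL_2 card_Fp // oQ => dk; suffices: p ^ k %| p ^ 1 by rewrite expn1.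
have p_gt1 := prime_gt1 p_pr; have p_gt0 := prime_gt0 p_pr.
have pp1 : 0 < p.-1 by rewrite -subn1 subn_gt0.
apply: dvdn_exp2l; move: dk; rewrite pfactor_dvdn ?muln_gt0 ?expn_gt0 ?p_gt0 ?pp1 //.
rewrite !lognM ?muln_gt0 ?expn_gt0 ?p_gt0 ?pp1 // logn_prime // eqxx !(@ltn_log0 p p.-1) ?prednK //.
rewrite !addn0 (logn_coprime (m := p.+1)) ?addn0 //.
by rewrite coprimenS.
Qed.

(** What is used of the fusion system at [E]: [B] and [A] stand for Aut_F(S) and Aut_F(E), and
    [conj_aut E @* S] is Aut_S(E). [local_restr] comes from [E] being characteristic, [local_ext]
    from the extension axiom. *)
Record local_data (gT : finGroupType) (p : nat) (S : {group gT}) (B : {set {perm gT}})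
    (E : {group gT}) (A : {set {perm gT}}) : Prop := LocalData {
  local_normal : E <| S;
  local_cent : 'C_S(E) \subset E;
  local_Aut : A \subset Aut E;
  local_Sylow : p.-Sylow(A) (conj_aut E @* S);
  local_spe : has_strongly_p_embedded p (A / Inn E);
  local_restr : forall b, b \in B -> exists2 a, a \in A & {in E, a =1 b};
  local_ext : forall a, a \in A -> a \in 'N(conj_aut E @* S) -> exists2 b, b \in B & {in E, b =1 a} }.

Lemma normal_commgl (gT : finGroupType) (S E : {group gT}) x e :
  E <| S -> x \in E -> e \in S -> [~ x, e] \in E.
Proof.
case/andP=> _ nES Ex Se; apply: (subsetP (_ : [~: E, S] \subset E)); last exact: mem_commg.
by rewrite commg_subl.
Qed.

Section OneSubgroup.
Variables (gT : finGroupType) (p : nat) (S : {group gT}) (B A : {group {perm gT}}) (E : {group gT}).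
Hypotheses (p_pr : prime p) (pS : p.-group S) (loc : local_data p S B E A).

Let sES : E \subset S := normal_sub (local_normal loc).
Let nES : S \subset 'N(E) := normal_norm (local_normal loc).
Let pE : p.-group E := pgroupS sES pS.
Let sAE := local_Aut loc.

Lemma local_conj e : e \in S -> conj_aut E e \in A.
Proof.
move=> Se; apply: (subsetP (pHall_sub (local_Sylow loc))).
by apply: mem_morphim; rewrite ?(subsetP nES).
Qed.

Lemma local_conjE e x : e \in S -> x \in E -> conj_aut E e x = x ^ e.
Proof. by move=> Se Ex; rewrite norm_conj_autE // (subsetP nES). Qed.

Lemma local_Inn : Inn E \subset A.
Proof. by apply: subset_trans (pHall_sub (local_Sylow loc)); apply: morphimS. Qed.

Let nI := Inn_normal sAE local_Inn.

Lemma local_conj_Inn e : e \in S -> (conj_aut E e \in Inn E) = (e \in E).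
Proof.
move=> Se; apply/idP/idP=> [|Ee]; last by apply: mem_morphim; rewrite ?(subsetP (normG E)).
case/morphimP=> y Ny Ey ec; have Sy := subsetP sES y Ey.
rewrite -(mulgKV y e) groupM //; apply: (subsetP (local_cent loc)).
rewrite inE groupM ?groupV //=; apply/centP=> x Ex; apply/commute_sym/commgP/conjg_fixP.
have Exy : x ^ y^-1 \in E by rewrite groupJ ?groupV.
have: conj_aut E e x = conj_aut E y x by rewrite ec.
by rewrite !local_conjE // conjgM => ->; rewrite conjgK.
Qed.

Lemma local_coset_conj e : e \in S -> (coset (Inn E) (conj_aut E e) == 1) = (e \in E).
Proof.
move=> Se; rewrite -local_conj_Inn //; apply/eqP/idP=> [|I]; last exact: coset_id.
by apply: coset_idr; rewrite (subsetP (normal_norm nI)) ?local_conj.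
Qed.

(** Since C_S(E) lies in [E], S / E is isomorphic to a Sylow p-subgroup of the outer group,
    nontrivial because that group has nontrivial p-elements. *)
Lemma local_index : (forall Q : {group coset_of (Inn E)}, Q \subset A / Inn E -> p.-group Q -> #|Q| %| p) ->
  #|S : E| = p.
Proof.
move=> leQ; have sylP := quotient_pHall (_ : _ \subset 'N(Inn E)) (local_Sylow loc).
have sSA := pHall_sub (local_Sylow loc).
have {}sylP := sylP (subset_trans sSA (normal_norm nI)).
have -> : #|S : E| = #|conj_aut E @* S / Inn E|.
  rewrite card_quotient ?(subset_trans sSA (normal_norm nI)) //.
  rewrite -(index_morphim_ker (conj_aut_morphism E) sES nES).
  have -> : #|'ker_S (conj_aut E) : E| = 1%N; last by rewrite muln1.
  apply/eqP; rewrite indexg_eq1; apply: subset_trans (local_cent loc).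
  by apply: setIS; have := ker_conj_aut E; rewrite /= => ->.
have [sPO pP _] := and3P sylP.
have dP := leQ (conj_aut E @* S / Inn E)%G sPO pP.
have [x [Ox px ntx]] := spe_p_elt p_pr (local_spe loc).
have pdP : p %| #|conj_aut E @* S / Inn E|.
  have sxO : <[x]> \subset A / Inn E by rewrite cycle_subG.
  have [Q sylQ sxQ] := Sylow_superset sxO (px : p.-group <[x]>).
  rewrite (card_Hall sylP) -(card_Hall sylQ).
  by apply: dvdn_trans (p_elt_dvd_order px ntx) _; rewrite order_dvdG // -cycle_subG.
by apply/eqP; rewrite eqn_dvd dP pdP.
Qed.

Variables (F : fieldType) (phi : gT -> 'rV[F]_3) (rho : coset_of (Inn E) -> 'M[F]_3).
Hypotheses (charF : p \in [pchar F]%R) (F2 : (2%:R != 0 :> F)%R).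
Hypothesis natF : forall a : F, exists k : nat, a = (k%:R)%R.
Hypothesis fr : frattini_rep A phi rho.
Hypothesis ntv : no_transvection (A / Inn E) rho.

Lemma phi_commg x e : x \in E -> e \in S ->
  phi [~ x, e] = (phi x *m (rho (coset (Inn E) (conj_aut E e)) - 1))%R.
Proof.
case: fr => phiM phi0 _ _ phiA Ex Se.
rewrite commgEl phiM ?groupV // ?(memJ_norm _ (subsetP nES e Se)) //.
rewrite (phiV phiM phi0) // -local_conjE // phiA ?local_conj //.
by rewrite mulmxBr mulmx1 addrC.
Qed.

Lemma local_p_elt e : e \in S -> p.-elt (coset (Inn E) (conj_aut E e)).
Proof.
move=> Se; apply: morph_p_elt; first by rewrite (subsetP (normal_norm nI)) ?local_conj.
by apply: morph_p_elt; rewrite ?(subsetP nES) // (mem_p_elt pS).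
Qed.

Lemma local_coset e : e \in S -> coset (Inn E) (conj_aut E e) \in A / Inn E.
Proof. by move=> Se; rewrite mem_quotient ?local_conj. Qed.

(** Commutation with [e] acts on E / Phi(E) as rho u - 1, for [u] the class of [e], and its square
    is nonzero by regularity. *)
Lemma regular_commg e : e \in S -> e \notin E ->
  exists2 x, x \in E & [~ x, e, e] \notin 'Phi(E).
Proof.
move=> Se nEe; case: (fr) => phiM phi0 onto frho _.
have ntu : coset (Inn E) (conj_aut E e) != 1 by rewrite local_coset_conj.
have [_ [v nz]] := p_elt_regular charF frho ntv (local_coset Se) (local_p_elt Se) ntu.
have [x Ex ev] := onto v; exists x => //.
have nE := local_normal loc; have Exe := normal_commgl nE Ex Se.
by rewrite -phi0 ?(normal_commgl nE) // !phi_commg // ev -mulmxA.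
Qed.

Lemma regular_irreducible : irreducible_mod_Phi A E.
Proof.
move=> N sNE invN; case: (fr) => phiM phi0 onto frho phiA.
have [sNP|] := boolP (N \subset 'Phi(E)); [by right | case/subsetPn=> x0 Nx0 nPx0; left].
pose X v := exists2 x, x \in N & phi x = v.
have allX : forall v, X v.
  apply: (no_transvection_irreducible p_pr charF natF F2 frho ntv (local_spe loc)).
  - move=> _ _ [x Nx <-] [y Ny <-]; exists (x * y); first exact: groupM.
    by rewrite phiM ?(subsetP sNE).
  - move=> a _ [x Nx <-]; have [k ->] := natF a; exists (x ^+ k); first exact: groupX.
    by rewrite (phiX phiM phi0) ?(subsetP sNE).
  - move=> _ _ /morphimP[a Na Aa ->] [x Nx <-]; exists (a x).
      by rewrite -(invN a Aa) imset_f.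
    by rewrite phiA ?(subsetP sNE).
  exists (phi x0); last by exists x0.
  by rewrite phi0 ?(subsetP sNE).
have defE : 'Phi(E) <*> N = E.
  apply/eqP; rewrite eqEsubset join_subG Phi_sub sNE /=; apply/subsetP=> x Ex.
  have [y Ny e] := allX (phi x); have Ey := subsetP sNE y Ny.
  rewrite -(mulKVg y x); apply: groupM; first by rewrite (subsetP (joing_subr _ _)).
  by rewrite (subsetP (joing_subl _ _)) // (phi_eq phiM phi0).
by rewrite -[RHS](Phi_nongen defE) genGid.
Qed.

End OneSubgroup.

(** * Interaction of the two essential subgroups *)

Section TwoRegular.
Variables (gT : finGroupType) (p : nat) (S : {group gT}) (B A1 A2 : {group {perm gT}}) (E1 E2 : {group gT}).
Hypotheses (p_pr : prime p) (p_odd : odd p) (pS : p.-group S).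
Hypotheses (loc1 : local_data p S B E1 A1) (loc2 : local_data p S B E2 A2).
Hypotheses (rk1 : sect_rank_le E1 3) (rk2 : sect_rank_le E2 3).
Hypotheses (i1 : #|E1 : 'Phi(E1)| = (p ^ 3)%N) (i2 : #|E2 : 'Phi(E2)| = (p ^ 3)%N).
Hypotheses (n12 : ~~ (E1 \subset E2)) (n21 : ~~ (E2 \subset E1)).
Variables (F : fieldType).
Hypotheses (charF : p \in [pchar F]%R) (F2 : (2%:R != 0 :> F)%R).
Hypothesis natF : forall a : F, exists k : nat, a = (k%:R)%R.

(** Take [x, e, e] with [e] in the second subgroup only: [x, e] already lies there by normality, so
    the next commutator lies in its derived subgroup. *)
Lemma regular_cross (A A' : {group {perm gT}}) (E E' : {group gT}) phi rho :
  local_data p S B E A -> local_data p S B E' A' ->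
  @frattini_rep _ F 3 E A phi rho -> no_transvection (A / Inn E) rho -> ~~ (E' \subset E) ->
  exists g, [/\ g \in E, g \notin 'Phi(E) & g \in 'Phi(E')].
Proof.
move=> loc loc' fr ntv /subsetPn[e E'e nEe].
have [[sES nES] [sES' nES']] := (andP (local_normal loc), andP (local_normal loc')).
have pE' := pgroupS sES' pS; have Se := subsetP sES' e E'e.
have [x Ex nP] := regular_commg pS loc charF fr ntv Se nEe.
have Sx := subsetP sES x Ex; exists [~ x, e, e]; split=> //.
  by do 2?[apply: (normal_commgl (local_normal loc)) => //].
rewrite (subsetP (der1_sub_Phi pE')) // mem_commg //.
by rewrite -invg_comm groupV (normal_commgl (local_normal loc')).
Qed.

Lemma two_regular_contra phi1 rho1 phi2 rho2 :
  @frattini_rep _ F 3 E1 A1 phi1 rho1 -> no_transvection (A1 / Inn E1) rho1 ->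
  @frattini_rep _ F 3 E2 A2 phi2 rho2 -> no_transvection (A2 / Inn E2) rho2 -> False.
Proof.
move=> fr1 ntv1 fr2 ntv2.
have [g [E1g nP1g P2g]] := regular_cross loc1 loc2 fr1 ntv1 n21.
have [h [E2h nP2h P1h]] := regular_cross loc2 loc1 fr2 ntv2 n12.
have ord (A : {group {perm gT}}) (E : {group gT}) phi rho : local_data p S B E A ->
  @frattini_rep _ F 3 E A phi rho -> no_transvection (A / Inn E) rho -> sect_rank_le E 3 ->
  #|E : 'Phi(E)| = (p ^ 3)%N -> forall x y, x \in E -> x \notin 'Phi(E) -> y \in 'Phi(E) -> #[y] < #[x].
  move=> loc fr ntv rk iE x y Ex nPx; have sAE := local_Aut loc.
  have inv : invariant_by A E by move=> a Aa; apply: Aut_imset_id; apply: (subsetP sAE).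
  have pE := pgroupS (normal_sub (local_normal loc)) pS.
  have irr := regular_irreducible p_pr loc charF F2 natF fr ntv.
  by have [_ /(_ y)] := order_Phi p_pr p_odd pE rk sAE (subxx _) inv irr iE Ex nPx.
have := ord _ _ _ _ loc1 fr1 ntv1 rk1 i1 g h E1g nP1g P1h.
by rewrite ltnNge ltnW // (ord _ _ _ _ loc2 fr2 ntv2 rk2 i2).
Qed.

End TwoRegular.

Lemma regular_image (F : fieldType) (M B : 'M[F]_3) : (2%:R != 0 :> F)%R -> B \in unitmx ->
  (B *m M *m invmx B = unip3 1)%R ->
  exists2 f : 'cV[F]_3, (f != 0)%R & forall v : 'rV_3, (v *m f = 0 -> exists w, v = w *m (M - 1))%R.
Proof.
move=> F2 uB EM; exists (invmx B *m (rv3 1 0 0)^T)%R.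
  apply/eqP=> /(congr1 (mulmx B)); rewrite mulmx0 mulKVmx // => /(congr1 trmx).
  by rewrite trmxK trmx0 => /matrixP/(_ ord0 ord0)/eqP; rewrite !mxE oner_eq0.
move=> v; rewrite mulmxA; set v' := (v *m invmx B)%R.
have [a [b [c Ev]]] := rv3P v'; rewrite Ev => /matrixP/(_ ord0 ord0).
rewrite !mxE !big_ord_recl big_ord0 !mxE /= !(mulr0, mulr1, addr0) => a0.
(* Read off from [rv3_unip3_sub1]: in the Jordan basis this vector is sent to (0, b, c). *)
exists (rv3 b (c - b / 2%:R) 0 *m B)%R; apply: (can_inj (mulmxK (_ : invmx B \in unitmx))).
  by rewrite unitmx_inv.
rewrite -/v' Ev mulmxBr mulmx1 mulmxBl mulmxK // -!mulmxA (mulmxA B) EM.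
have := rv3_unip3_sub1 F2 b (c - b / 2%:R)%R 0%R; rewrite scaleN1r => ->.
by rewrite a0; congr rv3; ring.
Qed.

Section Mixed.
Variables (gT : finGroupType) (p : nat) (S : {group gT}) (B A1 A2 : {group {perm gT}}) (E1 E2 : {group gT}).
Hypotheses (p_pr : prime p) (p_odd : odd p) (pS : p.-group S).
Hypotheses (loc1 : local_data p S B E1 A1) (loc2 : local_data p S B E2 A2).
Hypotheses (iS1 : #|S : E1| = p) (iS2 : #|S : E2| = p) (neqE : E1 :!=: E2).
Variables (F : fieldType).
Hypotheses (charF : p \in [pchar F]%R) (F2 : (2%:R != 0 :> F)%R).
Hypothesis natF : forall a : F, exists k : nat, a = (k%:R)%R.
Variables (phi : gT -> 'rV[F]_3) (rho : coset_of (Inn E1) -> 'M[F]_3).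
Hypotheses (fr : frattini_rep A1 phi rho) (ntv : no_transvection (A1 / Inn E1) rho).

Let nE1 := local_normal loc1.
Let nE2 := local_normal loc2.
Let sE1S : E1 \subset S := normal_sub nE1.
Let sE2S : E2 \subset S := normal_sub nE2.
Let p_gt0 := prime_gt0 p_pr.

Let oE1 : (#|E1| * p)%N = #|S|. Proof. by rewrite -{1}iS1 Lagrange. Qed.
Let oE2 : (#|E2| * p)%N = #|S|. Proof. by rewrite -{1}iS2 Lagrange. Qed.

Let oE12 : #|E1| = #|E2|.
Proof. by apply/eqP; rewrite -(eqn_pmul2r p_gt0) oE1 oE2. Qed.

Let nsub21 : ~~ (E2 \subset E1).
Proof. by apply: contra neqE => s21; rewrite eq_sym eqEcard s21 oE12 leqnn. Qed.

Let max1 : maximal E1 S. Proof. by apply: p_index_maximal; rewrite ?iS1. Qed.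
Let max2 : maximal E2 S. Proof. by apply: p_index_maximal; rewrite ?iS2. Qed.

(** Commutators with [e] fill a hyperplane of E1 / Phi(E1), so one element [x0] generates [E1]
    modulo Phi(S), and [e], [x0] generate [S]. A cyclic [S] would have only one subgroup of order
    |E1|. *)
Lemma mixed_grank : grank S = 2.
Proof.
rewrite grankE; apply/eqP; rewrite eqn_leq; apply/andP; split; last first.
  have [X genX <-] := grank_witness S; rewrite ltnNge; apply: contra neqE => X1.
  have cS : cyclic S.
    rewrite -genX; have [->|[x Xx]] := set_0Vmem X; first by rewrite gen0 cyclic1.
    suffices -> : X = [set x] by apply: cycle_cyclic.
    by apply/eqP; rewrite eq_sym eqEcard sub1set Xx cards1.
  by rewrite (eq_subG_cyclic cS) ?oE12.
have [e E2e nE1e] := subsetPn nsub21; have Se := subsetP sE2S e E2e.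
have ntu : coset (Inn E1) (conj_aut E1 e) != 1 by rewrite (local_coset_conj loc1).
have [phiM phi0 onto frho phiA] := fr.
have [C uC EC] := p_elt_normal_form charF frho ntv (local_coset loc1 Se) (local_p_elt pS loc1 Se) ntu.
have [f nzf fP] := regular_image F2 uC EC.
have sPhi1 : 'Phi(E1) \subset 'Phi(S) := PhiS pS sE1S.
have KPhi x : x \in E1 -> (phi x *m f = 0)%R -> x \in 'Phi(S).
  move=> Ex /fP[w Ew]; have [y Ey ey] := onto w.
  have Eye := normal_commgl nE1 Ey Se.
  rewrite -(mulKVg [~ y, e] x) groupM //.
    by rewrite (subsetP (der1_sub_Phi pS)) // mem_commg // (subsetP sE1S).
  rewrite (subsetP sPhi1) // (phi_eq phiM phi0) //.
  by rewrite (phi_commg loc1 fr) // ey.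
have [x0 Ex0 nz0] : exists2 x0, x0 \in E1 & ((phi x0 *m f) 0 0 != 0)%R.
  have [i nzi] : exists i, (f i 0 != 0)%R.
    apply/existsP; apply: contraR nzf => /existsPn no; apply/eqP/matrixP=> i j.
    by rewrite ord1 mxE; apply/eqP; move: (no i); rewrite negbK.
  have [x0 Ex0 e0] := onto (delta_mx 0 i)%R; exists x0 => //.
  by rewrite e0 -rowE mxE.
have decomp x : x \in E1 -> x \in 'Phi(S) <*> [set e; x0].
  move=> Ex; have [k Ek] := natF ((phi x *m f) 0 0 / (phi x0 *m f) 0 0)%R.
  have Ek' : ((phi x *m f) 0 0 = k%:R * (phi x0 *m f) 0 0)%R by rewrite -Ek divfK.
  rewrite -(mulgKV (x0 ^+ k) x) groupM //.
    apply: (subsetP (joing_subl _ _)); apply: KPhi; first by rewrite groupM ?groupV ?groupX.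
    apply/matrixP=> i j; rewrite !ord1 phiM ?groupV ?groupX // (phiV phiM phi0) ?groupX //.
    rewrite (phiX phiM phi0) // mulmxDl mulNmx -scalemxAl.
    by move: (phi x *m f)%R (phi x0 *m f)%R Ek' => U V EU; rewrite !mxE EU subrr.
  by rewrite groupX // (subsetP (joing_subr _ _)) // !inE eqxx orbT.
have sX : [set e; x0] \subset S by rewrite subUset !sub1set Se (subsetP sE1S).
have genX : <<[set e; x0]>> = S.
  apply: Phi_nongen; apply/eqP; rewrite eqEsubset join_subG Phi_sub sX /=.
  have ne : ~~ (<[e]> \subset E1) by rewrite cycle_subG.
  have seS : <[e]> \subset S by rewrite cycle_subG.
  rewrite -{1}(mulg_normal_maximal nE1 max1 seS ne) mul_subG ?cycle_subG //; first exact/subsetP.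
  by rewrite (subsetP (joing_subr _ _)) // !inE eqxx.
rewrite -{1}genX; apply: leq_trans (grank_min _) _.
by rewrite cards2; case: (_ == _).
Qed.

(** Both sides have index p^2: one because [S] has rank 2, the other as the intersection of two
    maximal subgroups with product [S]. *)
Lemma mixed_Phi : E1 :&: E2 = 'Phi(S).
Proof.
apply/eqP; rewrite eq_sym eqEcard subsetI !Phi_sub_max //=.
have iPhi : #|S : 'Phi(S)| = (p ^ 2)%N.
  have := pgroup_grank pS; rewrite -grankE mixed_grank.
  have /p_natP[k ->] : p.-nat #|S : 'Phi(S)| by apply: pnat_dvd (dvdn_indexg _ _) pS.
  by rewrite pfactorK // => <-.
have s12 : E1 * E2 = S by apply: mulg_normal_maximal.
have := mul_cardG E1 E2; rewrite s12 => o12.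
have := Lagrange (Phi_sub S); rewrite iPhi => oPhi.
rewrite -(leq_pmul2r (_ : 0 < p ^ 2)) ?expn_gt0 ?p_gt0 // oPhi.
by rewrite -(leq_pmul2l (cardG_gt0 S)) mulnA -o12 mulnACA oE1 oE2.
Qed.

End Mixed.

(** * Lifting the central involution of the outer group to an automorphism of [S] *)

Lemma expg_odd_involution (gT : finGroupType) (a : gT) m : odd m -> a * a = 1 -> a ^+ m = a.
Proof.
move=> m_odd a2; rewrite -[m]odd_double_half m_odd expgS -muln2 mulnC expgM expgS expg1 a2.
by rewrite expg1n mulg1.
Qed.

Section LiftInvolution.
Variables (gT : finGroupType) (p : nat) (S : {group gT}) (B A : {group {perm gT}}) (E : {group gT}).
Hypotheses (p_pr : prime p) (p_odd : odd p) (pS : p.-group S) (sBS : B \subset Aut S).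
Hypothesis loc : local_data p S B E A.
Variable t : coset_of (Inn E).
Hypotheses (Ot : t \in 'Z(Opprime p (A / Inn E))) (t2 : t * t = 1) (ntt : t != 1).

Let nES := local_normal loc.
Let sES := normal_sub nES.
Let sAE := local_Aut loc.
Let pE := pgroupS sES pS.
Let sIA := local_Inn loc.
Let nI := normal_norm (Inn_normal sAE sIA).

Let sOO : Opprime p (A / Inn E) \subset A / Inn E.
Proof. exact: Opprime_sub. Qed.

Lemma local_conj_eq x y : x \in S -> y \in S -> conj_aut E x = conj_aut E y -> x^-1 * y \in E.
Proof.
have nS : S \subset 'N(E) := normal_norm nES.
move=> Sx Sy e; rewrite -(local_conj_Inn loc) ?groupM ?groupV //.
rewrite (morphM (conj_aut_morphism E)) ?groupV ?(subsetP nS) //.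
by rewrite (morphV (conj_aut_morphism E)) ?(subsetP nS) //= e mulVg group1.
Qed.

(** The square of a preimage lies in [Inn E]; raising the preimage to the odd power |Inn E| kills
    this square and keeps the image [t]. *)
Lemma lift_involution : exists a, [/\ a \in A, a * a = 1 & coset (Inn E) a = t].
Proof.
have Ot' : t \in A / Inn E by apply: (subsetP sOO); apply: (subsetP (center_sub _)).
case/morphimP: Ot' => a Na Aa Et; have o : odd #|Inn E|.
  apply: odd_pgroup_odd p_odd _; exact: morphim_pgroup.
have Ia2 : a * a \in Inn E by apply: coset_idr; rewrite ?groupM // morphM //= -Et.
exists (a ^+ #|Inn E|); split; first exact: groupX.
  by rewrite -expgMn ?expg_cardG //; apply: commute_refl.
by rewrite morphX //= -Et expg_odd_involution.
Qed.

(** Classes of conjugations by [S] are p-elements of the outer group, so the central [t] commutes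
    with them. *)
Lemma lift_normalizes a : a \in A -> coset (Inn E) a = t -> 
  (forall s, s \in S -> exists2 y, y \in E & conj_aut E s ^ a = conj_aut E (s * y)).
Proof.
move=> Aa Et s Ss; have As := local_conj loc Ss.
have [Na Ns] := (subsetP nI a Aa, subsetP nI _ As).
have Os : coset (Inn E) (conj_aut E s) \in Opprime p (A / Inn E).
  by apply: mem_gen; rewrite inE (local_coset loc Ss) (local_p_elt pS loc Ss).
have cst : coset (Inn E) (conj_aut E s) ^ t = coset (Inn E) (conj_aut E s).
  by have /centerP[_ ct] := Ot; apply/conjg_fixP/commgP/commute_sym/ct.
have : (conj_aut E s)^-1 * conj_aut E s ^ a \in Inn E.
  apply: coset_idr; first by rewrite groupM ?groupV // groupJ.
  by rewrite morphM ?groupV ?groupJ //= morphV // morphJ //= Et cst mulVg.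
case/morphimP=> y Ny Ey e; exists y => //.
have nS : S \subset 'N(E) := normal_norm nES.
rewrite morphM //; last exact: (subsetP nS).
by apply: (mulgI (conj_aut E s)^-1); rewrite mulKg.
Qed.

Lemma lift_extend : exists b, [/\ b \in B, p^'.-elt b, b != 1,
  forall x, x \in S -> b (b x) = x & forall s, s \in S -> s^-1 * b s \in E].
Proof.
have [a [Aa a2 Ea]] := lift_involution.
have nS : S \subset 'N(E) := normal_norm nES.
have conjS := lift_normalizes Aa Ea.
have Na : a \in 'N(conj_aut E @* S).
  rewrite inE; apply/subsetP=> _ /imsetP[_ /morphimP[s Ns Ss ->] ->].
  have [y Ey ->] := conjS s Ss; have Sy := subsetP sES y Ey.
  by rewrite mem_morphim ?(subsetP nS) ?groupM.
have [b0 Bb0 Eb0] := local_ext loc Aa Na.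
have AE : a \in Aut E := subsetP sAE a Aa.
(* With m the p-part of the order, [b] has order prime to p; m is odd, so [b] still agrees on [E]
   with the involution [a]. *)
pose m := (#[b0]`_p)%N; pose b := b0 ^+ m.
have m_odd : odd m by rewrite /m p_part oddX p_odd orbT.
have b0X k x : x \in E -> (b0 ^+ k) x = (a ^+ k) x.
  move=> Ex; elim: k => [|k IH]; first by rewrite !perm1.
  by rewrite !expgSr !permM IH Eb0 // Aut_mem // groupX.
have Eb x : x \in E -> b x = a x by move=> Ex; rewrite b0X // expg_odd_involution.
have Bb : b \in B by apply: groupX.
have Sb : b \in Aut S := subsetP sBS b Bb.
have p'b : p^'.-elt b.
  rewrite /p_elt orderXdiv ?dvdn_part // -{1}[#[b0]](partnC p) // mulKn ?part_gt0 //.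
  exact: part_pnat.
have aK x : x \in E -> a (a x) = x by move=> Ex; rewrite -permM a2 perm1.
have bE s : s \in S -> s^-1 * b s \in E.
  move=> Ss; have [y Ey ey] := conjS s Ss; have Sy := subsetP sES y Ey.
  have Sbs : b s \in S by apply: Aut_mem.
  suffices e : conj_aut E (b s) = conj_aut E (s * y).
    have : (s * y)^-1 * b s \in E by apply: local_conj_eq; rewrite ?groupM.
    by rewrite invMg -mulgA groupMl ?groupV.
  rewrite -ey; apply: (eq_Aut (A := E)); rewrite ?Aut_aut ?groupJ ?Aut_aut // => x Ex.
  have Eax : a x \in E by apply: Aut_mem.
  have aV : a^-1 = a by apply/eqP; rewrite eq_invg_mul a2.
  rewrite conjgE aV !permM !(local_conjE loc) //.
  have Sax := subsetP sES _ Eax; have Sx := subsetP sES x Ex.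
  rewrite -Eb ?memJ_norm ?(subsetP nS) // conjgE !(AutM Sb) ?groupM ?groupV // (AutV Sb) //.
  by rewrite (Eb (a x)) // aK // conjgE mulgA.
exists b; split=> //.
  apply: contra ntt => /eqP b1; rewrite -Ea; suffices -> : a = 1 by rewrite morph1.
  by apply: (eq_Aut AE (group1 _)) => x Ex; rewrite -Eb // b1.
move=> s Ss; have Sbs : b s \in S by apply: Aut_mem.
(* The square of [b] fixes [E] pointwise, so its k-th power sends [s] to s w^k. The order of [w]
   therefore divides that of [b * b], prime to p, while [w] is a p-element. *)
pose w := s^-1 * b (b s).
have Ew : w \in E.
  by rewrite /w -(mulKVg (b s) (b (b s))) mulgA groupM // bE.
have bbX k : ((b * b) ^+ k) s = s * w ^+ k.
  elim: k => [|k IH]; first by rewrite perm1 mulg1.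
  rewrite expgSr permM IH permM !(AutM Sb) ?Aut_mem // ?(subsetP sES) ?groupX //.
  have -> : b (b (w ^+ k)) = w ^+ k by rewrite !Eb ?Aut_mem ?groupX // aK ?groupX.
  by rewrite expgS mulgA /w mulKVg.
have w1 : w ^+ #[b * b] = 1.
  by apply: (mulgI s); rewrite -bbX expg_order perm1 mulg1.
have w_eq1 : w == 1.
  rewrite -order_eq1; have pw : p.-nat #[w] := mem_p_elt pE Ew.
  have p'w : p^'.-nat #[w].
    apply: pnat_dvd (_ : #[w] %| #[b * b]) _; first by rewrite order_dvdn w1.
    by rewrite -expg2 -/(p_elt _ _) p_eltX.
  by rewrite (pnat_1 pw p'w).
by rewrite -{2}[s]mulg1 -(eqP w_eq1) /w mulKVg.
Qed.

End LiftInvolution.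

Lemma isog_central_involution (aT rT : finGroupType) (D : {group aT}) (G : {group rT}) :
  G \isog D -> (exists t, [/\ t \in 'Z(D), t != 1 & t * t = 1]) ->
  exists t, [/\ t \in 'Z(G), t != 1 & t * t = 1].
Proof.
rewrite isog_sym => /isogP[f injf <-] [t [/centerP[Dt ct] ntt t2]].
exists (f t); split.
- apply/centerP; split=> [|_ /morphimP[y Dy _ ->]]; first exact: mem_morphim.
  by rewrite /commute -!morphM // ct.
- by rewrite -(morph1 f) (inj_in_eq (injmP injf)).
by rewrite -morphM // t2 morph1.
Qed.

Section Mixed.
Variables (gT : finGroupType) (p : nat) (S : {group gT}) (B A1 A2 : {group {perm gT}}) (E1 E2 : {group gT}).
Hypotheses (p_pr : prime p) (p_odd : odd p) (pS : p.-group S) (sBS : B \subset Aut S).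
Hypotheses (loc1 : local_data p S B E1 A1) (loc2 : local_data p S B E2 A2).
Hypotheses (iS1 : #|S : E1| = p) (iS2 : #|S : E2| = p) (neqE : E1 :!=: E2).
Variables (F : fieldType) (aT : finGroupType) (D : {group aT}) (val : aT -> 'M[F]_2).
Hypotheses (charF : p \in [pchar F]%R) (F2 : (2%:R != 0 :> F)%R).
Hypothesis natF : forall a : F, exists k : nat, a = (k%:R)%R.
Hypotheses (fval : faithful_rep D val) (detD : forall x, x \in D -> (\det (val x) = 1)%R).
Hypothesis onD : forall A, (\det A = 1)%R -> mxG val D A.
Variables (phi : gT -> 'rV[F]_3) (rho : coset_of (Inn E1) -> 'M[F]_3).
Hypotheses (fr : frattini_rep A1 phi rho) (ntv : no_transvection (A1 / Inn E1) rho).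
Hypothesis iso2 : Opprime p (A2 / Inn E2) \isog D.

Lemma mixed_PSL2 : Opprime p (A1 / Inn E1) \isog D / 'Z(D).
Proof.
have [t [Zt ntt t2]] := isog_central_involution iso2 (central_involution_SL2 fval detD onD F2).
have [b [Bb p'b ntb b2 bE2]] := lift_extend p_odd pS sBS loc2 Zt t2 ntt.
have Sb : b \in Aut S := subsetP sBS b Bb.
have [sE1S nSE1] := andP (local_normal loc1).
(* If [b] were trivial on S / E1 as well, it would be trivial modulo Phi(S), the intersection of
   [E1] and [E2], and hence a p-element. *)
have [s Ss nE1w] : exists2 s, s \in S & s^-1 * b s \notin E1.
  apply/exists_inP; rewrite -negb_forall_in; apply: contra ntb => /forall_inP bE1.
  have pb : p.-elt b.
    apply: (Aut_trivial_mod_Phi pS Sb) => s Ss.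
    by rewrite -(mixed_Phi p_pr pS loc1 loc2 iS1 iS2 neqE charF F2 natF fr ntv) inE bE1 ?bE2.
  by rewrite -order_eq1 (pnat_1 pb p'b).
set w := s^-1 * b s in nE1w.
have Sw : w \in S by rewrite groupM ?groupV ?Aut_mem.
(* An involution inverts every s^-1 b(s); on [E1] this becomes inversion of the regular unipotent
   [u] by [ca]. *)
have bw : b w = w^-1 by rewrite /w (AutM Sb) ?groupV ?Aut_mem // (AutV Sb) // b2 // invMg invgK.
have [a Aa Ea] := local_restr loc1 Bb.
have [phiM phi0 onto frho phiA] := fr.
have nI := Inn_normal (local_Aut loc1) (local_Inn loc1).
have Na := subsetP (normal_norm nI) a Aa.
have Aut_a := subsetP (local_Aut loc1) a Aa.
have a2 : a * a = 1.
  apply: (eq_Aut (A := E1)); rewrite ?groupM ?group1 // => x Ex.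
  by rewrite permM perm1 (Ea (a x)) ?Aut_mem // (Ea x Ex) b2 ?(subsetP sE1S).
pose ca := coset (Inn E1) a; pose u := coset (Inn E1) (conj_aut E1 w).
have Oa : ca \in A1 / Inn E1 by apply: mem_quotient.
have Ou : u \in A1 / Inn E1 := local_coset loc1 Sw.
have Aw := local_conj loc1 Sw; have Nw := subsetP (normal_norm nI) _ Aw.
have ca2 : ca * ca = 1 by rewrite -morphM //= a2 morph1.
have uau : u * ca * u = ca.
  rewrite /u /ca -!morphM ?groupM //=; congr coset.
  apply: (eq_Aut (A := E1)); rewrite ?groupM ?(subsetP (local_Aut loc1)) // => x Ex.
  rewrite !permM !(local_conjE loc1) ?Aut_mem ?memJ_norm ?(subsetP nSE1) //.
  have Sx := subsetP sE1S x Ex.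
  have -> : a (x ^ w) = (b x) ^ w^-1.
    by rewrite Ea ?memJ_norm ?(subsetP nSE1) // -bw -!(autmE Sb) morphJ.
  by rewrite conjgKV Ea.
have ntu : u != 1 by rewrite (local_coset_conj loc1).
have z2 : (rho ca *m rho ca = 1%:M)%R by rewrite -(repM frho) // ca2 (rep1 frho).
have zG g : g \in A1 / Inn E1 -> mxG rho (A1 / Inn E1) (rho ca *m rho g *m rho ca)%R.
  by move=> Og; exists (ca * g * ca); rewrite ?groupM // !(repM frho) ?groupM.
have uzu : (rho u *m rho ca *m rho u = rho ca)%R by rewrite -!(repM frho) ?groupM // uau.
have [rho' [frho' toA ofA]] := reflection_Opprime p_pr charF natF F2 frho ntv (local_spe loc1)
  Ou (local_p_elt pS loc1 Sw) ntu z2 zG uzu.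
by apply: (sym2_isog fval frho' _ detD onD F2) => //; apply: Opprime_sub.
Qed.

End Mixed.

Lemma Aut_of_inj (gT : finGroupType) (E : {group gT}) (f : gT -> gT) :
  {in E &, {morph f : x y / x * y}} -> {in E &, injective f} -> f @: E \subset E ->
  exists2 a, a \in Aut E & {in E, a =1 f}.
Proof.
move=> fM fI fE; exists (perm_in fI fE); last exact: perm_inE.
rewrite inE perm_in_on; apply/morphicP=> x y Ex Ey.
by rewrite !perm_inE ?groupM // fM.
Qed.

(** * Essential subgroups of saturated fusion systems *)

Section Fusion.
Variables (gT : finGroupType) (p : nat) (S : {group gT}) (F : {set gT} -> {set {ffun gT -> gT}}).
Hypothesis fus : is_fusion_system S F.

Lemma nrm_eq (P : {set gT}) (f g : gT -> gT) : {in P, f =1 g} -> nrm P f = nrm P g.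
Proof. by move=> e; apply/ffunP=> x; rewrite !ffunE; case: ifP => // /e. Qed.

Lemma nrm_imset (P : {set gT}) (f : gT -> gT) : nrm P f @: P = f @: P.
Proof. by apply: eq_in_imset => x Px; rewrite ffunE Px. Qed.

Lemma AutF_group_set (P : {group gT}) : P \subset S -> group_set (AutF F P).
Proof.
move=> sPS; have [_ [_ [conjP [_ [compP _]]]]] := fus.
apply/group_setP; split=> [|a b].
  rewrite inE group1; rewrite (@nrm_eq _ _ (conjg^~ 1)) ?conjP //.
  by move=> x _; rewrite perm1 conjg1.
move=> /setIdP[Aa Fa] /setIdP[Ab Fb]; apply/setIdP; split; first exact: groupM.
have im_a : nrm P a @: P = P by rewrite nrm_imset Aut_imset_id.
have := compP P _ (nrm P b) sPS Fa; rewrite im_a => /(_ Fb).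
rewrite (@nrm_eq _ _ (a * b)) // => x Px.
by rewrite permM !ffunE Px Aut_mem.
Qed.

Definition AutF_group (P : {group gT}) (sPS : P \subset S) := Group (AutF_group_set sPS).

Lemma nrm_conj_AutF (P : {group gT}) s : P \subset S -> s \in 'N_S(P) -> conj_aut P s \in AutF F P.
Proof.
move=> sPS /setIP[Ss Ns]; have [_ [_ [conjP _]]] := fus.
rewrite inE Aut_aut (@nrm_eq _ _ (conjg^~ s)) ?conjP // => x Px.
by rewrite norm_conj_autE.
Qed.

Lemma F_characteristic_normal (E : {group gT}) : E \subset S -> F_characteristic S F E -> E <| S.
Proof.
move=> sES chE; rewrite /normal sES; apply/subsetP=> s Ss; rewrite inE.
have Ns : s \in 'N_S(S) by rewrite inE Ss (subsetP (normG S)).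
rewrite -{2}(chE _ (nrm_conj_AutF (subxx _) Ns)); apply/subsetP=> _ /imsetP[x Ex ->].
apply/imsetP; exists x => //; rewrite norm_conj_autE ?(subsetP sES) // ?(subsetP (normG S)) //.
Qed.

Hypotheses (sat : saturated p S F) (E : {group gT}).
Hypotheses (ess : essential p S F E) (chE : F_characteristic S F E).

Lemma essential_local_data : local_data p S (AutF F S) E (AutF F E).
Proof.
have [_ [homP [conjP [resP _]]]] := fus.
have [sES centE fnE speE] := ess; have nES := F_characteristic_normal sES chE.
have nSE := normal_norm nES.
have NSE : 'N_S(E) = S by apply/setIidPl.
have [/(_ fnE)[fcE autE] /(_ _)recE] := sat sES.
have conjE : E :=: conjg^~ 1 @: E.
  by rewrite -[LHS]imset_id; apply: eq_imset => x; rewrite conjg1.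
have EE : (E : {set gT}) \in conjF F E.
  apply/imsetP; exists (nrm E (conjg^~ 1)); first exact: conjP.
  by rewrite nrm_imset -conjE.
have sylE : p.-Sylow(AutF F E) (conj_aut E @* S).
  by move: autE; rewrite /fully_automized /AutS NSE.
split=> //.
- exact: centE.
- by apply/subsetP=> a; rewrite inE => /andP[].
- move=> b Fb; have := Fb; rewrite inE => /andP[Sb Fb'].
  have bE x : x \in E -> b x \in E by move=> Ex; rewrite -(chE Fb) imset_f.
  have [a Ea ab] : exists2 a, a \in Aut E & {in E, a =1 b}.
    apply: Aut_of_inj => [x y Ex Ey|x y _ _|]; last by rewrite chE.
      by rewrite (AutM Sb) ?(subsetP sES).
    exact: perm_inj.
  exists a => //; rewrite inE Ea; have := resP S E _ (subxx _) sES Fb'.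
  rewrite (@nrm_eq _ _ a) // => x Ex.
  by rewrite ffunE (subsetP sES) // ab.
move=> a; rewrite inE => /andP[Ea Fa] Na.
have im_a : nrm E a @: E = E by rewrite nrm_imset Aut_imset_id.
have [g Fg Eg] := recE fcE E (nrm E a) Fa im_a.
(* As [a] normalises Aut_S(E), it turns conjugation by any [y] of [S] into conjugation by some [z]
   of [S], so the extension axiom reaches all of [S]. *)
have NphiE : Nphi S E E (nrm E a) = S.
  apply/setP=> y; rewrite inE NSE; apply: andb_idr => Sy; apply/exists_inP.
  have Ny := subsetP nSE y Sy.
  have : conj_aut E y ^ a \in conj_aut E @* S by rewrite memJ_norm // mem_morphim.
  case/morphimP=> z Nz Sz ez; exists z => //; apply/forall_inP=> x Ex.
  rewrite !ffunE Ex memJ_norm // Ex; apply/eqP.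
  have := congr1 (fun b : {perm gT} => b (a x)) ez.
  by rewrite conjgE !permM permK !norm_conj_autE ?Aut_mem.
rewrite NphiE in Fg; have [gM gI gS g1] := homP S g (subxx _) Fg.
have [b Sb bg] := Aut_of_inj gM gI gS.
exists b; last first.
  by move=> x Ex; rewrite bg ?(subsetP sES) // Eg // ffunE Ex.
rewrite inE Sb; have -> : nrm S b = g => //.
apply/ffunP=> x; rewrite ffunE; case: ifP => [Sx|nSx]; first exact: bg.
by rewrite g1 // inE nSx.
Qed.

End Fusion.

Section LocalDichotomy.
Variables (gT : finGroupType) (p : nat) (S E : {group gT}) (B A : {group {perm gT}}).
Hypotheses (p_pr : prime p) (pS : p.-group S) (loc : local_data p S B E A).
Variables (F : fieldType) (aT : finGroupType) (D : {group aT}) (val : aT -> 'M[F]_2).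
Hypotheses (charF : p \in [pchar F]%R) (F2 : (2%:R != 0 :> F)%R).
Hypothesis natF : forall a : F, exists k : nat, a = (k%:R)%R.
Hypotheses (fval : faithful_rep D val) (detD : forall x, x \in D -> (\det (val x) = 1)%R).
Hypothesis onD : forall A, (\det A = 1)%R -> mxG val D A.
Hypothesis cardD : forall Q : {group aT}, Q \subset D -> p.-group Q -> #|Q| %| p.

Definition regular_on :=
  exists phi (rho : coset_of (Inn E) -> 'M[F]_3),
    [/\ frattini_rep A phi rho, no_transvection (A / Inn E) rho & #|E : 'Phi(E)| = (p ^ 3)%N].

(** Sectional rank bounds the dimension by 3, and dimension 1 has no nontrivial unipotent. In both
    surviving cases p-subgroups of the outer group have order dividing p, which gives the index. *)
Lemma local_dichotomy n phi (rho : coset_of (Inn E) -> 'M[F]_n.+1) :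
  frattini_rep A phi rho -> #|E : 'Phi(E)| = (p ^ n.+1)%N -> sect_rank_le E 3 ->
  #|S : E| = p /\ (Opprime p (A / Inn E) \isog D \/ regular_on).
Proof.
move=> fr iE rk; have pE := pgroupS (normal_sub (local_normal loc)) pS.
have n2 : n.+1 <= 3.
  have := sect_rank_Phi p_pr rk pE (subxx _).
  by rewrite iE leq_exp2l // prime_gt1.
have spe := local_spe loc.
have main : Opprime p (A / Inn E) \isog D \/ regular_on.
  case: n n2 phi rho fr iE => [|[|[|//]]] _ phi rho fr iE; have [_ _ _ frho _] := fr.
  - by case: (rep1_no_spe p_pr charF spe frho).
  - by left; apply: (rep2_Opprime p_pr charF natF fval detD onD spe frho).
  have [iso|ntv] := rep3_dichotomy p_pr charF natF fval detD onD spe frho; first by left.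
  by right; exists phi, rho.
split=> //; apply: (local_index p_pr loc) => Q sQO pQ.
case: main => [/isogP[f injf defD] | [phi' [rho' [[_ _ _ frho' _] ntv _]]]]; last first.
  exact: (no_transvection_card p_pr charF natF F2 frho' ntv).
have sQ : Q \subset Opprime p (A / Inn E).
  apply/subsetP=> x Qx; apply: mem_gen.
  by rewrite inE (subsetP sQO) // (mem_p_elt pQ).
by rewrite -(card_injm injf sQ) cardD ?morphim_pgroup // -defD morphimS.
Qed.

End LocalDichotomy.

Theorem theorem1p18 (gT : finGroupType) (p : nat) (S E1 E2 : {group gT})
    (F : {set gT} -> {set {ffun gT -> gT}}) :
  prime p -> odd p -> p.-group S ->
  is_fusion_system S F -> saturated p S F ->
  essential p S F E1 -> essential p S F E2 -> E1 :!=: E2 ->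
  F_characteristic S F E1 -> F_characteristic S F E2 ->
  sect_rank_le E1 3 -> sect_rank_le E2 3 ->
  let case12 (A B : {group gT}) :=
    (Opprime p (OutF F A) \isog SL2 p /\ Opprime p (OutF F B) \isog SL2 p)
    \/ [/\ Opprime p (OutF F A) \isog PSL2 p,
           Opprime p (OutF F B) \isog SL2 p & grank S = 2] in
  case12 E1 E2 \/ case12 E2 E1.
Proof.
move=> p_pr p_odd pS fus sat ess1 ess2 neqE ch1 ch2 rk1 rk2 case12.
have charF := pchar_Fp p_pr.
have F2 : (2%:R != 0 :> 'F_p)%R.
  rewrite -(dvdn_pcharf charF); apply/negP=> /dvdn_leq -/(_ isT).
  by rewrite leqNgt odd_prime_gt2.
have [sE1S _ _ _] := ess1; have [sE2S _ _ _] := ess2.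
pose A1 := AutF_group fus sE1S; pose A2 := AutF_group fus sE2S.
pose B := AutF_group fus (subxx S).
have loc1 : local_data p S B E1 A1 := essential_local_data fus sat ess1 ch1.
have loc2 : local_data p S B E2 A2 := essential_local_data fus sat ess2 ch2.
have sBS : B \subset Aut S by apply/subsetP=> a; rewrite inE => /andP[].
have dich (E : {group gT}) (A : {group {perm gT}}) : local_data p S B E A -> sect_rank_le E 3 ->
    #|S : E| = p /\ (Opprime p (A / Inn E) \isog SL2 p \/ regular_on p E A 'F_p).
  move=> loc rk; have pE := pgroupS (normal_sub (local_normal loc)) pS.
  have [n [phi [rho [fr iE]]]] := frattini_rep_exists p_pr pE (local_Aut loc) (local_Inn loc) (local_spe loc).
  exact: (local_dichotomy p_pr pS loc charF F2 (@Fp_natF p) (SL2_faithful_rep p) (@SL2_det p)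
    (@SL2_onto p) (SL2_card_pgroup p_pr) fr iE rk).
have [iS1 d1] := dich _ _ loc1 rk1; have [iS2 d2] := dich _ _ loc2 rk2.
have mixed (E E' : {group gT}) (A A' : {group {perm gT}}) : local_data p S B E A -> local_data p S B E' A' ->
    #|S : E| = p -> #|S : E'| = p -> E :!=: E' -> regular_on p E A 'F_p ->
    Opprime p (A' / Inn E') \isog SL2 p ->
    Opprime p (A / Inn E) \isog PSL2 p /\ grank S = 2.
  move=> loc loc' iS iS' neq [phi [rho [fr ntv _]]] iso; split.
    exact: (mixed_PSL2 p_pr p_odd pS sBS loc loc' iS iS' neq charF F2 (@Fp_natF p) (SL2_faithful_rep p) (@SL2_det p)
      (@SL2_onto p) fr ntv iso).
  exact: (mixed_grank p_pr pS loc loc' iS iS' neq charF F2 (@Fp_natF p) fr ntv).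
case: d1 d2 => [iso1 | reg1] [iso2 | reg2].
- by left; left.
- have neqE' : E2 :!=: E1 by rewrite eq_sym.
  have [iso r] := mixed _ _ _ _ loc2 loc1 iS2 iS1 neqE' reg2 iso1.
  by right; right.
- have [iso r] := mixed _ _ _ _ loc1 loc2 iS1 iS2 neqE reg1 iso2.
  by left; right.
(* Equal orders turn an inclusion into an equality, so neither subgroup contains the other. *)
have oE : #|E1| = #|E2|.
  by apply/eqP; rewrite -(eqn_pmul2r (prime_gt0 p_pr)) -{1}iS1 -{1}iS2 !Lagrange.
have [phi1 [rho1 [fr1 ntv1 i1]]] := reg1; have [phi2 [rho2 [fr2 ntv2 i2]]] := reg2.
case: (two_regular_contra p_pr p_odd pS loc1 loc2 rk1 rk2 i1 i2 _ _ charF F2 (@Fp_natF p) fr1 ntv1 fr2 ntv2).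
  by apply: contra neqE => s12; rewrite eqEcard s12 oE leqnn.
by apply: contra neqE => s21; rewrite eq_sym eqEcard s21 oE leqnn.
Qed.
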